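(* Every inductively tame arrangement $\mathcal{A}\in\mathcal{IT}$ is tame, and the tameness of an inductively tame arrangement is combinatorial: if $\mathcal{A}\in\mathcal{IT}_\ell$ is an arrangement in $\mathbb{K}^\ell$ and $\mathcal{B}$ is an arrangement in $\mathbb{K}^\ell$ whose intersection lattice $L(\mathcal{B})$ is isomorphic to $L(\mathcal{A})$, then $\mathcal{B}$ is tame as well.
   Context: Let $\mathbb{K}$ be a field, $V=\mathbb{K}^\ell$, $S=\mathbb{K}[x_1,\ldots,x_\ell]$. An arrangement $\mathcal{A}$ in $V$ is a finite set of linear hyperplanes, each $H\in\mathcal{A}$ with a fixed defining linear form $\alpha_H$; $Q(\mathcal{A})=\prod_{H\in\mathcal{A}}\alpha_H$. Let $\Omega^1_V=\bigoplus_iS\,dx_i$, $\Omega^p_V=\wedge^p\Omega^1_V$, and $$\Omega^p(\mathcal{A})=\{\omega\in \tfrac{1}{Q(\mathcal{A})}\Omega^p_V \mid Q(\mathcal{A})\,d\alpha_H\wedge\omega\in\alpha_H\Omega^{p+1}_V\ (\forall H\in\mathcal{A})\}.$$ $\mathcal{A}$ is free if $\Omega^1(\mathcal{A})$ is a free $S$-module, and tame if $\mathrm{pd}_S\Omega^p(\mathcal{A})\le p$ for all $0\le p\le\ell$. The intersection lattice $L(\mathcal{A})$ is the set of all intersections of subsets of $\mathcal{A}$, ordered by reverse inclusion. For $x\in V$, $\mathcal{A}_x=\{L\in\mathcal{A}\mid x\in L\}$. For $H\in\mathcal{A}$, $\mathcal{A}^H=\{H\cap L\mid L\in\mathcal{A}\setminus\{H\}\}$,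 an arrangement in $H\cong\mathbb{K}^{\ell-1}$. Stair-free arrangements: the stairly free (stair-free) arrangements form a class of arrangements over $\mathbb{K}$ introduced in earlier work of T. Abe. Treat it as a fixed class with the two properties that (i) every stair-free arrangement is free, and (ii) membership depends only on the intersection lattice, i.e. if $\mathcal{A}$, $\mathcal{B}$ are arrangements in the same space with $L(\mathcal{A})\cong L(\mathcal{B})$ and $\mathcal{A}$ is stair-free, so is $\mathcal{B}$. An arrangement $\mathcal{A}$ is stairly locally free along a subset $X\subset V$ if $\mathcal{A}_x$ is stair-free for all $0\ne x\in X$. Inductively tame arrangements: define sets $\mathcal{IT}_\ell$ of arrangements in $\mathbb{K}^\ell$ recursively. If $\ell\le3$, all arrangements in $\mathbb{K}^\ell$ are in $\mathcal{IT}_\ell$. For all $\ell$ the empty arrangement is in $\mathcal{IT}_\ell$. For $\ell\ge4$, an arrangement $\mathcal{A}$ in $\mathbb{K}^\ell$ belongs to $\mathcal{IT}_\ell$ if either (1) there is $H\in\mathcal{A}$ such that $\mathcal{A}$ and $\mathcal{A}\setminus\{H\}$ are stairly locally free along $H$ and $\mathcal{A}\setminus\{H\}\in\mathcal{IT}_\ell$; or (2) there is $H\in\mathcal{A}$ such that $\mathcal{A}\setminus\{H\}$ is stairly locally free along $H$, $\mathcal{A}\setminus\{H\}\in\mathcal{IT}_\ell$ and $\mathcal{A}^H\in\mathcal{IT}_{\ell-1}$. ($\mathcal{IT}_\ell$ is the smallest such class.) $\mathcal{IT}=\bigcup_\ell\mathcal{IT}_\ell$; its members are called inductively tame. *)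

(* Defs.v *)
From HB Require Import structures.
From mathcomp Require Import all_boot all_order all_algebra.
From mathcomp Require Import finmap mpoly boolp.
Set Implicit Arguments.
Unset Strict Implicit.
Unset Printing Implicit Defensive.
Import GRing.Theory.
Local Open Scope fset_scope.
Local Open Scope ring_scope.

Section Modules.
Variable R : nzRingType.

(* The basis [b : I -> M] may be infinite. *)
Definition free_module (M : lmodType R) : Prop :=
  exists (I : choiceType) (b : I -> M), forall m : M,
    exists! c : {fsfun I -> R with 0}, m = \sum_(i <- finsupp c) c i *: b i.

Definition projective_module (P : lmodType R) : Prop :=
  forall (M N : lmodType R) (g : {linear M -> N}) (f : {linear P -> N}),
    (forall y, exists x, g x = y) ->
    exists h : {linear P -> M}, forall x, g (h x) = f x.

(* [pd M <= n]: there is an exact sequence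
     0 -> P n -> ... -> P 1 -> P 0 -> M -> 0
   with all the P i projective. *)
Definition pd_le (M : lmodType R) (n : nat) : Prop :=
  exists (P : nat -> lmodType R)
         (d : forall i, {linear P i.+1 -> P i}) (e : {linear P 0%N -> M}),
    [/\ (forall i, projective_module (P i))
          /\ (forall i, (n < i)%N -> forall x : P i, x = 0),
        forall m, exists x, e x = m,
        forall x, e x = 0 <-> exists y, d 0%N y = x
      & forall i x, d i x = 0 <-> exists y, d i.+1 y = x].

End Modules.

Section Arrangements.
Variable K : fieldType.

Definition is_hyperplane l (H : {vspace 'rV[K]_l}) : bool := (\dim H).+1 == l.

Definition hyperplane l := {H : {vspace 'rV[K]_l} | is_hyperplane H}.

Definition arrangement l := {fset hyperplane l}.

Definition localization l (A : arrangement l) (x : 'rV[K]_l) : arrangement l :=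
  [fset H in A | x \in val H].

(* [B] is the restriction A^H, read in K^l through the linear isomorphism
   [phi] from K^l onto H. *)
Definition is_restriction l (A : arrangement l.+1) (H : hyperplane l.+1)
    (phi : 'Hom('rV[K]_l, 'rV[K]_l.+1)) (B : arrangement l) : Prop :=
  [/\ lker phi = 0%VS,
      limg phi = val H
    & [fset (phi @: val L)%VS | L in B]
        = [fset (val H :&: val L)%VS | L in A `\ H]].

Definition intersection_lattice l (A : arrangement l) :
    {fset {vspace 'rV[K]_l}} :=
  [fset (\bigcap_(H <- X) val H)%VS | X : {fset hyperplane l} in fpowerset A].

(* The order on L(A) is reverse inclusion. *)
Definition flat_le l (A : arrangement l) (X Y : intersection_lattice A) : bool :=
  (val Y <= val X)%VS.

Definition lattice_iso l (A B : arrangement l) : Prop :=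
  exists f : intersection_lattice A -> intersection_lattice B,
    bijective f /\ forall X Y, flat_le (f X) (f Y) = flat_le X Y.

Lemma defining_vector_ex l (H : hyperplane l) :
  exists a : 'cV[K]_l, lker (linfun (mulmxr a : 'rV_l -> 'rV_1)) == val H.
Proof.
case: H => H /= /eqP dimH.
pose M := \matrix_(i < \dim H) (vbasis H)`_i.
have rM : (\rank M^T < l)%N by rewrite -[X in (_ < X)%N]dimH ltnS rank_leq_col.
have nz : nz_row (kermx M^T) != 0.
  by rewrite nz_row_eq0 -mxrank_eq0 mxrank_ker subn_eq0 -ltnNge.
have Ma : M *m (nz_row (kermx M^T))^T = 0.
  have /sub_kermxP h := nz_row_sub (kermx M^T).
  by apply: trmx_inj; rewrite trmx_mul trmxK h trmx0.
exists (nz_row (kermx M^T))^T; set a := (_)^T in Ma *.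
have anz : a != 0 by rewrite trmx_eq0.
set f := linfun _.
have sub : (H <= lker f)%VS.
  apply/subvP => x /coord_vbasis ->; rewrite memv_ker linear_sum /=.
  apply/eqP/big1 => i _; rewrite linearZ /= lfunE /=.
  have <- : row i M = (vbasis H)`_i by rewrite rowK.
  by rewrite -row_mul Ma row0 scaler0.
rewrite eq_sym eqEdim sub /=.
have dimV : \dim (fullv : {vspace 'rV[K]_l}) = l by rewrite dimvf /dim /= mul1n.
have := limg_ker_dim f fullv; rewrite capfv dimV -[RHS]dimH.
have [i ai] : exists i, a i 0 != 0.
  apply/existsP; apply: contraNT anz => /existsPn h.
  by apply/eqP/matrixP => i j; rewrite ord1 [RHS]mxE; apply/eqP; have := h i; rewrite negbK.
have img0 : (0 < \dim (f @: fullv))%N.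
  rewrite lt0n dimv_eq0; apply: contraNneq ai => img0.
  have : f (delta_mx 0 i) \in (f @: fullv)%VS by rewrite memv_img ?memvf.
  rewrite img0 memv0 lfunE /= => /eqP/matrixP/(_ 0 0).
  by rewrite -rowE !mxE => ->.
by move=> e; rewrite -ltnS -e -addn1 leq_add2l.
Qed.

Definition defining_vector l (H : hyperplane l) : 'cV[K]_l :=
  xchoose (defining_vector_ex H).

Definition defining_form l (H : hyperplane l) : {mpoly K[l]} :=
  \sum_(i < l) defining_vector H i 0 *: 'X_i.

Definition defining_poly l (A : arrangement l) : {mpoly K[l]} :=
  \prod_(H <- A) defining_form H.

End Arrangements.

(* The exterior algebra on dx_0, ..., dx_(l-1) over R: the value at
   I = {i_1 < ... < i_p} is the coefficient of dx_(i_1) /\ ... /\ dx_(i_p). *)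
Notation extalg R l := {ffun {set 'I_l} -> R}.

Section ExteriorAlgebra.
Variables (R : comNzRingType) (l : nat).

Definition is_pform (p : nat) (w : extalg R l) : Prop :=
  forall I : {set 'I_l}, #|I| != p -> w I = 0.

Definition inversions (I J : {set 'I_l}) : nat :=
  #|[set ij in finset.setX I J | (ij.2 < ij.1)%N]|.

(* The sign is that of the shuffle sorting dx_I /\ dx_(M \ I) into dx_M. *)
Definition wedge (v w : extalg R l) : extalg R l :=
  [ffun M : {set 'I_l} => \sum_(I : {set 'I_l} | I \subset M)
     (-1) ^+ inversions I (M :\: I) * v I * w (M :\: I)].

End ExteriorAlgebra.

Section LogarithmicForms.
Variables (K : fieldType) (l : nat).
Local Notation S := {mpoly K[l]}.

Definition ratfun := {fraction S}.
HB.instance Definition _ := GRing.Field.on ratfun.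

Definition ratfun_scale (f : S) (g : ratfun) : ratfun := tofrac f * g.

Lemma ratfun_scaleA a b v :
  ratfun_scale a (ratfun_scale b v) = ratfun_scale (a * b) v.
Proof. by rewrite /ratfun_scale tofracM mulrA. Qed.
Lemma ratfun_scale1 : left_id 1 ratfun_scale.
Proof. by move=> v; rewrite /ratfun_scale tofrac1 mul1r. Qed.
Lemma ratfun_scaleDr : right_distributive ratfun_scale +%R.
Proof. by move=> a u v; rewrite /ratfun_scale mulrDr. Qed.
Lemma ratfun_scaleDl v : {morph ratfun_scale^~ v : a b / a + b}.
Proof. by move=> a b; rewrite /ratfun_scale tofracD mulrDl. Qed.

HB.instance Definition _ := GRing.Zmodule_isLmodule.Build S ratfun
  ratfun_scaleA ratfun_scale1 ratfun_scaleDr ratfun_scaleDl.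

Local Notation ratforms := (extalg ratfun l).

Definition to_ratform (w : extalg S l) : ratforms :=
  [ffun I : {set 'I_l} => tofrac (w I) : ratfun].

Definition differential (f : S) : extalg S l :=
  [ffun I : {set 'I_l} => \sum_(i < l | I == [set i]) f^`M(i)].

Variable A : arrangement K l.

(* The first clause says w is in (1/Q(A)) Omega^p_V, the second that
   Q(A) d(alpha_H) /\ w is in alpha_H Omega^(p+1)_V for all H in A. *)
Definition is_logform (p : nat) (w : ratforms) : Prop :=
  (exists2 t : extalg S l, is_pform p t
     & w = [ffun I : {set 'I_l} => (tofrac (t I) / tofrac (defining_poly A) : ratfun)])
  /\ (forall H, H \in A -> exists2 t : extalg S l, is_pform p.+1 t
     & defining_poly A *:
         (wedge (to_ratform (differential (defining_form H))) w : ratforms)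
       = defining_form H *: to_ratform t).

Definition logform_pred (p : nat) : {pred ratforms} :=
  fun w => `[< is_logform p w >].

Lemma logform_submod_closed p : submod_closed (logform_pred p).
Proof.
have scE (f : S) (w : ratforms) I : (f *: w) I = tofrac f * w I.
  by rewrite !ffunE.
have wD (v u w : ratforms) c :
    wedge v (c *: u + w) = c *: (wedge v u : ratforms) + wedge v w.
  apply/ffunP => J; rewrite [RHS]ffunE scE !ffunE big_distrr -big_split /=.
  by apply: eq_bigr => I _; rewrite ffunE scE mulrDr mulrCA.
split.
  apply/asboolP; split=> [|H _].
    exists 0 => [I _|]; first by rewrite ffunE.
    by apply/ffunP => I; rewrite !ffunE tofrac0 mul0r.
  exists 0 => [I _|]; first by rewrite ffunE.
  have := wD (to_ratform (differential (defining_form H))) 0 0 (-1).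
  rewrite scaler0 addr0 scaleN1r addNr => ->; rewrite scaler0.
  by apply/ffunP => I; rewrite scE !ffunE tofrac0 mulr0.
move=> c u v /asboolP[[s hs us] hu] /asboolP[[t ht vt] hv].
apply/asboolP; split=> [|H HA].
  exists [ffun I : {set 'I_l} => c * s I + t I] => [I hI|].
    by rewrite ffunE hs ?ht // mulr0 addr0.
  apply/ffunP => I; rewrite [LHS]ffunE scE us vt !ffunE tofracD tofracM.
  by rewrite mulrDl mulrA.
have [s' hs' us'] := hu H HA; have [t' ht' vt'] := hv H HA.
exists [ffun I : {set 'I_l} => c * s' I + t' I] => [I hI|].
  by rewrite ffunE hs' ?ht' // mulr0 addr0.
rewrite wD scalerDr scalerA mulrC -scalerA us' vt'.
apply/ffunP => I; rewrite [LHS]ffunE !scE !ffunE tofracD tofracM.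
by rewrite mulrDr mulrCA.
Qed.

HB.instance Definition _ p :=
  GRing.isSubmodClosed.Build S ratforms (logform_pred p) (logform_submod_closed p).

Record Omega (p : nat) : Type :=
  LogForm { logform_val : ratforms; _ : logform_val \in logform_pred p }.

HB.instance Definition _ p := [isSub for @logform_val p].
HB.instance Definition _ p := [Choice of Omega p by <:].
HB.instance Definition _ p := [SubChoice_isSubLmodule of Omega p by <:].

Definition free_arrangement : Prop := free_module (Omega 1).

Definition tame : Prop := forall p, (p <= l)%N -> pd_le (Omega p) p.

End LogarithmicForms.

Section InductivelyTame.
Variable K : fieldType.

(* SF stands for the class of stair-free arrangements, which is a parameter. *)
Variable SF : forall l, arrangement K l -> Prop.

Definition stairly_locally_free l (A : arrangement K l) (X : {vspace 'rV[K]_l}) :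
    Prop :=
  forall x, x \in X -> x != 0 -> SF (localization A x).

(* In the last clause the identification phi of K^l with H is arbitrary. *)
Inductive inductively_tame : forall l, arrangement K l -> Prop :=
| IT_small l (A : arrangement K l) : (l <= 3)%N -> inductively_tame A
| IT_empty l : inductively_tame (fset0 : arrangement K l)
| IT_deletion l (A : arrangement K l) (H : hyperplane K l) :
    (4 <= l)%N -> H \in A ->
    stairly_locally_free A (val H) ->
    stairly_locally_free (A `\ H) (val H) ->
    inductively_tame (A `\ H) ->
    inductively_tame A
| IT_restriction l (A : arrangement K l.+1) (H : hyperplane K l.+1)
    (phi : 'Hom('rV[K]_l, 'rV[K]_l.+1)) (B : arrangement K l) :
    (4 <= l.+1)%N -> H \in A ->
    stairly_locally_free (A `\ H) (val H) ->
    inductively_tame (A `\ H) ->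
    is_restriction A H phi B ->
    inductively_tame B ->
    inductively_tame A.

End InductivelyTame.

(* Main.v *)
(* Write t = Q(A) w, so that Omega^p(A) becomes the module M^p(A) of polynomial
   p-forms t with alpha_L | d alpha_L /\ t for all L in A.  For H in A and
   A' = A \ H there are a residue sequence and a restriction sequence
     0 -> M^(p+1)(A') --alpha_H--> M^(p+1)(A) -> M^p(A^H),
     0 -> M^(p+1)(A) -> M^(p+1)(A') -> M^(p+1)(A^H),
   the second map of the latter being the restriction to H divided by the
   product of alpha_X^(m_X - 1), X in A^H.  Saito's criterion shows that their
   last maps are onto when A' (resp. A) is free.  If this only holds locally at
   the nonzero points of H, the cokernel is supported at the origin, and an
   element of its socle would give a nonzero Koszul cohomology class, which depth
   rules out as soon as pd M^(p+1)(A') (resp. A) <= l - 3.  As every M^p(A) is a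
   second syzygy, Hilbert's syzygy theorem settles p >= l - 2, and below this
   range the two sequences bound the projective dimension of M^p(A) by induction
   on p (deletion), the first one alone does so when A^H is tame (restriction).

   For the combinatorial part, a lattice isomorphism is the same as a bijection of
   the hyperplanes preserving the dimensions of all intersections.  It carries
   deletions, restrictions and the localizations at nonzero points of one
   arrangement to those of the other. *)
Require Import Defs.
From HB Require Import structures.
From mathcomp Require Import all_boot all_order all_algebra.
From mathcomp Require Import finmap mpoly boolp ring zify.
From mathcomp Require monalg classical_sets.
Set Implicit Arguments.
Unset Strict Implicit.
Unset Printing Implicit Defensive.
Import GRing.Theory.
Local Open Scope ring_scope.

(** * Projective dimension *)

(** The field is arbitrary and local freeness is known only at points of K^l, so the support of a
    cokernel cannot be tested at all primes. No ring is localized: a statement at x is read as a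
    statement up to a product of forms of hyperplanes missing x. Such products push an element
    outside the image towards one that is carried into the image by linear forms whose only common
    zero is the origin, hence by all variables; this is how a socle element is found without leaving
    the K-points. The bound l - 3 is the price of lifting that element. The lifting uses vanishing
    Koszul H^2 of the left module and H^1 of the middle one, that is depth 3 and depth 2, and depth
    2 comes with being a second syzygy. Freeness of a localization is used through a pair of
    matrices with product Q(A), which turns surjectivity into divisibility of the values of forms on
    vector fields. In the deletion case nothing is known about A^H, so the induction must bound
    M^p(A^H) as well, by p + 1 over S. *)

Section Submodules.
Variables (R : nzRingType) (M : lmodType R).

(** Kernels, images and modules of logarithmic forms are cut out by undecidable conditions, so
    membership is a [Prop], made boolean classically in [submod_pred]. *)
Record submodule := Submodule {
  in_submod :> M -> Prop;
  in_submod_closed :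
    in_submod 0 /\ forall a x y, in_submod x -> in_submod y -> in_submod (a *: x + y) }.

Variable U : submodule.

Definition submod_pred : {pred M} := fun x => `[< U x >].

Lemma submod_pred_closed : submod_closed submod_pred.
Proof.
have [U0 UD] := in_submod_closed U.
split; first exact/asboolP.
by move=> a x y /asboolP hx /asboolP hy; apply/asboolP/UD.
Qed.

HB.instance Definition _ :=
  GRing.isSubmodClosed.Build R M submod_pred submod_pred_closed.

Record submod_type := SubmodElt
  { submod_val : M; _ : submod_val \in submod_pred }.

HB.instance Definition _ := [isSub for submod_val].
HB.instance Definition _ := [Choice of submod_type by <:].
HB.instance Definition _ := [SubChoice_isSubLmodule of submod_type by <:].

Definition submod_incl (x : submod_type) : M := val x.
Lemma submod_incl_linear : linear submod_incl.
Proof. by []. Qed.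
HB.instance Definition _ :=
  GRing.isLinear.Build R submod_type M _ submod_incl submod_incl_linear.

Lemma submod_valP (x : submod_type) : U (val x).
Proof. exact: (asboolW (valP x)). Qed.

Definition submod_elt x (Ux : U x) : submod_type := SubmodElt (asboolT Ux).

Lemma submod_eltP x : U x -> exists u : submod_type, submod_incl u = x.
Proof. by move=> Ux; exists (submod_elt Ux). Qed.

Lemma submod_incl_inj : injective submod_incl.
Proof. exact: val_inj. Qed.

Lemma submod_corestrict (N : lmodType R) (f : {linear N -> M}) :
  (forall x, U (f x)) -> exists g : {linear N -> submod_type}, forall x, submod_incl (g x) = f x.
Proof.
move=> h; pose g x := submod_elt (h x).
have gl : linear g by move=> a x y; apply: val_inj; rewrite /= linearP.
pose gL : {linear N -> submod_type} := HB.pack g (GRing.isLinear.Build R _ _ _ g gl).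
by exists gL.
Qed.

End Submodules.
Arguments submod_incl {R M U}.

Lemma linear_ext (R : nzRingType) (M N : lmodType R) (f : M -> N) :
  linear f -> exists g : {linear M -> N}, forall x, g x = f x.
Proof.
move=> fl; pose g : {linear M -> N} := HB.pack f (GRing.isLinear.Build R _ _ _ f fl).
by exists g.
Qed.

Section Exact.
Variable R : nzRingType.

Definition ses (A B C : lmodType R) (f : {linear A -> B}) (g : {linear B -> C}) :=
  [/\ injective f, (forall y, exists x, g x = y)
    & forall x, g x = 0 <-> exists y, f y = x].

Lemma linear_inj0 (A B : lmodType R) (f : {linear A -> B}) :
  (forall x, f x = 0 -> x = 0) -> injective f.
Proof.
by move=> h x y e; apply/eqP; rewrite -subr_eq0; apply/eqP/h; rewrite linearB /= e subrr.
Qed.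

Lemma surj_ses (B C : lmodType R) (g : {linear B -> C}) :
  (forall y, exists x, g x = y) ->
  exists (A : lmodType R) (f : {linear A -> B}), ses f g.
Proof.
move=> gs.
have cl : g 0 = 0 /\ forall a x y, g x = 0 -> g y = 0 -> g (a *: x + y) = 0.
  split; first exact: linear0.
  by move=> a x y hx hy; rewrite linearP hx hy scaler0 addr0.
pose U := @Submodule R B (fun x => g x = 0) cl.
exists (submod_type U), (submod_incl : {linear _ -> _}); split=> //.
- exact: submod_incl_inj.
- move=> x; split; first by exact: (@submod_eltP _ _ U).
  by case=> y <-; exact: (submod_valP y).
Qed.

Lemma inj_lift (A B C : lmodType R) (f : {linear A -> B}) (h : {linear C -> B}) :
  injective f -> (forall x, exists y, f y = h x) ->
  exists k : {linear C -> A}, forall x, f (k x) = h x.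
Proof.
move=> fi hx; pose k x := projT1 (cid (hx x)).
have kE x : f (k x) = h x by exact: (projT2 (cid (hx x))).
have [|g gE] := @linear_ext _ _ _ k.
  by move=> a x y; apply: fi; rewrite linearP !kE linearP.
by exists g => x; rewrite gE.
Qed.

Lemma ses_comp0 (A B C : lmodType R) (f : {linear A -> B}) (g : {linear B -> C}) :
  ses f g -> forall x, g (f x) = 0.
Proof. by case=> _ _ h x; apply/h; exists x. Qed.

(** Peels off one syzygy at a time instead of asking for a whole resolution as [pd_le] does, which
    suits induction on n; [pdim_pd_le] and [pd_pdim_le] show that both notions agree. *)
Fixpoint pdim_le (n : nat) (M : lmodType R) : Prop :=
  match n with
  | 0 => projective_module M
  | n'.+1 => exists (P A : lmodType R) (f : {linear A -> P}) (g : {linear P -> M}),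
      [/\ projective_module P, ses f g & pdim_le n' A]
  end.

Lemma projective_retract (P M : lmodType R) (i : {linear M -> P}) (r : {linear P -> M}) :
  projective_module P -> (forall x, r (i x) = x) -> projective_module M.
Proof.
move=> PP ri A B g f gs.
have [h hE] := PP A B g (f \o r : {linear _ -> _}) gs.
by exists (h \o i : {linear _ -> _}) => x /=; rewrite hE /= ri.
Qed.

Lemma pdim_le_iso n (M N : lmodType R) (f : {linear M -> N}) :
  bijective f -> pdim_le n M -> pdim_le n N.
Proof.
case=> f' fK f'K.
have f'l : linear f'.
  by move=> a x y; apply: (can_inj fK); rewrite linearP !f'K.
have [k kE] := linear_ext f'l.
case: n => [|n] /=; first by move=> PM; apply: (projective_retract (i := k) (r := f) PM) => x; rewrite kE f'K.
case=> P [A [u [v [PP [ui vs ex] pA]]]].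
exists P, A, u, (f \o v : {linear _ -> _}); split=> //; split=> // [y|x].
  by have [x vx] := vs (f' y); exists x; rewrite /= vx f'K.
rewrite -ex /=; split=> [|->]; last exact: linear0.
by move=> h; apply: (can_inj fK); rewrite h linear0.
Qed.

Lemma projective_zero (M : lmodType R) : (forall x : M, x = 0) -> projective_module M.
Proof.
move=> M0 A B g f gs.
exists (\0 : {linear M -> A}) => x; rewrite (M0 x) !linear0 //.
Qed.

Definition pairL (A B : lmodType R) : lmodType R := (A * B)%type.

Lemma projective_pair (P Q : lmodType R) :
  projective_module P -> projective_module Q -> projective_module (pairL P Q).
Proof.
move=> PP PQ A B g f gs.
have i1l : linear (fun x : P => (x, 0) : pairL P Q).
  by move=> a x y; congr pair; rewrite /= scaler0 addr0.
have i2l : linear (fun x : Q => (0, x) : pairL P Q).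
  by move=> a x y; congr pair; rewrite /= scaler0 addr0.
have [i1 i1E] := linear_ext i1l; have [i2 i2E] := linear_ext i2l.
have [h1 h1E] := PP A B g (f \o i1 : {linear _ -> _}) gs.
have [h2 h2E] := PQ A B g (f \o i2 : {linear _ -> _}) gs.
have hl : linear (fun x : pairL P Q => h1 x.1 + h2 x.2).
  by move=> a x y /=; rewrite !linearP /= scalerDr addrACA.
have [h hE] := linear_ext hl; exists h => x.
rewrite hE linearD h1E h2E /= i1E i2E -linearD; congr (f _).
by rewrite [x in RHS]surjective_pairing; congr pair; rewrite /= ?addr0 ?add0r.
Qed.

(* Horseshoe: the projectives covering the ends cover the middle term. *)
Lemma pdim_le_ext n (A B C : lmodType R) (f : {linear A -> B}) (g : {linear B -> C}) :
  ses f g -> pdim_le n A -> pdim_le n C -> pdim_le n B.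
Proof.
elim: n A B C f g => [|n IH] A B C f g [fi gs ex].
  move=> PA PC.
  have [s sE] := PC B C g (idfun : {linear C -> C}) gs.
  have [r rE] : exists r : {linear B -> A}, forall x, f (r x) = x - s (g x).
    have hl : linear (fun x : B => x - s (g x)).
      by move=> a x y; rewrite (linearP g) (linearP s) opprD scalerBr addrACA.
    have [h hE] := linear_ext hl.
    have [|k kE] := @inj_lift A B B f h fi.
      by move=> x; apply/ex; rewrite hE linearB /= sE subrr.
    by exists k => x; rewrite kE hE.
  have il : linear (fun x : B => (r x, g x) : pairL A C).
    by move=> a x y; congr pair; rewrite /= linearP.
  have [i iE] := linear_ext il.
  have jl : linear (fun x : pairL A C => f x.1 + s x.2).
    by move=> a x y /=; rewrite !linearP /= scalerDr addrACA.
  have [j jE] := linear_ext jl.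
  apply: (projective_retract (i := i) (r := j) (projective_pair PA PC)) => x.
  by rewrite jE iE /= rE subrK.
case=> P [A1 [u [v [PP [ui vs uv] pA]]]] [Q [C1 [u' [v' [PQ [ui' vs' uv'] pC]]]]].
have [w wE] := PQ B C g v' gs.
have kl : linear (fun x : pairL P Q => f (v x.1) + w x.2).
  by move=> a x y /=; rewrite !linearP /= scalerDr addrACA.
have [k kE] := linear_ext kl.
have gf x : g (f x) = 0 by apply/ex; exists x.
have ks y : exists x, k x = y.
  have [q qE] := vs' (g y).
  have /ex [a aE] : g (y - w q) = 0 by rewrite linearB /= wE qE subrr.
  have [p pE] := vs a.
  by exists (p, q); rewrite kE /= pE aE subrK.
have [D [d sd]] := surj_ses ks; have [di _ dk] := sd.
exists (pairL P Q), D, d, k; split=> //; first exact: projective_pair.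
have [d1 d1E] : exists d1 : {linear A1 -> D}, forall x, d (d1 x) = (u x, 0).
  have hl : linear (fun x : A1 => (u x, 0) : pairL P Q).
    by move=> a x y; congr pair; rewrite /= ?linearP ?scaler0 ?addr0.
  have [h hE] := linear_ext hl.
  have [|k' k'E] := @inj_lift D _ A1 d h di.
    by move=> x; apply/dk; rewrite hE kE /= (_ : v (u x) = 0) ?linear0 ?addr0 //; apply/uv; exists x.
  by exists k' => x; rewrite k'E hE.
have [d2 d2E] : exists d2 : {linear D -> C1}, forall x, u' (d2 x) = (d x).2.
  have hl : linear (fun x : D => (d x).2) by move=> a x y; rewrite linearP.
  have [h hE] := linear_ext hl.
  have [|k' k'E] := @inj_lift C1 _ D u' h ui'.
    move=> x; apply/uv'; rewrite hE.
    have /dk : exists y, d y = d x by exists x.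
    rewrite kE => /(congr1 g); rewrite linearD gf add0r wE linear0 //.
  by exists k' => x; rewrite k'E hE.
apply: (IH _ _ _ d1 d2 _ pA pC); split.
- move=> x y e; apply: ui.
  by have := congr1 d e; rewrite !d1E => -[].
- move=> y.
  have vuy : v' (u' y) = 0 by apply/uv'; exists y.
  have /ex [a aE] : g (w (u' y)) = 0 by rewrite wE.
  have [p pE] := vs (- a).
  have /dk [x xE] : k (p, u' y) = 0 by rewrite kE /= pE linearN /= aE addNr.
  by exists x; apply: ui'; rewrite d2E xE.
- move=> x; split; last first.
    by case=> y <-; apply: ui'; rewrite d2E d1E linear0.
  move=> /(congr1 u'); rewrite d2E linear0 => x2.
  have /dk : exists y, d y = d x by exists x.
  rewrite kE x2 linear0 addr0 -(linear0 f) => /fi/uv[y yE].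
  by exists y; apply: di; rewrite d1E yE -x2 -surjective_pairing.
Qed.

Lemma pdim_leS n (M : lmodType R) : pdim_le n M -> pdim_le n.+1 M.
Proof.
elim: n M => [|n IH] M /=.
  move=> PM.
  have s : forall y : M, exists x, (idfun : {linear M -> M}) x = y by move=> y; exists y.
  have [A [f sf]] := surj_ses s.
  exists M, A, f, (idfun : {linear _ -> _}); split=> //.
  apply: projective_zero => x; have [fi _ ex] := sf.
  by apply: fi; rewrite linear0; apply/(ex (f x)); exists x.
case=> P [A [f [g [PP sf pA]]]]; exists P, A, f, g; split=> //.
exact: IH.
Qed.

Lemma pdim_le_leq n m (M : lmodType R) : (n <= m)%N -> pdim_le n M -> pdim_le m M.
Proof. by move=> /subnK <- h; elim: (m - n)%N => //= k IH; apply: pdim_leS. Qed.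

(* If [0 -> K -> Q -> M (+) P -> 0] then the kernel of [Q -> M] is [K (+) P]. *)
Lemma pdim_le_cancel n (M P : lmodType R) :
  projective_module P -> pdim_le n (pairL M P) -> pdim_le n M.
Proof.
move=> PP; case: n => [|n] /=.
  have il : linear (fun x : M => (x, 0) : pairL M P).
    by move=> a x y; congr pair; rewrite /= scaler0 addr0.
  have pl : linear (fun x : pairL M P => x.1) by move=> a x y.
  have [i iE] := linear_ext il; have [p pE] := linear_ext pl.
  move=> PMP; apply: (projective_retract (i := i) (r := p) PMP) => x.
  by rewrite pE iE.
case=> Q [A [u [v [PQ [ui vs uv] pA]]]].
have gl : linear (fun x : Q => (v x).1) by move=> a x y; rewrite linearP.
have [g gE] := linear_ext gl.
have gs y : exists x, g x = y.
  by have [x xE] := vs (y, 0); exists x; rewrite gE xE.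
have [D [d sd]] := surj_ses gs; have [di _ dg] := sd.
exists Q, D, d, g; split=> //.
have [d1 d1E] : exists d1 : {linear A -> D}, forall x, d (d1 x) = u x.
  apply: inj_lift => // x; apply/dg; rewrite gE (_ : v (u x) = 0) //.
  by apply/uv; exists x.
have hl : linear (fun x : D => (v (d x)).2) by move=> a x y; rewrite !linearP.
have [h hE] := linear_ext hl.
apply: (pdim_le_ext (f := d1) (g := h)) => //; last exact: (pdim_le_leq (leq0n n)).
split.
- by move=> x y e; apply: ui; rewrite -!d1E e.
- move=> y; have [x xE] := vs (0, y).
  have /dg [z zE] : g x = 0 by rewrite gE xE.
  by exists z; rewrite hE zE xE.
- move=> x; rewrite hE; split; last first.
    by case=> y <-; rewrite d1E (_ : v (u y) = 0) //; apply/uv; exists y.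
  move=> h2.
  have : g (d x) = 0 by apply/dg; exists x.
  rewrite gE => h1.
  have /uv [y yE] : v (d x) = 0 by rewrite (surjective_pairing (v _)) h1 h2.
  by exists y; apply: di; rewrite d1E.
Qed.

Lemma pdim_le_iso2 n (M N : lmodType R) (f : {linear M -> N}) :
  injective f -> (forall y, exists x, f x = y) -> pdim_le n M -> pdim_le n N.
Proof.
move=> fi fs; apply: (@pdim_le_iso n M N f).
exists (fun y => projT1 (cid (fs y))) => [x|y]; last exact: (projT2 (cid (fs y))).
by apply: fi; exact: (projT2 (cid (fs (f x)))).
Qed.

(* The fibre product of [B] with a projective cover of [C] splits off [A]. *)
Lemma pdim_le_ker n (A B C : lmodType R) (f : {linear A -> B}) (g : {linear B -> C}) :
  ses f g -> pdim_le n B -> pdim_le n.+1 C -> pdim_le n A.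
Proof.
move=> [fi gs ex] pB [P [K [u [v [PP [ui vs uv] pK]]]]].
have cl : (fun x : pairL P B => v x.1 = g x.2) 0 /\
    forall a x y, v x.1 = g x.2 -> v y.1 = g y.2 -> v (a *: x + y).1 = g (a *: x + y).2.
  split; first by rewrite /= !linear0.
  by move=> a x y; rewrite /= !linearP /= => -> ->.
pose F := @Submodule R (pairL P B) _ cl.
have p1l : linear (fun x : submod_type F => (submod_incl x).1) by move=> a x y; rewrite linearP.
have p2l : linear (fun x : submod_type F => (submod_incl x).2) by move=> a x y; rewrite linearP.
have [p1 p1E] := linear_ext p1l; have [p2 p2E] := linear_ext p2l.
have FP (x : submod_type F) : v (p1 x) = g (p2 x).
  by rewrite p1E p2E; exact: (submod_valP x).
have Finj (x y : submod_type F) : p1 x = p1 y -> p2 x = p2 y -> x = y.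
  rewrite !p1E !p2E => h1 h2; apply: submod_incl_inj.
  by rewrite (surjective_pairing (submod_incl x)) h1 h2 -surjective_pairing.
have Fmk p b : v p = g b -> exists x : submod_type F, p1 x = p /\ p2 x = b.
  move=> h; have [x xE] := @submod_eltP _ _ F (p, b) h.
  by exists x; rewrite p1E p2E xE.
(* The projection of the fibre product [F] to [B] has kernel [K], so [F] inherits the bound of [K]
   and [B]. Its projection to [P] has kernel [A] and splits. *)
have pF : pdim_le n (submod_type F).
  have [k kE] : exists k : {linear K -> submod_type F}, forall x, submod_incl (k x) = (u x, 0).
    have hl : linear (fun x : K => (u x, 0) : pairL P B).
      by move=> a x y; congr pair; rewrite /= ?linearP ?scaler0 ?addr0.
    have [h hE] := linear_ext hl.
    have [|k' k'E] := @submod_corestrict _ _ F _ h.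
      move=> x; rewrite hE /= linear0; apply/uv; by exists x.
    by exists k' => x; rewrite k'E hE.
  apply: (pdim_le_ext (f := k) (g := p2)) => //; split.
  - by move=> x y e; apply: ui; have := kE y; rewrite -e kE => -[].
  - by move=> b; have [p pE] := vs (g b); have [x [_ <-]] := Fmk _ _ pE; exists x.
  - move=> x; split=> [h|[y <-]]; last by rewrite p2E kE.
    have /uv [y yE] : v (p1 x) = 0 by rewrite FP h linear0.
    by exists y; apply: Finj; rewrite ?p1E ?p2E kE //= ?yE ?p1E // -p2E h.
have p1s y : exists x, p1 x = y.
  by have [b bE] := gs (v y); have [x [<- _]] := Fmk _ _ (esym bE); exists x.
have [s sE] := PP _ _ p1 (idfun : {linear P -> P}) p1s.
have [j jE] : exists j : {linear A -> submod_type F}, forall x, submod_incl (j x) = (0, f x).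
  have hl : linear (fun x : A => (0, f x) : pairL P B).
    by move=> a x y; congr pair; rewrite /= ?linearP ?scaler0 ?addr0.
  have [h hE] := linear_ext hl.
  have [|k' k'E] := @submod_corestrict _ _ F _ h.
    by move=> x; rewrite hE /= linear0; apply/esym/ex; exists x.
  by exists k' => x; rewrite k'E hE.
apply: (@pdim_le_cancel n A P PP).
have [r rE] : exists r : {linear submod_type F -> A}, forall x, f (r x) = p2 (x - s (p1 x)).
  have hl : linear (fun x : submod_type F => p2 (x - s (p1 x))).
    move=> a x y; rewrite -linearP; congr (p2 _).
    by rewrite (linearP p1) (linearP s) opprD scalerBr addrACA.
  have [h hE] := linear_ext hl.
  have [|k kE] := @inj_lift A B _ f h fi.
    by move=> x; apply/ex; rewrite hE -FP (linearB p1) sE /= subrr linear0.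
  by exists k => x; rewrite kE hE.
have ml : linear (fun x : submod_type F => (r x, p1 x) : pairL A P).
  by move=> a x y; congr pair; rewrite /= linearP.
have [m mE] := linear_ext ml.
apply: (pdim_le_iso2 (f := m)) pF.
  apply: linear_inj0 => x; rewrite mE => -[h1 h2].
  have := rE x; rewrite h1 h2 (linear0 f) (linear0 s) subr0 => /esym h3.
  by apply: Finj; rewrite ?h2 ?h3 linear0.
case=> a p; exists (j a + s p).
have p1j : p1 (j a) = 0 by rewrite p1E jE.
have p2j : p2 (j a) = f a by rewrite p2E jE.
have p1js : p1 (j a + s p) = p by rewrite linearD /= p1j add0r sE.
rewrite mE p1js; congr pair.
by apply: fi; rewrite rE p1js addrK p2j.
Qed.

(** A projective cover P of B also covers C, and the kernel of P -> C is an extension of A by the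
    kernel K of P -> B. *)
Lemma pdim_le_coker n (A B C : lmodType R) (f : {linear A -> B}) (g : {linear B -> C}) :
  ses f g -> pdim_le n A -> pdim_le n.+1 B -> pdim_le n.+1 C.
Proof.
move=> [fi gs ex] pA [P [K [u [v [PP [ui vs uv] pK]]]]].
have [k kE] : exists k : {linear P -> C}, forall x, k x = g (v x) by exists (g \o v : {linear _ -> _}).
have ks y : exists x, k x = y.
  by have [b <-] := gs y; have [x <-] := vs b; exists x; rewrite kE.
have [D [d sd]] := surj_ses ks; have [di _ dk] := sd.
exists P, D, d, k; split=> //.
have [d1 d1E] : exists d1 : {linear K -> D}, forall x, d (d1 x) = u x.
  apply: inj_lift => // x; apply/dk; rewrite kE (_ : v (u x) = 0) ?linear0 //.
  by apply/uv; exists x.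
have [d2 d2E] : exists d2 : {linear D -> A}, forall x, f (d2 x) = (v \o d : {linear _ -> _}) x.
  apply: inj_lift => // x; apply/ex; rewrite /= -kE; apply/dk; by exists x.
apply: (pdim_le_ext (f := d1) (g := d2)) => //; split.
- by move=> x y e; apply: ui; rewrite -!d1E e.
- move=> y; have [p pE] := vs (f y).
  have /dk [x xE] : k p = 0 by rewrite kE pE; apply/ex; exists y.
  by exists x; apply: fi; rewrite d2E /= xE.
- move=> x; split=> [h|[y <-]]; last first.
    by apply: fi; rewrite d2E linear0 /= d1E; apply/uv; exists y.
  have /uv [y yE] : v (d x) = 0 by have := d2E x; rewrite h linear0 /= => <-.
  by exists y; apply: di; rewrite d1E.
Qed.

(** Put e = i r and cover N by two copies of P through (x, y) |-> e (v x) + (1 - e) (v y). The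
    kernel of this cover retracts onto the kernel of P -> M by its first component, so the induction
    applies to the kernels. *)
Lemma pdim_le_retract n (M N : lmodType R) (i : {linear M -> N}) (r : {linear N -> M}) :
  (forall x, r (i x) = x) -> pdim_le n N -> pdim_le n M.
Proof.
elim: n M N i r => [|n IH] M N i r ri; first by move=> PN; exact: (projective_retract PN ri).
case=> P [K [u [v [PP [ui vs uv] pK]]]].
pose ir : {linear N -> N} := i \o r.
have gl : linear (fun x : pairL P P => ir (v x.1) + (v x.2 - ir (v x.2))).
  move=> a x y; rewrite !(linearP v) !(linearP ir) scalerDr scalerBr opprD.
  by rewrite (addrACA (a *: v x.2)) [LHS]addrACA.
have [g gE] := linear_ext gl.
have gs y : exists x, g x = y.
  by have [x xE] := vs y; exists (x, x); rewrite gE /= xE addrC subrK.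
have ks y : exists x, (r \o v : {linear P -> M}) x = y.
  by have [x xE] := vs (i y); exists x; rewrite /= xE ri.
have [D [d sd]] := surj_ses ks; have [di _ dk] := sd.
have [F [e se]] := surj_ses gs; have [ei _ ek] := se.
exists P, D, d, (r \o v : {linear _ -> _}); split=> //.
have pF : pdim_le n F.
  apply: (pdim_le_ker se); last by exists P, K, u, v.
  apply: (pdim_le_leq (leq0n n) (projective_pair PP PP)).
have [d1 d1E] : exists d1 : {linear D -> F}, forall x, e (d1 x) = (d x, 0).
  have hl : linear (fun x : D => (d x, 0) : pairL P P).
    by move=> a x y; congr pair; rewrite /= ?linearP ?scaler0 ?addr0.
  have [h hE] := linear_ext hl.
  have [|k kE] := @inj_lift F _ D e h ei.
    move=> x; apply/ek; rewrite hE gE /= !(linear0 v) !(linear0 i, linear0 r) subr0 addr0.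
    have /dk /= -> : exists y, d y = d x by exists x.
    exact: linear0.
  by exists k => x; rewrite kE hE.
have [d2 d2E] : exists d2 : {linear F -> D}, forall x, d (d2 x) = (e x).1.
  have hl : linear (fun x : F => (e x).1) by move=> a x y; rewrite linearP.
  have [h hE] := linear_ext hl.
  have [|k kE] := @inj_lift D _ F d h di.
    move=> x; apply/dk; rewrite hE /=.
    have /ek : exists y, e y = e x by exists x.
    by rewrite gE => /(congr1 r); rewrite linearD linearB /= !ri subrr addr0 linear0.
  by exists k => x; rewrite kE hE.
apply: (IH D F d1 d2) => // x; apply: di; by rewrite d2E d1E.
Qed.


Lemma pdim_pd_le n (M : lmodType R) : pdim_le n M -> pd_le M n.
Proof.
elim: n M => [|n IH] M.
  move=> PM.
  pose Z : lmodType R := 'rV[R]_0.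
  have Z0 (x : Z) : x = 0 by apply/matrixP => i [].
  pose P i := if i is _.+1 then Z else M.
  pose d i : {linear P i.+1 -> P i} := \0.
  exists P, d, (idfun : {linear M -> M}); split.
  - split; first by case=> [|i]; [exact: PM | exact: projective_zero].
    by case=> [|i] // _ x; exact: Z0.
  - by move=> m; exists m.
  - by move=> x; split=> [/= ->|[y <-]] //; exists 0.
  - by move=> i x; split=> // _; exists 0; rewrite (Z0 x).
case=> P0 [A [f [g [PP [fi gs ex] /IH[P [d [e [[PPi Pz] es ek dk]]]]]]]].
pose P' i : lmodType R := if i is j.+1 then P j else P0.
pose d' i : {linear P' i.+1 -> P' i} :=
  match i with 0 => (f \o e : {linear P 0 -> P0}) | j.+1 => d j end.
exists P', d', g; split=> //.
- split; first by case=> [|i]; [exact: PP | exact: PPi].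
  by case=> [|i] //=; rewrite ltnS; exact: Pz.
- move=> x; rewrite ex; split=> [[y <-]|[y <-]].
    by have [z <-] := es y; exists z.
  by exists (e y).
- case=> [|i] x /=; last exact: dk.
  rewrite -ek; split=> [h|->]; last exact: linear0.
  by apply: fi; rewrite h linear0.
Qed.

Lemma pd_pdim_le n (M : lmodType R) : pd_le M n -> pdim_le n M.
Proof.
elim: n M => [|n IH] M [P [d [e [[PPi Pz] es ek dk]]]].
  apply: (pdim_le_iso2 (n := 0) (f := e)) (PPi 0%N) => //.
  apply: linear_inj0 => x /ek[y <-].
  by rewrite (Pz 1%N _ y) ?linear0.
have [A [f sf]] := surj_ses es; have [fi _ ex] := sf.
exists (P 0%N), A, f, e; split=> //; apply: IH.
have [e' e'E] : exists e' : {linear P 1%N -> A}, forall x, f (e' x) = d 0%N x.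
  by apply: inj_lift => // x; apply/ex/ek; exists x.
exists (fun i => P i.+1), (fun i => d i.+1), e'; split=> //.
- by split=> // i; rewrite -ltnS => /Pz.
- by move=> y; have /ek[x xE] : e (f y) = 0 by [apply/ex; exists y]; exists x; apply: fi; rewrite e'E.
- move=> x; rewrite -dk -e'E; split=> [->|h]; first exact: linear0.
  by apply: fi; rewrite h linear0.
Qed.

End Exact.

(** * Koszul cohomology *)

Section Koszul.
Variable R : comNzRingType.

(* The cochain complex of [x :: xs] is the cone of [x] on that of [xs]; it is
   kept ungraded, with the degree as a separate predicate. *)
Fixpoint koszul (M : lmodType R) (r : nat) : lmodType R :=
  if r is r'.+1 then (koszul M r' * koszul M r')%type else M.

Fixpoint kdiff (M : lmodType R) (xs : seq R) :
    koszul M (size xs) -> koszul M (size xs) :=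
  match xs with
  | [::] => fun _ => 0
  | x :: xs' => fun w => (kdiff w.1, x *: w.1 - kdiff w.2)
  end.

Fixpoint kdeg (M : lmodType R) (r i : nat) : koszul M r -> Prop :=
  match r with
  | 0 => fun w => i = 0%N \/ w = 0
  | r'.+1 => fun w => @kdeg M r' i w.1 /\
      (if i is j.+1 then @kdeg M r' j w.2 else w.2 = 0)
  end.

Fixpoint kmap (M N : lmodType R) (f : M -> N) (r : nat) : koszul M r -> koszul N r :=
  match r with
  | 0 => f
  | r'.+1 => fun w => (kmap f w.1, kmap f w.2)
  end.

(** Vanishing of the i-th Koszul cohomology; in degree 0 the only primitive allowed is 0. *)
Definition kvanish (xs : seq R) (i : nat) (M : lmodType R) : Prop :=
  forall w : koszul M (size xs), kdeg i w -> kdiff w = 0 ->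
  exists2 u, (if i is j.+1 then kdeg j u else u = 0) & kdiff u = w.

Section Basics.
Variables (M : lmodType R).

Lemma kdiff_linear xs : linear (@kdiff M xs).
Proof.
elim: xs => [|x xs IH] a u v /=; first by rewrite scaler0 addr0.
rewrite !IH; congr pair => /=.
by rewrite scalerDr !scalerBr opprD !scalerA mulrC addrACA.
Qed.

HB.instance Definition _ xs :=
  GRing.isLinear.Build R _ _ _ (@kdiff M xs) (@kdiff_linear xs).

Lemma kdiffK xs (w : koszul M (size xs)) : kdiff (kdiff w) = 0.
Proof.
elim: xs w => //= x xs IH [a b] /=.
by rewrite IH linearB linearZ /= IH subr0 subrr.
Qed.

Lemma kdeg0 r i : @kdeg M r i 0.
Proof. by elim: r i => [|r IH] i /=; [right | split=> //; case: i]. Qed.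

Lemma kdegD r i (a : R) (u v : koszul M r) : kdeg i u -> kdeg i v -> kdeg i (a *: u + v).
Proof.
elim: r i u v => [|r IH] i u v /=.
  move=> [h1|h1]; first by left.
  by move=> [h2|h2]; [left | right; rewrite h1 h2 scaler0 addr0].
case=> [u1 u2] [v1 v2]; split; first exact: IH.
by case: i u1 u2 v1 v2 => [|i] _ u2 _ v2; [rewrite u2 v2 scaler0 addr0 | exact: IH].
Qed.

Lemma kdegB r i (u v : koszul M r) : kdeg i u -> kdeg i v -> kdeg i (u - v).
Proof.
move=> hu hv; rewrite addrC -scaleN1r; exact: kdegD.
Qed.

Lemma kdegN r i (u : koszul M r) : kdeg i u -> kdeg i (- u).
Proof. by move=> hu; rewrite -sub0r; apply: kdegB => //; apply: kdeg0. Qed.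

Lemma kdeg_diff xs i (w : koszul M (size xs)) : kdeg i w -> kdeg i.+1 (kdiff w).
Proof.
elim: xs i w => [|x xs IH] i w /=; first by right.
case=> h1 h2; split; first exact: IH.
apply: kdegB; last by case: i h1 h2 => [|i] _ h2; [rewrite h2 linear0; apply: kdeg0 | exact: IH].
by rewrite -[_ *: _]addr0; apply: kdegD => //; apply: kdeg0.
Qed.

Lemma kdeg_gt r i (w : koszul M r) : (r < i)%N -> kdeg i w -> w = 0.
Proof.
elim: r i w => [|r IH] [|i] //= w; first by move=> _ [].
move=> ri [h1 h2]; rewrite (surjective_pairing w).
by rewrite (IH _ _ ri h2) (IH _ _ (ltnW ri) h1).
Qed.

Fixpoint kconst r (m : M) : koszul M r :=
  if r is r'.+1 then (kconst r' m, 0) else m.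

Lemma kdeg_const r m : kdeg 0 (kconst r m).
Proof. by elim: r => //=; left. Qed.

Lemma kdeg0_const r (w : koszul M r) : kdeg 0 w -> exists m, w = kconst r m.
Proof.
elim: r w => [|r IH] w /=; first by exists w.
by case=> /IH[m h1] h2; exists m; rewrite -h1 -h2 -surjective_pairing.
Qed.

Lemma kconst0 r m : kconst r m = 0 -> m = 0.
Proof. by elim: r => //= r IH [/IH]. Qed.

Lemma kconstZ r a m : kconst r (a *: m) = a *: kconst r m.
Proof. by elim: r => //= r ->; congr pair; rewrite scaler0. Qed.

Lemma kdiff_const0 (xs : seq R) m : kdiff (kconst (size xs) m) = 0 ->
  forall x, x \in xs -> x *: m = 0.
Proof.
elim: xs => //= x xs IH [h1 h2] y; rewrite inE => /orP[/eqP ->|yxs]; last exact: IH.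
by apply: (@kconst0 (size xs)); move: h2; rewrite linear0 subr0 kconstZ.
Qed.

End Basics.

Lemma kconst_linear (M : lmodType R) r : linear (@kconst M r).
Proof. by elim: r => //= r IH a u v; rewrite IH; congr pair; rewrite /= scaler0 addr0. Qed.

Section Functor.
Variables (M N : lmodType R) (f : {linear M -> N}).

Lemma kmap_linear r : linear (@kmap M N f r).
Proof.
elim: r => [|r IH] a u v /=; first exact: linearP.
by rewrite !IH.
Qed.

HB.instance Definition _ r :=
  GRing.isLinear.Build R _ _ _ (@kmap M N f r) (@kmap_linear r).

Lemma kmap_diff xs (w : koszul M (size xs)) : kmap f (kdiff w) = kdiff (kmap f w).
Proof.
elim: xs w => /= [|x xs IH] w; first exact: linear0.
by rewrite linearB linearZ /= !IH.
Qed.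

Lemma kmap_deg r i (w : koszul M r) : kdeg i w -> kdeg i (kmap f w).
Proof.
elim: r i w => [|r IH] i w /=.
  by case=> ->; [left | right; exact: linear0].
case=> h1 h2; split; first exact: IH.
by case: i h1 h2 => [|i] _ h2; [rewrite h2 linear0 | exact: IH].
Qed.

Lemma kmap_const r m : kmap f (kconst r m) = kconst r (f m).
Proof. by elim: r => //= r ->; rewrite linear0. Qed.

Lemma kmap_inj r : injective f -> injective (@kmap M N f r).
Proof.
move=> fi; elim: r => //= r IH u v [/IH h1 /IH h2].
by rewrite (surjective_pairing u) (surjective_pairing v) h1 h2.
Qed.

Lemma kmap_surj r i (w : koszul N r) : (forall y, exists x, f x = y) ->
  kdeg i w -> exists2 u, kdeg i u & kmap f u = w.
Proof.
move=> fs; elim: r i w => [|r IH] i w /=.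
  case=> [->|->]; last by exists 0; [right | exact: linear0].
  by have [x xE] := fs w; exists x; [left|].
case=> /IH[u1 d1 e1]; case: i d1 => [|i] d1.
  by move=> h2; exists (u1, 0); rewrite //= e1 linear0 -h2 -surjective_pairing.
case/IH=> u2 d2 e2; exists (u1, u2) => //=.
by rewrite e1 e2 -surjective_pairing.
Qed.

Lemma kmap_deg_inj r i (w : koszul M r) : injective f -> kdeg i (kmap f w) -> kdeg i w.
Proof.
move=> fi; elim: r i w => [|r IH] i w /=.
  by case=> [->|h]; [left | right; apply: fi; rewrite linear0].
case=> h1 h2; split; first exact: IH.
case: i h1 h2 => [|i] _ h2; last exact: IH.
by apply: (kmap_inj fi); rewrite h2 linear0.
Qed.

End Functor.

Lemma kmap_exact (A B C : lmodType R) (f : {linear A -> B}) (g : {linear B -> C}) r (w : koszul B r) :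
  (forall x, g x = 0 -> exists y, f y = x) -> kmap g w = 0 -> exists u, kmap f u = w.
Proof.
move=> ex; elim: r w => [|r IH] w /=; first exact: ex.
case=> /IH[u1 h1] /IH[u2 h2]; exists (u1, u2).
by rewrite h1 h2 -surjective_pairing.
Qed.

Lemma kmap_comp0 (A B C : lmodType R) (f : {linear A -> B}) (g : {linear B -> C}) r (u : koszul A r) :
  (forall x, g (f x) = 0) -> kmap g (kmap f u) = 0.
Proof. by move=> h; elim: r u => [|r IH] u //=; rewrite !IH. Qed.

(** The stretch H^i(B) -> H^i(C) -> H^(i+1)(A) of the long exact sequence, by the usual chase on
    cochains. *)
Lemma kvanish_coker xs i (A B C : lmodType R) (f : {linear A -> B}) (g : {linear B -> C}) :
  ses f g -> kvanish xs i B -> kvanish xs i.+1 A -> kvanish xs i C.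
Proof.
move=> sfg vB vA; have [fi gs ex] := sfg; move=> w dw w0.
have [v dv vE] := kmap_surj gs dw.
have [] := @kmap_exact _ _ _ f g _ (kdiff v) (fun x => (ex x).1).
  by rewrite kmap_diff vE.
move=> t tE.
have dt : kdeg i.+1 t by apply: (kmap_deg_inj fi); rewrite tE; exact: kdeg_diff.
have t0 : kdiff t = 0 by apply: (kmap_inj fi); rewrite kmap_diff tE kdiffK linear0.
have [u du uE] := vA t dt t0.
have [||y dy yE] := vB (v - kmap f u).
- by apply: kdegB => //; apply: kmap_deg.
- by rewrite linearB /= -kmap_diff uE tE subrr.
exists (kmap g y).
  by case: (i) dy => [->|j]; [rewrite linear0 | exact: kmap_deg].
rewrite -kmap_diff yE linearB /= vE kmap_comp0 ?subr0 //.
by move=> x; exact: ses_comp0 sfg x.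
Qed.

Lemma kvanish_retract xs i (P M : lmodType R) (s : {linear M -> P}) (r : {linear P -> M}) :
  (forall x, r (s x) = x) -> kvanish xs i P -> kvanish xs i M.
Proof.
move=> rs vP w dw w0.
have [||u du uE] := vP (kmap s w); first exact: kmap_deg.
  by rewrite -kmap_diff w0 linear0.
exists (kmap r u).
  by case: (i) du => [->|j]; [rewrite linear0 | exact: kmap_deg].
by rewrite -kmap_diff uE; elim: (size xs) (w) => [|n IH] v //=; rewrite !IH -surjective_pairing.
Qed.

(** Dimension shifting: each syzygy costs one cohomological degree. This is the inequality of the
    Auslander-Buchsbaum formula that bounds depth from below. *)
Lemma kvanish_pdim xs k (M : lmodType R) :
  (forall P : lmodType R, projective_module P -> forall i, (i < size xs)%N -> kvanish xs i P) ->
  pdim_le k M -> forall i, (i + k < size xs)%N -> kvanish xs i M.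
Proof.
move=> vP; elim: k M => [|k IH] M /=; first by move=> PM i; rewrite addn0; exact: vP.
case=> P [A [f [g [PP s pA]]]] i ik.
apply: (kvanish_coker s); last by apply: IH => //; rewrite addSnnS.
by apply: vP => //; apply: leq_ltn_trans ik; rewrite leq_addr.
Qed.

(** The element [c] represents a socle element of the cokernel of g. Preimages of the products x c
    assemble to a 1-cochain w of G lying over d c. Its differential comes from a 2-cocycle of F,
    which is some d u; the 1-cocycle w - f u is then d y with y in G, and g y - c is killed by all
    of [xs], hence zero. *)
Lemma koszul_lift xs (F G N : lmodType R) (f : {linear F -> G}) (g : {linear G -> N}) (c : N) :
  injective f -> (forall x, g x = 0 <-> exists y, f y = x) ->
  kvanish xs 2 F -> kvanish xs 1 G ->
  (forall n : N, (forall x, x \in xs -> x *: n = 0) -> n = 0) ->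
  (forall x, x \in xs -> exists y, g y = x *: c) ->
  exists y, g y = c.
Proof.
move=> fi ex v2 v1 v0 hc.
have [w dw wE] : exists2 w : koszul G (size xs), kdeg 1 w & kmap g w = kdiff (kconst (size xs) c).
  elim: xs hc {v2 v1 v0} => [|x xs IH] hc /=; first by exists 0; [right | exact: linear0].
  have [|w dw wE] := IH; first by move=> y yxs; apply: hc; rewrite inE yxs orbT.
  have [y yE] := hc x (mem_head _ _).
  exists (w, kconst _ y); first by split=> //; exact: kdeg_const.
  rewrite wE kmap_const yE linear0 subr0; congr pair.
  by rewrite kconstZ.
have [] := @kmap_exact _ _ _ f g _ (kdiff w) (fun x => (ex x).1).
  by rewrite kmap_diff wE kdiffK.
move=> v vE.
have dv : kdeg 2 v by apply: (kmap_deg_inj fi); rewrite vE; exact: kdeg_diff.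
have [|u du uE] := v2 v dv.
  by apply: (kmap_inj fi); rewrite kmap_diff vE kdiffK linear0.
have [||z dz zE] := v1 (w - kmap f u).
- by apply: kdegB => //; apply: kmap_deg.
- by rewrite linearB /= -kmap_diff uE vE subrr.
have [y yE] := kdeg0_const dz; exists y; apply/eqP; rewrite -subr_eq0; apply/eqP/v0.
apply: kdiff_const0 => //.
have [kl klE] := linear_ext (@kconst_linear N (size xs)).
rewrite -klE linearB /= !klE linearB /= -wE -kmap_const -yE -kmap_diff zE linearB /=.
rewrite kmap_comp0 ?subr0 ?subrr // => x; apply/ex; by exists x.
Qed.

Fixpoint ktop (M : lmodType R) r : koszul M r -> M :=
  if r is r'.+1 then fun w => ktop w.2 else id.

Definition in_span (M : lmodType R) (xs : seq R) (m : M) : Prop :=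
  exists c : nat -> M, m = \sum_(i < size xs) xs`_i *: c i.

Lemma ktop_linear (M : lmodType R) r : linear (@ktop M r).
Proof. by elim: r => //= r IH a u v; rewrite IH. Qed.

(** Top Koszul cohomology is M / (xs) M, seen through the single top coefficient; [ktop_span] gives
    the converse inclusion. *)
Lemma ktop_diff (M : lmodType R) xs (a : koszul M (size xs)) :
  kdeg (size xs) a -> in_span xs (ktop a) ->
  exists2 u, (if size xs is j.+1 then kdeg j u else u = 0) & kdiff u = a.
Proof.
elim: xs a => [|x xs IH] /= a.
  by move=> _ [c ->]; rewrite big_ord0; exists 0.
case=> a1 a2 [c cE].
have {}a1 : a.1 = 0 by apply: (kdeg_gt _ a1).
(* subtract [x c_0] placed in top degree *)
have [t [dt tE]] : exists t : koszul M (size xs), kdeg (size xs) t /\ ktop t = c 0%N.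
  elim: (size xs) => [|r [t [dt tE]]] /=; first by exists (c 0%N); split=> //; left.
  by exists (0, t); split=> //; split=> //; exact: kdeg0.
have [kl klE] := linear_ext (@ktop_linear M (size xs)).
have [||u du uE] := IH (x *: t - a.2).
- by apply: kdegB => //; rewrite -[_ *: _]addr0; apply: kdegD => //; exact: kdeg0.
- exists (fun i => - c i.+1); rewrite -klE linearB linearZ /= !klE tE cE.
  rewrite big_ord_recl /= opprD addNKr -sumrN; apply: eq_bigr => i _.
  by rewrite scalerN.
exists (t, u).
  split=> //; by case: (size xs) du.
rewrite /= uE opprB addrC subrK (surjective_pairing a) a1; congr pair.
have : kdeg (size xs).+1 (kdiff t) by exact: kdeg_diff.
exact: kdeg_gt.
Qed.

Lemma ktop_span (M : lmodType R) xs (u : koszul M (size xs)) :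
  in_span xs (ktop (kdiff u)).
Proof.
elim: xs u => [|x xs IH] u /=; first by exists (fun _ => 0); rewrite big_ord0.
have [c cE] := IH u.2.
have [kl klE] := linear_ext (@ktop_linear M (size xs)).
exists (fun i => if i is j.+1 then - c j else ktop u.1).
rewrite -klE linearB linearZ /= !klE cE big_ord_recl /=; congr (_ + _).
by rewrite -sumrN; apply: eq_bigr => i _; rewrite scalerN.
Qed.

(** Regularity is read from the right, each element being a nonzerodivisor modulo those after it, to
    match the cone recursion of [koszul]. *)
Fixpoint regular_seq (M : lmodType R) (xs : seq R) : Prop :=
  if xs is x :: xs' then
    (forall m : M, in_span xs' (x *: m) -> in_span xs' m) /\ regular_seq M xs'
  else True.

(** A cocycle (a, b) of the cone has a closed and x a = d b. Below the top degree of the tail, a is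
    exact by induction; in that degree its class lies in M / (xs) M, where x is injective. With a =
    d y, the rest b - x y is closed of lower degree. *)
Lemma regular_kvanish (M : lmodType R) xs :
  regular_seq M xs -> forall i, (i < size xs)%N -> kvanish xs i M.
Proof.
elim: xs => //= x xs IH [xreg /IH{}IH] i.
rewrite ltnS => ir w /= [d1 d2] [e1 /eqP]; rewrite subr_eq0 => /eqP e2.
have [y dy yE] : exists2 y, (if i is j.+1 then kdeg j y else y = 0) & kdiff y = w.1.
  move: ir; rewrite leq_eqVlt => /orP[/eqP ir|ir]; last exact: IH.
  rewrite ir in d1 *; apply: ktop_diff => //; apply: xreg.
  have [kl klE] := linear_ext (@ktop_linear M (size xs)).
  by rewrite -klE -linearZ /= klE e2; exact: ktop_span.
case: i ir d1 d2 dy => [|i] ir d1 d2 dy.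
  exists 0; rewrite //= scaler0 linear0 subr0 [RHS]surjective_pairing d2.
  by rewrite -yE dy linear0.
have dxy : kdeg i (w.2 - x *: y).
  by apply: kdegB => //; rewrite -[_ *: _]addr0; apply: kdegD => //; exact: kdeg0.
have [//||z dz zE] := IH i ir (w.2 - x *: y).
  by rewrite linearB linearZ /= yE e2 subrr.
exists (y, - z).
  by split=> //; case: (i) dz => [->|j dz]; [rewrite oppr0 | exact: kdegN].
by rewrite /= yE (_ : kdiff (- z) = - kdiff z) ?linearN // opprK zE addrC subrK -surjective_pairing.
Qed.

End Koszul.

(** * Hilbert's syzygy theorem *)

Section MonoidAlgebras.
Import monalg.
Local Notation mcoeff := monalg.mcoeff.
Local Notation msupp := monalg.msupp.
Local Notation "g @_ k" := (mcoeff k g) : ring_scope.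

Section FreeModules.
Variable R : nzRingType.

(** The type [{malg R[I]}] serves here as the free module on the set [I], and this is its universal
    map. *)
Definition malg_lift (I : choiceType) (M : lmodType R) (f : I -> M) (g : {malg R[I]}) : M :=
  \sum_(k <- msupp g) g@_k *: f k.

Section Lift.
Variables (I : choiceType) (M : lmodType R) (f : I -> M).

Lemma malg_liftEw (d : {fset I}) g : (msupp g `<=` d)%fset ->
  malg_lift f g = \sum_(k <- d) g@_k *: f k.
Proof.
move=> le; rewrite [LHS](big_fset_incl _ le) => //= x xd /mcoeff_outdom ->.
by rewrite scale0r.
Qed.

Lemma malg_lift_linear : linear (malg_lift f).
Proof.
move=> a x y; pose d := (msupp x `|` msupp y)%fset.
have xd : (msupp x `<=` d)%fset by apply: fsubsetUl.
have yd : (msupp y `<=` d)%fset by apply: fsubsetUr.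
have axyd : (msupp (a *: x + y) `<=` d)%fset.
  apply: fsubset_trans (msuppD_le _ _) _; apply: fsetSU; exact: msuppZ_le.
rewrite (malg_liftEw xd) (malg_liftEw yd) (malg_liftEw axyd) scaler_sumr -big_split /=.
by apply: eq_bigr => k _; rewrite mcoeffD mcoeffZ scalerDl scalerA.
Qed.

HB.instance Definition _ :=
  GRing.isLinear.Build R {malg R[I]} M _ (malg_lift f) malg_lift_linear.

Lemma malg_liftU c k : malg_lift f << c *g k >> = c *: f k.
Proof. by rewrite (malg_liftEw msuppU_le) big_seq_fset1 mcoeffUU. Qed.

End Lift.

Lemma malg_linear_ext (I : choiceType) (M : lmodType R) (f g : {linear {malg R[I]} -> M}) :
  (forall k, f << k >> = g << k >>) -> f =1 g.
Proof.
move=> h x; rewrite (monalgE x) !linear_sum /=; apply: eq_bigr => k _.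
have -> : << x@_k *g k >> = x@_k *: << k >>.
  by apply/malgP => j; rewrite mcoeffZ !mcoeffU mulrnAr mulr1.
by rewrite !linearZ /= h.
Qed.

Lemma malg_projective (I : choiceType) : projective_module {malg R[I]}.
Proof.
move=> M N g f gs.
pose h k := projT1 (cid (gs (f << k >>))).
exists (malg_lift h : {linear _ -> _}).
apply: (@malg_linear_ext I N (g \o malg_lift h) f) => k.
by rewrite /= malg_liftU scale1r (projT2 (cid (gs (f << k >>)))).
Qed.

Lemma free_cover (M : lmodType R) : exists g : {linear {malg R[M]} -> M}, forall y, exists x, g x = y.
Proof.
by exists (malg_lift id : {linear _ -> _}) => y; exists << y >>; rewrite /= malg_liftU scale1r.
Qed.

Lemma projective_free_retract (P : lmodType R) : projective_module P ->
  exists (i : {linear P -> {malg R[P]}}) (r : {linear {malg R[P]} -> P}), forall x, r (i x) = x.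
Proof.
move=> PP; have [g gs] := free_cover P.
by have [i iE] := PP _ _ g (idfun : {linear P -> P}) gs; exists i, g.
Qed.

End FreeModules.

Section RegularFree.
Variable R : comNzRingType.

Lemma in_span_malg (I : choiceType) (xs : seq R) (m : {malg R[I]}) :
  in_span xs m <-> forall k, @in_span R R^o xs m@_k.
Proof.
split=> [[c ->] k|h].
  exists (fun i => (c i)@_k); rewrite raddf_sum /=; apply: eq_bigr => i _.
  by rewrite mcoeffZ.
pose c k := projT1 (cid (h k)).
have cE k : m@_k = \sum_(i < size xs) xs`_i * c k i := projT2 (cid (h k)).
exists (fun i => \sum_(k <- msupp m) << c k i *g k >>).
rewrite {1}(monalgE m); under [RHS]eq_bigr do rewrite scaler_sumr.
rewrite exchange_big /=; apply: eq_bigr => k _.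
rewrite {1}cE raddf_sum /=; apply: eq_bigr => i _.
by apply/malgP => j; rewrite mcoeffZ !mcoeffU mulrnAr.
Qed.

Lemma regular_malg (I : choiceType) (xs : seq R) :
  @regular_seq R R^o xs -> regular_seq {malg R[I]} xs.
Proof.
elim: xs => //= x xs IH [h /IH{}IH]; split=> // m /in_span_malg hm.
by apply/in_span_malg => k; apply: h; have := hm k; rewrite mcoeffZ.
Qed.

Lemma regular_projective_kvanish (P : lmodType R) (xs : seq R) i :
  @regular_seq R R^o xs -> projective_module P -> (i < size xs)%N -> kvanish xs i P.
Proof.
move=> reg PP ixs; have [s [r rs]] := projective_free_retract PP.
by apply: (kvanish_retract rs); apply: regular_kvanish => //; exact: regular_malg.
Qed.

Lemma regular_pdim_kvanish (M : lmodType R) (xs : seq R) i k :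
  @regular_seq R R^o xs -> pdim_le k M -> (i + k < size xs)%N -> kvanish xs i M.
Proof.
move=> reg pM; apply: kvanish_pdim pM _ => P PP j.
exact: regular_projective_kvanish.
Qed.

End RegularFree.

(** * Change of rings along a hypersurface *)

Section Restriction.
Variables (R R' : comNzRingType).

(** Restriction of scalars: an alias of the carrier, so that it can bear a second scalar action. *)
Definition resmod (phi : {rmorphism R -> R'}) (M : lmodType R') : Type := M.

Variable phi : {rmorphism R -> R'}.

Section ResmodStructure.
Variable M : lmodType R'.
HB.instance Definition _ := GRing.Zmodule.on (resmod phi M).

Definition resmod_scale (a : R) (x : resmod phi M) : resmod phi M := phi a *: (x : M).
Lemma resmod_scaleA a b x : resmod_scale a (resmod_scale b x) = resmod_scale (a * b) x.
Proof. by rewrite /resmod_scale scalerA rmorphM. Qed.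
Lemma resmod_scale1 : left_id 1 resmod_scale.
Proof. by move=> x; rewrite /resmod_scale rmorph1 scale1r. Qed.
Lemma resmod_scaleDr : right_distributive resmod_scale +%R.
Proof. by move=> a x y; rewrite /resmod_scale scalerDr. Qed.
Lemma resmod_scaleDl x : {morph resmod_scale^~ x : a b / a + b}.
Proof. by move=> a b; rewrite /resmod_scale rmorphD scalerDl. Qed.

HB.instance Definition _ := GRing.Zmodule_isLmodule.Build R (resmod phi M)
  resmod_scaleA resmod_scale1 resmod_scaleDr resmod_scaleDl.

Lemma resmodZ (a : R) (x : resmod phi M) : a *: x = phi a *: (x : M) :> M.
Proof. by []. Qed.

End ResmodStructure.

Lemma resmod_map (M N : lmodType R') (f : {linear M -> N}) :
  exists g : {linear resmod phi M -> resmod phi N}, forall x, g x = f x.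
Proof.
apply: (@linear_ext _ (resmod phi M) (resmod phi N) f) => a x y.
by rewrite linearP.
Qed.

Variable al : R.
Hypothesis al_reg : forall x, al * x = 0 -> x = 0.
Hypothesis phi_surj : forall y, exists x, phi x = y.
Hypothesis phi_ker : forall x, phi x = 0 <-> exists y, x = al * y.

(** Multiplication by [al] on the free R-module with the same basis has the free R'-module as
    cokernel. *)
Lemma pdim_resmod_free (I : choiceType) : pdim_le 1 (resmod phi {malg R'[I]}).
Proof.
have fl : linear (fun x : {malg R[I]} => al *: x).
  by move=> a x y; rewrite scalerDr !scalerA mulrC.
have [f fE] := linear_ext fl.
pose g : {linear {malg R[I]} -> resmod phi {malg R'[I]}} :=
  @malg_lift R I (resmod phi {malg R'[I]}) (fun k => << k >> : {malg R'[I]}).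
have gE x k : (g x : {malg R'[I]})@_k = phi x@_k.
  rewrite /g /= /malg_lift raddf_sum /=.
  under eq_bigr do rewrite resmodZ mcoeffZ mcoeffU.
  rewrite [in RHS](monalgE x) !raddf_sum /=; apply: eq_bigr => j _.
  by rewrite mcoeffU mulrnAr mulr1 raddfMn.
exists {malg R[I]}, {malg R[I]}, f, g; split; [exact: malg_projective| |exact: malg_projective].
split.
- apply: linear_inj0 => x; rewrite fE => /malgP h; apply/malgP => k.
  by rewrite mcoeff0; apply: al_reg; have := h k; rewrite mcoeffZ mcoeff0.
- move=> y; pose c k := projT1 (cid (phi_surj (y : {malg R'[I]})@_k)).
  exists (\sum_(k <- msupp (y : {malg R'[I]})) << c k *g k >>).
  apply/malgP => j; rewrite gE [in RHS](monalgE y) !raddf_sum /=; apply: eq_bigr => k _.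
  rewrite !mcoeffU raddfMn /= /c; case: cid => z /= -> //.
- move=> x; split=> [h|[y <-]]; last first.
    apply/malgP => k; rewrite gE fE mcoeffZ mcoeff0; apply/phi_ker.
    by exists (y@_k).
  have hk k : exists y, x@_k = al * y.
    by apply/phi_ker; rewrite -gE h mcoeff0.
  pose c k := projT1 (cid (hk k)).
  exists (\sum_(k <- msupp x) << c k *g k >>).
  rewrite fE scaler_sumr [RHS]monalgE; apply: eq_bigr => k _.
  apply/malgP => j; rewrite mcoeffZ !mcoeffU mulrnAr; congr (_ *+ _).
  by rewrite /c; case: cid.
Qed.

(** Projectives over R' are retracts of free modules, hence of dimension at most 1 over R. This one
    unit is carried unchanged along a resolution by [pdim_le_coker]. *)
Lemma pdim_resmod n (M : lmodType R') : pdim_le n M -> pdim_le n.+1 (resmod phi M).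
Proof.
have res_proj (P : lmodType R') : projective_module P -> pdim_le 1 (resmod phi P).
  move=> PP; have [i [r ri]] := projective_free_retract PP.
  have [i' i'E] := resmod_map i; have [r' r'E] := resmod_map r.
  apply: (pdim_le_retract (i := i') (r := r')); last exact: pdim_resmod_free.
  by move=> x; rewrite r'E i'E ri.
elim: n M => [|n IH] M; first exact: res_proj.
case=> P [A [f [g [PP [fi gs ex] pA]]]].
have [f' f'E] := resmod_map f; have [g' g'E] := resmod_map g.
apply: (@pdim_le_coker _ _ (resmod phi A) (resmod phi P) _ f' g').
- split; first by move=> x y; rewrite !f'E => /fi.
    by move=> y; have [x xE] := gs y; exists x; rewrite g'E.
  move=> x; rewrite g'E; split=> [/ex[y yE]|[y]]; first by exists y; rewrite f'E.
  by rewrite f'E => yE; apply/ex; exists y.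
- exact: IH.
- apply: pdim_le_leq (res_proj _ PP); by [].
Qed.

End Restriction.

(** Zorn's lemma on graphs of partial linear lifts of [f]: a maximal graph has full domain, since a
    missing vector m can be sent to any preimage of f m. *)
Lemma field_projective (F : fieldType) (M : lmodType F) : projective_module M.
Proof.
move=> A B g f gs.
pose good (P : M * A -> Prop) :=
  [/\ forall c x y, P x -> P y -> P (c *: x.1 + y.1, c *: x.2 + y.2),
      forall m a a', P (m, a) -> P (m, a') -> a = a'
    & forall x, P x -> g x.2 = f x.1].
have [|P [[PD Pf Pg] Pmax]] := @classical_sets.Zorn_bigcup (M * A)%type good.
  move=> Fs Fgood Ftot.
  have two x y : classical_sets.bigcup Fs id x -> classical_sets.bigcup Fs id y ->
      exists2 P, Fs P & P x /\ P y.
    move=> [P FP Px] [Q FQ Qy]; case: (Ftot P Q FP FQ) => h.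
      by exists Q => //; split=> //; apply: h.
    by exists P => //; split=> //; apply: h.
  split.
  - move=> c x y hx hy; have [P FP [Px Py]] := two _ _ hx hy.
    by exists P => //; have [PD _ _] := Fgood _ FP; apply: PD.
  - move=> m a a' hx hy; have [P FP [Px Py]] := two _ _ hx hy.
    by have [_ Pf _] := Fgood _ FP; apply: Pf Px Py.
  - by move=> x [P FP Px]; have [_ _ Pg] := Fgood _ FP; apply: Pg.
have Pmax' Q : good Q -> (forall x, P x -> Q x) -> forall x, Q x -> P x.
  move=> Qg PQ x Qx; apply: contrapT => nPx; apply: (Pmax Q) => //.
  by split=> // h; apply: nPx; apply: h.
(* The empty graph is good as well, so membership of the zero pair has to be extracted from
   maximality. *)
have P0 : P (0, 0).
  apply: (Pmax' (fun x => P x \/ x = (0, 0))); [|by left|by right]; split.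
  - move=> c x y [Px|->] [Py|->] /=; rewrite ?scaler0 ?addr0 ?add0r.
    + by left; apply: PD.
    + by left; have := PD (c - 1) x x Px Px; rewrite !scalerBl !scale1r !subrK.
    + by left; rewrite -surjective_pairing.
    + by right.
  - have P0 a : P (0, a) -> a = 0.
      move=> h; have := PD 1 _ _ h h; rewrite /= scaler0 addr0 scale1r => h2.
      by have /eqP := Pf _ _ _ h2 h; rewrite -subr_eq0 addrK => /eqP.
    move=> m a a' [h|[em ea]] [h'|[em' ea']]; first exact: Pf h h'.
    + by rewrite ea'; apply: P0; rewrite -em'.
    + by rewrite ea; apply/esym/P0; rewrite -em.
    + by rewrite ea ea'.
  - by move=> x [Px|->] /=; [apply: Pg | rewrite !linear0].
have Pdom m : exists a, P (m, a).
  apply: contrapT => nmm; have [a0 a0E] := gs (f m).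
  pose Q (x : M * A) := exists c y, P y /\ x = (c *: m + y.1, c *: a0 + y.2).
  have Qm : Q (m, a0) by exists 1, (0, 0); split=> //=; rewrite !addr0 !scale1r.
  apply: (nmm); exists a0; apply: (Pmax' Q) => //; last first.
    by move=> x Px; exists 0, x; rewrite !scale0r !add0r -surjective_pairing.
  split.
  - move=> c _ _ [d [y [Py ->]]] [e [z [Pz ->]]] /=.
    exists (c * d + e), (c *: y.1 + z.1, c *: y.2 + z.2); split; first exact: PD.
    by rewrite /= !scalerDr !scalerDl !scalerA; congr pair; rewrite addrACA.
  - move=> x a a' [c [y [Py [e1 e2]]]] [c' [y' [Py' [e1' e2']]]].
    have [cc|cc] := eqVneq c c'.
      rewrite e2 e2' cc; congr (_ + _); apply: (Pf y.1).
        by rewrite -surjective_pairing.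
      have -> : y.1 = y'.1 by apply: (addrI (c *: m)); rewrite -e1 {1}cc.
      by rewrite -surjective_pairing.
    exfalso; apply: nmm; exists ((c - c')^-1 *: (y'.2 - y.2)).
    have Pd : P (y'.1 - y.1, y'.2 - y.2).
      by have := PD (-1) y y' Py Py'; rewrite !scaleN1r ![- _ + _]addrC.
    have -> : m = (c - c')^-1 *: (y'.1 - y.1).
      apply: (@scalerI _ _ (c - c')); rewrite ?subr_eq0 // scalerA divff ?subr_eq0 // scale1r scalerBl.
      by apply/eqP; rewrite subr_eq addrAC -subr_eq opprK addrC -e1 e1' addrC.
    by have := PD (c - c')^-1 _ _ Pd P0; rewrite /= !addr0.
  - move=> x [c [y [Py ->]]] /=.
    by rewrite !linearD !linearZ /= a0E (Pg _ Py).
have [|h hE] := @linear_ext F M A (fun m => projT1 (cid (Pdom m))).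
  move=> c x y; case: cid => a Pa; case: cid => b Pb; case: cid => d Pd /=.
  by apply: Pf Pa _; exact: (PD c _ _ Pb Pd).
exists h => x; rewrite hE; case: cid => a Pa /=; exact: (Pg _ Pa).
Qed.

Local Notation "g @_ k" := (mcoeff k g) : ring_scope.

Section AdditiveLift.
Variables (M W : zmodType).
Local Notation T := (malg nat M).

Definition add_lift (f : nat -> M -> W) (u : T) : W :=
  \sum_(k <- msupp u) f k u@_k.

Lemma malg_nat_ind (P : T -> Prop) :
  P 0 -> (forall u v, P u -> P v -> P (u + v)) -> (forall k x, P << x *g k >>) ->
  forall u, P u.
Proof.
move=> P0 PD PU u; rewrite (monalgE u).
by apply: (big_ind P) => // k _; apply: PU.
Qed.

Variable f : nat -> M -> W.
Hypothesis fD : forall k x y, f k (x + y) = f k x + f k y.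

Let f0 k : f k 0 = 0.
Proof. by apply: (addrI (f k 0)); rewrite -fD !addr0. Qed.

Lemma add_liftEw (d : {fset nat}) u : (msupp u `<=` d)%fset ->
  add_lift f u = \sum_(k <- d) f k u@_k.
Proof.
move=> le; rewrite [LHS](big_fset_incl _ le) => //= x xd /mcoeff_outdom ->.
by rewrite f0.
Qed.

Lemma add_liftU k x : add_lift f << x *g k >> = f k x.
Proof. by rewrite (add_liftEw msuppU_le) big_seq_fset1 mcoeffUU. Qed.

Lemma add_liftD u v : add_lift f (u + v) = add_lift f u + add_lift f v.
Proof.
pose d := (msupp u `|` msupp v)%fset.
have ud : (msupp u `<=` d)%fset by apply: fsubsetUl.
have vd : (msupp v `<=` d)%fset by apply: fsubsetUr.
rewrite (add_liftEw ud) (add_liftEw vd) (add_liftEw (msuppD_le _ _)) -big_split /=.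
by apply: eq_bigr => k _; rewrite mcoeffD fD.
Qed.

Lemma add_lift0 : add_lift f 0 = 0.
Proof. by apply: (addrI (add_lift f 0)); rewrite -add_liftD !addr0. Qed.

End AdditiveLift.

Section Hilbert.
Variables (K : fieldType) (l : nat).
Local Notation S := {mpoly K[l]}.

Lemma mpoly_alg_ind (P : S -> Prop) :
  (forall c, P c%:MP_[l]) -> (forall p q, P p -> P q -> P (p + q)) ->
  (forall p q, P p -> P q -> P (p * q)) -> (forall j : 'I_l, P 'X_j) ->
  forall p, P p.
Proof.
move=> PC PD PM PX; have P0 := PC 0; have P1 := PC 1.
rewrite mpolyC0 in P0; rewrite mpolyC1 in P1.
elim/mpolyind => // c m p _ _ Pp; apply: (PD) => //.
rewrite -mul_mpolyC; apply: (PM) => //; rewrite mpolyXE_id.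
by apply: (big_ind P) => // i _; elim: (m i) => [|n IH]; rewrite ?expr0 // exprS; apply: PM.
Qed.

(** Linearity over the subring K[x_0, ..., x_(k-1)], stated on its generators. *)
Definition rel_linear (k : nat) (M N : lmodType S) (f : M -> N) : Prop :=
  [/\ forall x y, f (x + y) = f x + f y,
      forall c x, f (c%:MP_[l] *: x) = c%:MP_[l] *: f x
    & forall j : 'I_l, (j < k)%N -> forall x, f ('X_j *: x) = 'X_j *: f x].

Lemma rel_linear_linear (M N : lmodType S) (f : M -> N) : rel_linear l f -> linear f.
Proof.
case=> fD fC fX a x y; rewrite fD; congr (_ + _); move: x.
elim/mpoly_alg_ind: a => [c|p q hp hq|p q hp hq|j] x //.
- by rewrite !scalerDl fD hp hq.
- by rewrite -!scalerA hp hq.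
- exact: fX.
Qed.

(** Interpolates between k = 0, where it is a fact about K-vector spaces, and k = l, where it is
    projectivity over S. The surjections tested are always S-linear; only the map to be lifted, and
    its lift, are relative. *)
Definition rel_projective (k : nat) (M : lmodType S) : Prop :=
  forall (A B : lmodType S) (g : {linear A -> B}) (f : M -> B),
    (forall y, exists x, g x = y) -> rel_linear k f ->
    exists2 h : M -> A, rel_linear k h & forall x, g (h x) = f x.

Lemma rel_projective0 (M : lmodType S) : rel_projective 0 M.
Proof.
move=> A B g f gs [fD fC _].
have [g' g'E] := resmod_map (@mpolyC l K : {rmorphism K -> S}) g.
have [|f' f'E] := @linear_ext K (resmod (@mpolyC l K) M) (resmod (@mpolyC l K) B) f.
  by move=> c x y; rewrite fD fC.
have [|h hE] := @field_projective K (resmod (@mpolyC l K) M) _ _ g' f'.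
  by move=> y; have [x xE] := gs y; exists x; rewrite g'E.
exists h; last by move=> x; rewrite -g'E hE f'E.
by split=> // [x y|c x]; [rewrite linearD | rewrite (linearZ_LR h c x)].
Qed.

Lemma rel_projective_projective (M : lmodType S) : rel_projective l M -> projective_module M.
Proof.
move=> PM A B g f gs.
have [|h hl hE] := PM A B g f gs.
  by split=> [x y|c x|j _ x]; rewrite ?linearD ?linearZ.
by have [h' h'E] := linear_ext (rel_linear_linear hl); exists h' => x; rewrite h'E hE.
Qed.

(* [M[t]], on which the variable of index [i] acts as [t] and the other ones
   through [M]. *)
Section PolyExt.
Variables (i : 'I_l) (M : lmodType S).

Definition polyext (j : 'I_l) (N : lmodType S) : Type := malg nat N.
Local Notation T := (polyext i M).
HB.instance Definition _ := GRing.Zmodule.on (polyext i M).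

Definition poly_act (p : {poly S}) : malg nat M -> malg nat M :=
  add_lift (fun k x => \sum_(j < size p) << p`_j *: x *g (k + j)%N >>).

Lemma poly_act_add (p : {poly S}) k (x y : M) :
  \sum_(j < size p) << p`_j *: (x + y) *g (k + j)%N >> =
  \sum_(j < size p) << p`_j *: x *g (k + j)%N >> +
  \sum_(j < size p) << p`_j *: y *g (k + j)%N >> :> malg nat M.
Proof. by rewrite -big_split; apply: eq_bigr => j _; rewrite scalerDr monalgUD. Qed.

Lemma poly_actU n (p : {poly S}) k x : (size p <= n)%N ->
  poly_act p << x *g k >> = \sum_(j < n) << p`_j *: x *g (k + j)%N >>.
Proof.
move=> pn; rewrite /poly_act add_liftU; last exact: poly_act_add.
rewrite -(big_mkord xpredT (fun j => << p`_j *: x *g (k + j)%N >>)).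
rewrite -(big_mkord xpredT (fun j => << p`_j *: x *g (k + j)%N >>)).
rewrite [RHS](@big_cat_nat _ _ _ (size p)) //= [X in _ = _ + X]big_nat_cond.
rewrite [X in _ = _ + X]big1 ?addr0 // => j.
by rewrite andbT => /andP[h _]; rewrite nth_default // scale0r monalgU0.
Qed.

Lemma poly_actD p u v : poly_act p (u + v) = poly_act p u + poly_act p v.
Proof. exact/add_liftD/poly_act_add. Qed.

Lemma poly_act0 p : poly_act p 0 = 0.
Proof. exact/add_lift0/poly_act_add. Qed.

Lemma poly_actDl p q u : poly_act (p + q) u = poly_act p u + poly_act q u.
Proof.
elim/malg_nat_ind: u => [|u v hu hv|k x]; first by rewrite !poly_act0 addr0.
  by rewrite !poly_actD hu hv addrACA.
rewrite (poly_actU _ _ (size_polyD p q)) (poly_actU _ _ (leq_maxl (size p) (size q))).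
rewrite (poly_actU _ _ (leq_maxr (size p) (size q))) -big_split /=.
by apply: eq_bigr => j _; rewrite coefD scalerDl monalgUD.
Qed.

Lemma poly_act_monom c a k x : poly_act (c *: 'X^a) << x *g k >> = << c *: x *g (k + a)%N >>.
Proof.
have h : (size (c *: 'X^a : {poly S}) <= a.+1)%N by rewrite (leq_trans (size_scale_leq _ _)) ?size_polyXn.
rewrite (poly_actU _ _ h) (bigD1 ord_max) //= coefZ coefXn eqxx mulr1 big1 ?addr0 // => j.
by rewrite -val_eqE /= coefZ coefXn => /negPf ->; rewrite mulr0 scale0r monalgU0.
Qed.

Lemma poly_act_sum (I : Type) (r : seq I) (F : I -> {poly S}) u :
  poly_act (\sum_(j <- r) F j) u = \sum_(j <- r) poly_act (F j) u.
Proof.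
elim: r => [|j r IH]; last by rewrite !big_cons poly_actDl IH.
rewrite !big_nil; apply: (addrI (poly_act 0 u)); by rewrite -poly_actDl !addr0.
Qed.

Lemma poly_act_sumr (I : Type) (r : seq I) p (F : I -> malg nat M) :
  poly_act p (\sum_(j <- r) F j) = \sum_(j <- r) poly_act p (F j).
Proof. by apply: big_morph => [u v|]; [apply: poly_actD | apply: poly_act0]. Qed.

Lemma poly_actM p q u : poly_act p (poly_act q u) = poly_act (p * q) u.
Proof.
elim/malg_nat_ind: u => [|u v hu hv|k x]; first by rewrite !poly_act0.
  by rewrite !poly_actD hu hv.
rewrite -[p]coefK -[q]coefK !poly_def mulr_suml !poly_act_sum.
apply: eq_bigr => a _; rewrite poly_act_sumr mulr_sumr poly_act_sum.
apply: eq_bigr => b _; rewrite !poly_act_monom.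
have -> : p`_a *: 'X^a * (q`_b *: 'X^b) = (p`_a * q`_b) *: 'X^(a + b).
  by rewrite -scalerAl -scalerAr scalerA exprD.
by rewrite poly_act_monom scalerA -addnA [(a + b)%N]addnC.
Qed.

(** Sends x_i to t and the other variables to constants, so that the module axioms are inherited
    from the action of [{poly S}] on M[t]. *)
Definition polyext_hom : {rmorphism S -> {poly S}} :=
  mpoly.mmap (polyC \o @mpolyC l K) (fun j : 'I_l => if j == i then 'X else ('X_j : S)%:P).

Definition polyext_scale (a : S) (u : T) : T := poly_act (polyext_hom a) u.
Lemma polyext_scaleA a b u : polyext_scale a (polyext_scale b u) = polyext_scale (a * b) u.
Proof.
transitivity (poly_act (polyext_hom a * polyext_hom b) u); first exact: poly_actM.
by congr (poly_act _ u); exact: (esym (rmorphM polyext_hom a b)).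
Qed.
Lemma polyext_scale1 : left_id 1 polyext_scale.
Proof.
move=> u; rewrite /polyext_scale rmorph1.
elim/malg_nat_ind: u => [|u v hu hv|k x]; first exact: poly_act0.
  by rewrite poly_actD hu hv.
have -> : (1 : {poly S}) = 1 *: 'X^0 by rewrite scale1r.
by rewrite poly_act_monom scale1r addn0.
Qed.
Lemma polyext_scaleDr : right_distributive polyext_scale +%R.
Proof. move=> a u v; exact: poly_actD. Qed.
Lemma polyext_scaleDl u : {morph polyext_scale^~ u : a b / a + b}.
Proof. by move=> a b; rewrite /polyext_scale rmorphD poly_actDl. Qed.

HB.instance Definition _ := GRing.Zmodule_isLmodule.Build S T
  polyext_scaleA polyext_scale1 polyext_scaleDr polyext_scaleDl.

Definition pmon k (x : M) : T := << x *g k >>.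

Lemma pmonD k x y : pmon k (x + y) = pmon k x + pmon k y.
Proof. exact: monalgUD. Qed.

Lemma polyext_ind (P : T -> Prop) :
  P 0 -> (forall u v, P u -> P v -> P (u + v)) -> (forall k x, P (pmon k x)) ->
  forall u, P u.
Proof. exact: malg_nat_ind. Qed.

Lemma polyextC c k x : c%:MP_[l] *: pmon k x = pmon k (c%:MP_[l] *: x).
Proof.
rewrite /pmon [LHS]/(polyext_scale _ _) /polyext_scale /= mpoly.mmapC /=.
have -> : (c%:MP_[l])%:P = c%:MP_[l] *: 'X^0 by rewrite expr0 alg_polyC.
by rewrite poly_act_monom addn0.
Qed.

Lemma polyextX k x : 'X_i *: pmon k x = pmon k.+1 x.
Proof.
rewrite /pmon [LHS]/(polyext_scale _ _) /polyext_scale /= mpoly.mmapX mpoly.mmap1U eqxx.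
by rewrite -['X]expr1 -['X^1]scale1r poly_act_monom scale1r addn1.
Qed.

Lemma polyextXj j k x : j != i -> 'X_j *: pmon k x = pmon k ('X_j *: x).
Proof.
move=> ji; rewrite /pmon [LHS]/(polyext_scale _ _) /polyext_scale /= mpoly.mmapX mpoly.mmap1U (negPf ji).
have -> : ('X_j : S)%:P = 'X_j *: 'X^0 by rewrite expr0 alg_polyC.
by rewrite poly_act_monom addn0.
Qed.

Lemma polyext_rel_linear n (N : lmodType S) (f : T -> N) :
  (forall u v, f (u + v) = f u + f v) -> f 0 = 0 ->
  (forall c k x, f (c%:MP_[l] *: pmon k x) = c%:MP_[l] *: f (pmon k x)) ->
  (forall (j : 'I_l) k x, (j < n)%N -> f ('X_j *: pmon k x) = 'X_j *: f (pmon k x)) ->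
  rel_linear n f.
Proof.
move=> fD f0 fC fX; split=> // [c u|j jn u]; elim/polyext_ind: u => [|u v hu hv|k x];
  rewrite ?scaler0 ?f0 ?scaler0 ?scalerDr ?fD ?hu ?hv ?scalerDr //; exact: fX.
Qed.

(** A map out of M[t] that is linear in x_0, ..., x_i is determined by its restriction to the
    constants M, which is linear in the variables before x_i. Lift this restriction to h0 and extend
    by t^k x |-> x_i^k h0(x). *)
Lemma rel_projective_polyext : rel_projective i M -> rel_projective i.+1 T.
Proof.
move=> PM A B g f gs [fD fC fX].
have f0 : f 0 = 0 by apply: (addrI (f 0)); rewrite -fD !addr0.
have [|h0 [hD hC hX] h0E] := PM A B g (fun x => f (pmon 0 x)) gs.
  split=> [x y|c x|j ji x]; first by rewrite pmonD fD.
    by rewrite -polyextC fC.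
  by rewrite -polyextXj ?fX ?leqW // -val_eqE neq_ltn ji.
pose phi k x := 'X_i ^+ k *: h0 x : A.
have phiD k x y : phi k (x + y) = phi k x + phi k y by rewrite /phi hD scalerDr.
pose h (u : T) := add_lift phi u.
have hU k x : h (pmon k x) = 'X_i ^+ k *: h0 x by exact: add_liftU.
have hDu u v : h (u + v) = h u + h v by exact: add_liftD.
have h00 : h 0 = 0 by exact: add_lift0.
exists h.
  apply: polyext_rel_linear => // [c k x|j k x].
    by rewrite polyextC !hU hC !scalerA mulrC.
  rewrite ltnS leq_eqVlt => /orP[/eqP/val_inj ->|ji].
    by rewrite polyextX !hU exprS scalerA.
  by rewrite polyextXj -?val_eqE ?neq_ltn ?ji // !hU hX // !scalerA mulrC.
elim/polyext_ind => [|u v hu hv|k x]; first by rewrite h00 linear0 f0.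
  by rewrite hDu linearD hu hv fD.
rewrite hU linearZ /= h0E; elim: k => [|k IH]; first by rewrite scale1r.
by rewrite exprS -scalerA IH -fX // polyextX.
Qed.

(** Multiplication by t - x_i, where x_i acts on the coefficients, followed by evaluation of t at
    x_i. *)
Lemma polyext_ses : exists (d : {linear T -> T}) (e : {linear T -> M}), ses d e.
Proof.
pose phi k x := pmon k.+1 x - pmon k ('X_i *: x).
have phiD k x y : phi k (x + y) = phi k x + phi k y.
  by rewrite /phi scalerDr !pmonD opprD addrACA.
pose psi k x := 'X_i ^+ k *: x : M.
have psiD k x y : psi k (x + y) = psi k x + psi k y by rewrite /psi scalerDr.
have dU k x : add_lift phi (pmon k x) = pmon k.+1 x - pmon k ('X_i *: x) by exact: add_liftU.
have dD u v : add_lift phi (u + v) = add_lift phi u + add_lift phi v by exact: add_liftD.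
have d0 : add_lift phi 0 = 0 by exact: add_lift0.
have eU k x : add_lift psi (pmon k x) = 'X_i ^+ k *: x by exact: add_liftU.
have eD u v : add_lift psi (u + v) = add_lift psi u + add_lift psi v by exact: add_liftD.
have e0 : add_lift psi 0 = 0 by exact: add_lift0.
have [|d dE] := @linear_ext S T T (add_lift phi).
  apply: rel_linear_linear; apply: polyext_rel_linear => // [c k x|j k x _].
    by rewrite polyextC !dU scalerBr !polyextC !scalerA mulrC.
  have [->|ji] := eqVneq j i; first by rewrite polyextX !dU scalerBr !polyextX.
  by rewrite polyextXj // !dU scalerBr !polyextXj // !scalerA mulrC.
have [|e eE] := @linear_ext S T M (add_lift psi).
  apply: rel_linear_linear; apply: polyext_rel_linear => // [c k x|j k x _].
    by rewrite polyextC !eU !scalerA mulrC.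
  have [->|ji] := eqVneq j i; first by rewrite polyextX !eU exprS scalerA.
  by rewrite polyextXj // !eU !scalerA mulrC.
have dUd k x : d (pmon k x) = pmon k.+1 x - pmon k ('X_i *: x) by rewrite dE dU.
have eUe k x : e (pmon k x) = 'X_i ^+ k *: x by rewrite eE eU.
exists d, e; split.
- apply: linear_inj0 => u du0.
  have coef (v : T) k : (d v : malg nat M)@_k.+1 = (v : malg nat M)@_k - 'X_i *: (v : malg nat M)@_k.+1.
    elim/polyext_ind: v => [|v w hv hw|j x].
    + by rewrite linear0 !mcoeff0 scaler0 subr0.
    + by rewrite linearD !mcoeffD hv hw scalerDr opprD addrACA.
    + rewrite dUd mcoeffB !mcoeffU eqSS; congr (_ - _).
      by rewrite scalerMnr.
  (* From d u = 0 one gets u_k = x_i u_(k+1), so the coefficients vanish downwards from beyond the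
     top one. *)
  have step n : (forall k, (n < k)%N -> (u : malg nat M)@_k = 0) ->
      forall k, (u : malg nat M)@_k = 0.
    elim: n => [|n IH] h k.
      have := coef u 0%N; rewrite du0 mcoeff0 (h 1%N) // scaler0 subr0 => /esym u0.
      by case: k => // k; apply: h.
    apply: IH => {}k; rewrite leq_eqVlt => /orP[/eqP <-|]; last exact: h.
    by have := coef u n.+1; rewrite du0 mcoeff0 (h n.+2) // scaler0 subr0.
  apply/malgP => k; rewrite mcoeff0.
  apply: (step (\max_(j <- msupp (u : malg nat M)) j)%N) => j jmax.
  apply/eqP; rewrite mcoeff_eq0; apply: contraTN jmax => jm; rewrite -leqNgt.
  exact: (leq_bigmax_seq (F := id)).
- by move=> x; exists (pmon 0 x); rewrite eUe scale1r.
- have ed u : e (d u) = 0.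
    elim/polyext_ind: u => [|u v hu hv|k x]; first by rewrite !linear0.
      by rewrite !linearD /= hu hv addr0.
    by rewrite dUd linearB /= !eUe scalerA exprSr subrr.
  (* Modulo the image of [d], t acts as x_i, so u is congruent to the constant e(u). *)
  have dec u : exists v, u = pmon 0 (e u) + d v.
    elim/polyext_ind: u => [|u v [u' hu] [v' hv]|k x].
    + by exists 0; rewrite !linear0 addr0 /pmon monalgU0.
    + by exists (u' + v'); rewrite !linearD /= pmonD addrACA -hu -hv.
    + elim: k x => [|k IH] x; first by exists 0; rewrite linear0 addr0 eUe scale1r.
      have [v vE] := IH ('X_i *: x); exists (v + pmon k x).
      rewrite linearD /= dUd addrA eUe exprSr -scalerA -eUe -vE.
      by rewrite addrC subrK.
  move=> u; split=> [eu|[v <-]]; last exact: ed.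
  have [v vE] := dec u; exists v.
  by rewrite [RHS]vE eu /pmon monalgU0 add0r.
Qed.

End PolyExt.

(** Replacing M by M[t] gains one variable of relative projectivity, and the sequence of
    [polyext_ses] charges one unit of dimension for it. *)
Lemma hilbert_rel k (M : lmodType S) : (k <= l)%N -> rel_projective k M -> pdim_le (l - k) M.
Proof.
move=> kl; move En: (l - k)%N => n; elim: n k M kl En => [|n IH] k M kl En PM.
  have {En}kl' : k = l by apply/eqP; rewrite eqn_leq kl -subn_eq0 En.
  by apply: rel_projective_projective; rewrite kl' in PM.
have lt_kl : (k < l)%N by rewrite -subn_gt0 En.
have [d [e s]] := polyext_ses (Ordinal lt_kl) M.
have pE : pdim_le n (polyext (Ordinal lt_kl) M).
  apply: (IH k.+1) => //; first by rewrite subnS En.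
  exact: (rel_projective_polyext (i := Ordinal lt_kl)).
exact: pdim_le_coker s pE (pdim_leS pE).
Qed.

Theorem hilbert_syzygy (M : lmodType S) : pdim_le l M.
Proof. by have := hilbert_rel (leq0n l) (@rel_projective0 M); rewrite subn0. Qed.

End Hilbert.

End MonoidAlgebras.

(** * Cokernels and second syzygies *)

Section Cokernel.
Variables (R : nzRingType) (M : lmodType R) (U : submodule M).
Local Open Scope quotient_scope.

Definition quotmod : Type := Quotient.quot (submod_pred U).
HB.instance Definition _ := GRing.Zmodule.on quotmod.

Definition quotmod_pi (x : M) : quotmod := \pi_(Quotient.quot (submod_pred U)) x.

Lemma quotmod_piP x y : quotmod_pi x = quotmod_pi y <-> U (x - y).
Proof.
split=> [/eqP|h].
  by rewrite -Quotient.idealrBE => /asboolP.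
by apply/eqP; rewrite -Quotient.idealrBE; apply/asboolP.
Qed.

Lemma quotmod_surj (y : quotmod) : exists x, quotmod_pi x = y.
Proof. by exists (repr y); rewrite /quotmod_pi reprK. Qed.

Lemma quotmod_piD x y : quotmod_pi (x + y) = quotmod_pi x + quotmod_pi y.
Proof. by rewrite /quotmod_pi raddfD. Qed.

Definition quotmod_scale (a : R) (y : quotmod) : quotmod := quotmod_pi (a *: repr y).

Lemma quotmod_scaleE a x : quotmod_scale a (quotmod_pi x) = quotmod_pi (a *: x).
Proof.
apply/quotmod_piP; rewrite -scalerBr.
have [U0 UD] := in_submod_closed U.
rewrite -[_ *: _]addr0; apply: UD => //; apply/quotmod_piP.
by rewrite /quotmod_pi reprK.
Qed.

Lemma quotmod_scaleA a b x : quotmod_scale a (quotmod_scale b x) = quotmod_scale (a * b) x.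
Proof. by have [y <-] := quotmod_surj x; rewrite !quotmod_scaleE scalerA. Qed.
Lemma quotmod_scale1 : left_id 1 quotmod_scale.
Proof. by move=> x; have [y <-] := quotmod_surj x; rewrite !quotmod_scaleE scale1r. Qed.
Lemma quotmod_scaleDr : right_distributive quotmod_scale +%R.
Proof.
move=> a x y; have [x' <-] := quotmod_surj x; have [y' <-] := quotmod_surj y.
by rewrite -quotmod_piD !quotmod_scaleE scalerDr quotmod_piD.
Qed.
Lemma quotmod_scaleDl x : {morph quotmod_scale^~ x : a b / a + b}.
Proof.
move=> a b; have [y <-] := quotmod_surj x.
by rewrite !quotmod_scaleE scalerDl quotmod_piD.
Qed.

HB.instance Definition _ := GRing.Zmodule_isLmodule.Build R quotmod
  quotmod_scaleA quotmod_scale1 quotmod_scaleDr quotmod_scaleDl.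

Lemma cokernel_exists : exists (C : lmodType R) (q : {linear M -> C}),
  (forall y, exists x, q x = y) /\ (forall x, q x = 0 <-> U x).
Proof.
have [|q qE] := @linear_ext R M quotmod quotmod_pi.
  by move=> a x y; rewrite quotmod_piD -quotmod_scaleE.
exists quotmod, q; split=> [y|x].
  by have [x <-] := quotmod_surj y; exists x.
rewrite qE; have -> : 0 = quotmod_pi 0 by rewrite -qE linear0.
by rewrite quotmod_piP subr0.
Qed.

End Cokernel.

Section SecondSyzygy.
Variables (K : fieldType) (l : nat).
Local Notation S := {mpoly K[l]}.

(** Hilbert's theorem bounds the cokernel of f by l; [pdim_le_ker] takes off one unit for the image
    of f and one more for M, its second syzygy. *)
Lemma second_syzygy_pdim (M F G : lmodType S) (i : {linear M -> F}) (f : {linear F -> G}) :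
  projective_module F -> projective_module G ->
  injective i -> (forall x, f x = 0 <-> exists y, i y = x) -> pdim_le (l - 2) M.
Proof.
move=> PF PG ii ex.
have cl : (fun y => exists x, f x = y) 0 /\
    forall a x y, (exists z, f z = x) -> (exists z, f z = y) -> exists z, f z = a *: x + y.
  split; first by exists 0; rewrite linear0.
  by move=> a x y [x' <-] [y' <-]; exists (a *: x' + y'); rewrite linearP.
pose U := @Submodule S G _ cl.
have [C [q [qs qk]]] := cokernel_exists U.
have [f' f'E] := @submod_corestrict _ _ U F f (fun x => ex_intro _ x erefl).
have s1 : ses (submod_incl : {linear submod_type U -> G}) q.
  split=> //; first exact: submod_incl_inj.
  by move=> x; rewrite qk; split=> [/submod_eltP|[y <-]] //; exact: (submod_valP y).
have s2 : ses i f'.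
  split=> // [y|x].
    by have [x xE] := submod_valP y; exists x; apply: submod_incl_inj; rewrite f'E.
  rewrite -ex -f'E; split=> [->|h]; first exact: linear0.
  by apply: submod_incl_inj; rewrite h linear0.
have pU : pdim_le (l - 1) (submod_type U).
  apply: (pdim_le_ker s1); first exact: (pdim_le_leq (leq0n _) (PG : pdim_le 0 G)).
  by apply: pdim_le_leq (hilbert_syzygy C); rewrite subn1 leqSpred.
apply: (pdim_le_ker s2); first exact: (pdim_le_leq (leq0n _) (PF : pdim_le 0 F)).
by apply: pdim_le_leq pU; rewrite -[2%N]addn1 subnDA [X in (_ <= X.+1)%N]subn1 leqSpred.
Qed.

End SecondSyzygy.

(** * Exterior forms and their values on vectors *)

Section Below.
Variable l : nat.
Implicit Types (i k : 'I_l) (J : {set 'I_l}).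

(** The sign exponent: how many factors dx_j with j in J precede dx_i when the product is sorted. *)
Definition below i J : nat := #|[set j in J | (j < i)%N]|.

Lemma below_setU1 i k J : k \notin J -> below i (k |: J) = ((k < i) + below i J)%N.
Proof.
move=> kJ; rewrite /below; case: ltnP => ki.
  have -> : [set j in k |: J | (j < i)%N] = k |: [set j in J | (j < i)%N].
    by apply/setP => j; rewrite !inE; case: eqP => [->|] //=; rewrite ki.
  by rewrite cardsU1 inE (negPf kJ).
rewrite add0n; congr #|pred_of_set _|; apply/setP => j; rewrite !inE.
by case: eqP => [->|] //=; rewrite ltnNge ki andbF.
Qed.

Lemma below_setU1_same i J : below i (i |: J) = below i J.
Proof.
rewrite /below; congr #|pred_of_set _|; apply/setP => j; rewrite !inE.
by case: eqP => [->|] //=; rewrite ltnn andbF.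
Qed.

Lemma below_setD1 i k J : k \in J -> below i J = ((k < i) + below i (J :\ k))%N.
Proof. by move=> kJ; rewrite -{1}(setD1K kJ) below_setU1 // !inE eqxx. Qed.

Lemma enum_setU1 i J : i \notin J ->
  exists xs ys, [/\ enum J = xs ++ ys, enum (i |: J) = xs ++ i :: ys & size xs = below i J].
Proof.
move=> iJ; pose r : rel 'I_l := fun a b => (a < b)%N.
have rt : transitive r by move=> b a c; apply: ltn_trans.
have ri : irreflexive r by move=> a; apply: ltnn.
have enum_pw (A : {set 'I_l}) : pairwise r (enum A).
  rewrite /enum_mem pairwise_filter // -enumT.
  have -> : pairwise r (enum 'I_l) = pairwise ltn (map val (enum 'I_l)) by rewrite pairwise_map.
  by rewrite val_enum_ord -sorted_pairwise ?iota_ltn_sorted //; exact: ltn_trans.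
pose xs := [seq j : 'I_l <- enum J | (j < i)%N].
pose ys := [seq j : 'I_l <- enum J | (i < j)%N].
have mxs j : j \in xs = (j < i)%N && (j \in J) by rewrite mem_filter mem_enum.
have mys j : j \in ys = (i < j)%N && (j \in J) by rewrite mem_filter mem_enum.
have pxs : pairwise r xs by rewrite pairwise_filter.
have pys : pairwise r ys by rewrite pairwise_filter.
exists xs, ys; split.
- apply: (irr_sorted_eq rt ri); rewrite ?sorted_pairwise //.
    rewrite pairwise_cat pxs pys !andbT; apply/allrelP => a b.
    by rewrite mxs mys => /andP[h _] /andP[h' _]; apply: ltn_trans h h'.
  move=> j; rewrite mem_cat mxs mys mem_enum -andb_orl.
  case: (ltngtP j i) => //= ji; apply: contraNF iJ => jJ.
  by rewrite -(val_inj ji).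
- apply: (irr_sorted_eq rt ri); rewrite ?sorted_pairwise //.
    rewrite pairwise_cat /= pxs pys !andbT; apply/andP; split; last first.
      by apply/allP => b; rewrite mys => /andP[].
    apply/allrelP => a b; rewrite mxs inE mys => /andP[h _] /orP[/eqP ->//|/andP[h' _]].
    exact: ltn_trans h h'.
  move=> j; rewrite mem_cat inE mxs mys mem_enum !inE.
  case: (ltngtP j i) => [ji|ji|/val_inj ->]; rewrite ?eqxx //= -val_eqE ?(ltn_eqF ji) ?(gtn_eqF ji) ?orbF //.
- rewrite /below cardE; apply: perm_size; apply: uniq_perm.
  + by rewrite filter_uniq // enum_uniq.
  + exact: enum_uniq.
  + by move=> j; rewrite mxs mem_enum inE andbC.
Qed.

End Below.

Section Interior.
Variables (R : comNzRingType).

Section Ops.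
Variable l : nat.
Local Notation E := {ffun {set 'I_l} -> R^o}.
Implicit Types (w : E) (u v : 'rV[R]_l) (b : 'cV[R]_l).

Lemma regular_scaleE (a : R) (x : R^o) : a *: x = a * x :> R.
Proof. by []. Qed.

Definition interior v w : E :=
  [ffun J : {set 'I_l} => \sum_(i | i \notin J) (-1) ^+ below i J * v 0 i * w (i |: J)].

Definition wedge1 b w : E :=
  [ffun J : {set 'I_l} => \sum_(i in J) (-1) ^+ below i J * b i 0 * w (J :\ i)].

Definition pairing v b : R := (v *m b) 0 0.

Lemma interior_linear v : linear (interior v).
Proof.
move=> a w w'; apply/ffunP => J; rewrite !ffunE scaler_sumr -big_split /=.
by apply: eq_bigr => i _; rewrite !ffunE !regular_scaleE mulrDr [in LHS]mulrCA.
Qed.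
HB.instance Definition _ v := GRing.isLinear.Build R E E _ (interior v) (interior_linear v).

Lemma interiorDl a u v w : interior (a *: u + v) w = a *: interior u w + interior v w.
Proof.
apply/ffunP => J; rewrite !ffunE scaler_sumr -big_split /=.
by apply: eq_bigr => i _; rewrite !mxE !regular_scaleE; ring.
Qed.

Lemma interior0l w : interior 0 w = 0.
Proof. by have := interiorDl (-1) 0 0 w; rewrite scaler0 addr0 scaleN1r addNr. Qed.

(** The double sum runs over ordered pairs of new indices, and exchanging the two indices of a pair
    flips the sign. *)
Lemma interior_sq v w : interior v (interior v w) = 0.
Proof.
apply/ffunP => J; rewrite !ffunE.
pose F i k : R := (-1) ^+ below i J * v 0 i * ((-1) ^+ below k (i |: J) * v 0 k * w (k |: (i |: J))).
pose P i k := (i \notin J) && (k \notin i |: J).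
have -> : \sum_(i | i \notin J) (-1) ^+ below i J * v 0 i * (interior v w (i |: J) : R) =
          \sum_(p : 'I_l * 'I_l | P p.1 p.2) F p.1 p.2.
  transitivity (\sum_(i | i \notin J) \sum_(k | k \notin i |: J) F i k); last by rewrite pair_big_dep.
  by apply: eq_bigr => i iJ; rewrite ffunE mulr_sumr.
rewrite (bigID (fun p : 'I_l * 'I_l => (p.1 < p.2)%N)) /=.
rewrite [X in _ + X](reindex_inj (h := fun p : 'I_l * 'I_l => (p.2, p.1))) /=; last first.
  by move=> [a b] [c d] [-> ->].
rewrite -[RHS](addrN (\sum_(p : 'I_l * 'I_l | P p.1 p.2 && (p.1 < p.2)%N) F p.1 p.2)).
congr (_ + _); rewrite -sumrN; apply: eq_big => [[i k]|[i k]] /=.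
  rewrite /P !inE !negb_or; case: (ltngtP i k) => [ik|ik|/val_inj ->]; rewrite ?andbF ?eqxx ?andbF //=.
  by rewrite !andbT -!val_eqE /= !(gtn_eqF ik, ltn_eqF ik) /= andbC.
rewrite -leqNgt /P !inE !negb_or => /andP[/andP[kJ /andP[ik iJ]] ki].
have {ki}ik : (i < k)%N by rewrite ltn_neqAle ki andbT.
rewrite /F setUCA !below_setU1 // (ltnNge k i) (ltnW ik) ik /= add0n exprS.
by ring.
Qed.

Lemma interior_anti u v w : interior u (interior v w) = - interior v (interior u w).
Proof.
have := interior_sq (u + v) w.
have D x y z : interior (x + y) z = interior x z + interior y z.
  by have := interiorDl 1 x y z; rewrite !scale1r.
rewrite !D !linearD /= !interior_sq add0r addr0 => /eqP.
by rewrite addr_eq0 => /eqP.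
Qed.

Lemma wedge1_linear b : linear (wedge1 b).
Proof.
move=> a w w'; apply/ffunP => J; rewrite !ffunE scaler_sumr -big_split /=.
by apply: eq_bigr => i _; rewrite !ffunE !regular_scaleE mulrDr [in LHS]mulrCA.
Qed.
HB.instance Definition _ b := GRing.isLinear.Build R E E _ (wedge1 b) (wedge1_linear b).

Lemma sign_sq n : (-1) ^+ n * (-1) ^+ n = 1 :> R.
Proof. by rewrite -exprD addnn -muln2 mulnC exprM sqrrN !expr1n. Qed.

Lemma sign_cancel n (x y z : R) : (-1) ^+ n * x * ((-1) ^+ n * y * z) = x * y * z.
Proof. by rewrite mulrACA [_ * (_ * y)]mulrA sign_sq mul1r mulrCA mulrA. Qed.

(** The diagonal terms add up to the pairing, the indices outside J coming from the left-hand side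
    and those in J from the subtracted term; the off-diagonal terms cancel in pairs. *)
Lemma interior_wedge1 v b w :
  interior v (wedge1 b w) = pairing v b *: w - wedge1 b (interior v w).
Proof.
apply/eqP; rewrite eq_sym subr_eq eq_sym; apply/eqP/ffunP => J; rewrite !ffunE.
pose G i k : R := (-1) ^+ below i J * v 0 i * ((-1) ^+ below k (i |: J) * b k 0 * w ((i |: J) :\ k)).
pose H i k : R := (-1) ^+ below k J * b k 0 * ((-1) ^+ below i (J :\ k) * v 0 i * w (i |: (J :\ k))).
have -> : \sum_(i | i \notin J) (-1) ^+ below i J * v 0 i * (wedge1 b w (i |: J) : R) =
  \sum_(i | i \notin J) v 0 i * b i 0 * w J + \sum_(i | i \notin J) \sum_(k in J) G i k.
  rewrite -big_split /=; apply: eq_bigr => i iJ; rewrite ffunE (big_setU1 _ iJ) /=.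
  rewrite mulrDr mulr_sumr; congr (_ + _).
  by rewrite setU1K // below_setU1_same sign_cancel.
have -> : \sum_(k in J) (-1) ^+ below k J * b k 0 * (interior v w (J :\ k) : R) =
  \sum_(k in J) v 0 k * b k 0 * w J + \sum_(k in J) \sum_(i | i \notin J) H i k.
  rewrite -big_split /=; apply: eq_bigr => k kJ; rewrite ffunE.
  rewrite (bigD1 k) ?setD11 //= mulrDr mulr_sumr; congr (_ + _).
    rewrite setD1K // (below_setD1 k kJ) ltnn add0n.
    by rewrite sign_cancel [b k 0 * _]mulrC.
  apply: eq_bigl => i; rewrite !inE; case: eqP => [->|]; rewrite ?kJ //= ?andbT //.
rewrite addrACA [X in _ + X](_ : _ = 0) ?addr0.
  rewrite regular_scaleE /pairing mxE mulr_suml [RHS](bigID (fun i => i \in J)) /= addrC //.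
rewrite [X in _ + X]exchange_big -big_split big1 //= => i iJ.
rewrite -big_split big1 //= => k kJ.
have ik : i != k by apply: contraNneq iJ => ->.
rewrite /G /H.
have -> : (i |: J) :\ k = i |: (J :\ k).
  by apply/setP => j; rewrite !inE; case: (j =P i) => [->|] //=; rewrite ik.
rewrite below_setU1 // (below_setD1 i kJ).
case: (ltngtP i k) => [lik|lki|/val_inj e]; last by rewrite e eqxx in ik.
  by rewrite add0n add1n exprS; ring.
by rewrite add0n add1n exprS; ring.
Qed.

(** Contracts with all vectors of the list and reads the coefficient at the empty set: the value of
    a p-form on p vectors. Divisibility conditions stated on values are free of coordinates and
    behave well under pullback. *)
Definition ev w (vs : seq 'rV[R]_l) : R := foldl (fun w v => interior v w) w vs set0.

Lemma ev_cons w v vs : ev w (v :: vs) = ev (interior v w) vs.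
Proof. by []. Qed.

Lemma ev_linear vs : linear_for *%R (ev^~ vs).
Proof.
elim: vs => [|v vs IH] a w w'; first by rewrite /ev /= !ffunE.
by rewrite !ev_cons linearP IH.
Qed.

Lemma evD w w' vs : ev (w + w') vs = ev w vs + ev w' vs.
Proof. by have := ev_linear vs 1 w w'; rewrite scale1r mul1r. Qed.
Lemma ev0 vs : ev 0 vs = 0.
Proof. by have := ev_linear vs (-1) 0 0; rewrite scaler0 addr0 mulN1r addNr. Qed.
Lemma evZ a w vs : ev (a *: w) vs = a * ev w vs.
Proof. by have := ev_linear vs a w 0; rewrite ev0 !addr0. Qed.
Lemma evN w vs : ev (- w) vs = - ev w vs.
Proof. by rewrite -scaleN1r evZ mulN1r. Qed.
Lemma evB w w' vs : ev (w - w') vs = ev w vs - ev w' vs.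
Proof. by rewrite evD evN. Qed.

Lemma ev_cat_cons w xs a u v ys :
  ev w (xs ++ (a *: u + v) :: ys) = a * ev w (xs ++ u :: ys) + ev w (xs ++ v :: ys).
Proof.
elim: xs w => [|x xs IH] w /=; last by rewrite !ev_cons IH.
by rewrite !ev_cons interiorDl evD evZ.
Qed.

Lemma ev_consP w a u v ys : ev w ((a *: u + v) :: ys) = a * ev w (u :: ys) + ev w (v :: ys).
Proof. exact: (ev_cat_cons w [::]). Qed.

Lemma ev_consZ w a u ys : ev w ((a *: u) :: ys) = a * ev w (u :: ys).
Proof.
have := ev_consP w a u 0 ys; rewrite addr0 => ->.
by rewrite [ev w (0 :: _)]ev_cons interior0l ev0 addr0.
Qed.

Lemma ev_cons_sum w (I : Type) (r : seq I) (F : I -> 'rV[R]_l) ys :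
  ev w (\sum_(i <- r) F i :: ys) = \sum_(i <- r) ev w (F i :: ys).
Proof.
elim: r => [|i r IH]; first by rewrite !big_nil ev_cons interior0l ev0.
rewrite !big_cons -IH -[F i in LHS]scale1r ev_consP mul1r //.
Qed.

Lemma ev_move w xs v ys : ev w (xs ++ v :: ys) = (-1) ^+ size xs * ev w (v :: xs ++ ys).
Proof.
elim: xs w => [|x xs IH] w /=; first by rewrite mul1r.
by rewrite ev_cons IH !ev_cons interior_anti evN exprS mulN1r mulNr mulrN.
Qed.

Lemma ev_dup w v xs ys : ev w (v :: xs ++ v :: ys) = 0.
Proof. by rewrite ev_cons ev_move !ev_cons interior_sq ev0 mulr0. Qed.

Lemma ev_scale_all w (c : R) vs : ev w [seq c *: v | v <- vs] = c ^+ size vs * ev w vs.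
Proof.
elim: vs w => [|v vs IH] w /=; first by rewrite mul1r.
by rewrite ev_consZ ev_cons IH -ev_cons exprS mulrA.
Qed.

Lemma ev_wedge1_annih b w vs : (forall v, v \in vs -> pairing v b = 0) -> ev (wedge1 b w) vs = 0.
Proof.
elim: vs w => [|v vs IH] w h; first by rewrite /ev /= ffunE big_set0.
rewrite ev_cons interior_wedge1 h ?mem_head // scale0r sub0r evN IH ?oppr0 // => u uvs.
by apply: h; rewrite inE uvs orbT.
Qed.

Lemma ev_wedge1_cons b w v vs : (forall u, u \in vs -> pairing u b = 0) ->
  ev (wedge1 b w) (v :: vs) = pairing v b * ev w vs.
Proof.
by move=> h; rewrite ev_cons interior_wedge1 evB evZ ev_wedge1_annih // subr0.
Qed.

Lemma pform_interior p v w : is_pform p.+1 w -> is_pform p (interior v w).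
Proof.
move=> pw J Jp; rewrite ffunE big1 // => i iJ; rewrite pw ?mulr0 //.
by rewrite cardsU1 iJ add1n eqSS.
Qed.

Lemma pform0_interior v w : is_pform 0 w -> interior v w = 0.
Proof.
move=> pw; apply/ffunP => J; rewrite !ffunE big1 // => i iJ; rewrite pw ?mulr0 //.
by rewrite cardsU1 iJ.
Qed.

Lemma pform_wedge1 p b w : is_pform p w -> is_pform p.+1 (wedge1 b w).
Proof.
move=> pw J Jp; rewrite ffunE big1 // => i iJ; rewrite pw ?mulr0 //.
by apply: contra Jp => /eqP <-; rewrite (cardsD1 i J) iJ.
Qed.

Lemma pform_ev p w vs : is_pform p w -> size vs != p -> ev w vs = 0.
Proof.
elim: vs p w => [|v vs IH] [|p] w pw //= s.
- by rewrite /ev /= pw // cards0.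
- by rewrite ev_cons pform0_interior // ev0.
- by rewrite ev_cons; apply: IH s; exact: pform_interior.
Qed.

Lemma interior_delta i w J :
  interior (delta_mx 0 i) w J = if i \in J then 0 else (-1) ^+ below i J * w (i |: J).
Proof.
rewrite ffunE; case: ifPn => iJ.
  apply: big1 => k kJ; rewrite mxE eqxx /=.
  by case: eqP kJ iJ => [->|_]; rewrite ?mulr0 ?mul0r // => /negPf ->.
rewrite (bigD1 i) //= mxE !eqxx mulr1 big1 ?addr0 // => k /andP[_ ki].
by rewrite mxE (negPf ki) andbF mulr0 mul0r.
Qed.

Lemma ev_delta w (J : {set 'I_l}) : ev w [seq delta_mx 0 i | i <- enum J] = w J.
Proof.
move En: #|J| => n; elim: n J w En => [|n IH] J w.
  by move=> /cards0_eq ->; rewrite enum_set0.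
move=> En; have [i0 i0J] : exists i, i \in J by apply/set0Pn; rewrite -card_gt0 En.
(* Contracting with the smallest index of J makes every sign trivial. *)
pose i := [arg min_(i < i0 in J) i]%N.
have [iJ imin] : i \in J /\ forall j, j \in J -> (i <= j)%N.
  by rewrite /i; case: arg_minnP.
have b0 : below i (J :\ i) = 0%N.
  rewrite /below; apply/eqP; rewrite cards_eq0; apply/eqP/setP => j; rewrite !inE.
  by case: eqP => //= _; apply/negbTE/negP => /andP[/imin ij]; rewrite ltnNge ij.
have [] := @enum_setU1 _ i (J :\ i); first by rewrite !inE eqxx.
move=> [|x xs] [ys [e1 e2]]; last by rewrite b0.
move=> _; rewrite setD1K // in e2; rewrite e2 /= ev_cons -[ys]e1 IH.
  by rewrite interior_delta !inE eqxx /= b0 mul1r setD1K.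
by move: En; rewrite (cardsD1 i) iJ => -[].
Qed.

Lemma ev_coefP p w (P : R -> Prop) : P 0 -> is_pform p w ->
  (forall vs, size vs = p -> P (ev w vs)) -> forall J, P (w J).
Proof.
move=> P0 pw h J; have [e|ne] := eqVneq #|J| p; last by rewrite pw.
by rewrite -ev_delta; apply: h; rewrite size_map -cardE.
Qed.

Lemma ev_inj p w w' : is_pform p w -> is_pform p w' ->
  (forall vs, size vs = p -> ev w vs = ev w' vs) -> w = w'.
Proof.
move=> pw pw' h; apply/ffunP => J; have [e|ne] := eqVneq #|J| p; last by rewrite pw ?pw'.
by rewrite -!ev_delta; apply: h; rewrite size_map -cardE.
Qed.

(* Multilinear expansion along [v = w + z nu]; terms containing [nu] twice vanish. *)
Lemma ev_split (W : 'rV[R]_l -> Prop) (Z J : R -> Prop) (nu : 'rV[R]_l) p w :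
  J 0 -> (forall x y, J x -> J y -> J (x + y)) -> (forall a x, J x -> J (a * x)) ->
  (forall ws, size ws = p -> (forall v, v \in ws -> W v) -> J (ev w ws)) ->
  (forall z ws, Z z -> (size ws).+1 = p -> (forall v, v \in ws -> W v) -> J (z * ev w (nu :: ws))) ->
  forall vs, size vs = p ->
  (forall v, v \in vs -> exists x z, [/\ v = x + z *: nu, W x & Z z]) -> J (ev w vs).
Proof.
move=> J0 JD JM h0 h1.
have aux1 vs hs z : Z z -> (size hs + size vs).+1 = p -> (forall v, v \in hs -> W v) ->
    (forall v, v \in vs -> exists x z, [/\ v = x + z *: nu, W x & Z z]) ->
    J (z * ev w (nu :: hs ++ vs)).
  elim: vs hs => [|v vs IH] hs Zz sz hW hv.
    by rewrite cats0; apply: h1 => //; rewrite -sz addn0.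
  have [x [c [-> Wx _]]] := hv v (mem_head _ _).
  rewrite addrC (ev_cat_cons w (nu :: hs)) ev_dup mulr0 add0r.
  rewrite -cat_rcons; apply: IH => //.
  - by rewrite size_rcons -sz /= addSnnS.
  - by move=> u; rewrite mem_rcons inE => /orP[/eqP ->|/hW].
  - by move=> u uvs; apply: hv; rewrite inE uvs orbT.
have aux2 vs hs : (size hs + size vs)%N = p -> (forall v, v \in hs -> W v) ->
    (forall v, v \in vs -> exists x z, [/\ v = x + z *: nu, W x & Z z]) ->
    J (ev w (hs ++ vs)).
  elim: vs hs => [|v vs IH] hs sz hW hv.
    by rewrite cats0; apply: h0 => //; rewrite -sz addn0.
  have hv' u : u \in vs -> exists x z, [/\ u = x + z *: nu, W x & Z z].
    by move=> uvs; apply: hv; rewrite inE uvs orbT.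
  have [x [c [-> Wx Zc]]] := hv v (mem_head _ _).
  rewrite addrC ev_cat_cons; apply: JD.
    rewrite ev_move mulrCA; apply: JM; apply: aux1 => //; by rewrite -sz /= addnS.
  rewrite -cat_rcons; apply: IH => //.
  - by rewrite size_rcons -sz /= addSnnS.
  - by move=> u; rewrite mem_rcons inE => /orP[/eqP ->|/hW].
by move=> vs sz hv; apply: (aux2 vs [::]).
Qed.

End Ops.

Section Pull.
Variables (l n : nat) (M : 'M[R]_(n, l)).

Definition pull (w : {ffun {set 'I_l} -> R^o}) : {ffun {set 'I_n} -> R^o} :=
  [ffun J : {set 'I_n} => ev w [seq row i M | i <- enum J]].

Lemma interior_pull u w : interior u (pull w) = pull (interior (u *m M) w).
Proof.
apply/ffunP => J; rewrite !ffunE -ev_cons.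
have -> : u *m M = \sum_i u 0 i *: row i M.
  apply/rowP => j; rewrite mxE summxE; apply: eq_bigr => i _; by rewrite !mxE.
rewrite ev_cons_sum [RHS](bigID (fun i => i \in J)) /= [X in _ = X + _]big1 ?add0r => [|i iJ]; last first.
  rewrite ev_consZ; have : i \in enum J by rewrite mem_enum.
  by case/splitPr => p1 p2; rewrite map_cat /= ev_dup mulr0.
apply: eq_bigr => i iJ; rewrite ffunE ev_consZ.
have [xs [ys [e1 e2 <-]]] := enum_setU1 iJ.
rewrite e1 e2 !map_cat /= ev_move size_map.
by rewrite mulrACA sign_sq mul1r.
Qed.

Lemma ev_pull w us : ev (pull w) us = ev w [seq u *m M | u <- us].
Proof.
elim: us w => [|u us IH] w; first by rewrite /ev /= ffunE enum_set0.
by rewrite /= ev_cons interior_pull IH.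
Qed.

Lemma pform_pull p w : is_pform p w -> is_pform p (pull w).
Proof. by move=> pw J Jp; rewrite ffunE (pform_ev pw) // size_map -cardE. Qed.

End Pull.

End Interior.

Section BaseChange.
Variables (R R' : comNzRingType) (f : {rmorphism R -> R'}) (l : nat).

Definition map_form (w : {ffun {set 'I_l} -> R^o}) : {ffun {set 'I_l} -> R'^o} :=
  [ffun J => f (w J)].

Lemma interior_map v w : interior (map_mx f v) (map_form w) = map_form (interior v w).
Proof.
apply/ffunP => J; rewrite !ffunE rmorph_sum; apply: eq_bigr => i _.
by rewrite !ffunE mxE !rmorphM rmorph_sign.
Qed.

Lemma ev_map w vs : ev (map_form w) [seq map_mx f v | v <- vs] = f (ev w vs).
Proof.
elim: vs w => [|v vs IH] w; first by rewrite /ev /= ffunE.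
by rewrite /= ev_cons interior_map IH.
Qed.

Lemma pform_map p w : is_pform p w -> is_pform p (map_form w).
Proof. by move=> pw J Jp; rewrite ffunE pw // rmorph0. Qed.

End BaseChange.

(** * Linear forms and substitutions *)

Section Divisibility.
Variable R : idomainType.

Definition dvdr (a b : R) : Prop := exists c, b = a * c.
(** Units satisfy this too; where they must be excluded, [~ dvdr p 1] is asked for separately. *)
Definition prime_elt (p : R) : Prop :=
  p != 0 /\ forall a b, dvdr p (a * b) -> dvdr p a \/ dvdr p b.

Lemma dvdr0 a : dvdr a 0.
Proof. by exists 0; rewrite mulr0. Qed.
Lemma dvdrr a : dvdr a a.
Proof. by exists 1; rewrite mulr1. Qed.
Lemma dvd1r a : dvdr 1 a.
Proof. by exists a; rewrite mul1r. Qed.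
Lemma dvdrD a b c : dvdr a b -> dvdr a c -> dvdr a (b + c).
Proof. by case=> x -> [y ->]; exists (x + y); rewrite mulrDr. Qed.
Lemma dvdrN a b : dvdr a b -> dvdr a (- b).
Proof. by case=> x ->; exists (- x); rewrite mulrN. Qed.
Lemma dvdrB a b c : dvdr a b -> dvdr a c -> dvdr a (b - c).
Proof. by move=> h h'; apply: dvdrD => //; apply: dvdrN. Qed.
Lemma dvdr_mull a b c : dvdr a c -> dvdr a (b * c).
Proof. by case=> x ->; exists (b * x); rewrite mulrCA. Qed.
Lemma dvdr_mulr a b c : dvdr a b -> dvdr a (b * c).
Proof. by move=> h; rewrite mulrC; apply: dvdr_mull. Qed.
Lemma dvdr_trans a b c : dvdr a b -> dvdr b c -> dvdr a c.
Proof. by case=> x -> [y ->]; exists (x * y); rewrite mulrA. Qed.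
Lemma dvdr_mul a b c d : dvdr a b -> dvdr c d -> dvdr (a * c) (b * d).
Proof. by case=> x -> [y ->]; exists (x * y); rewrite mulrACA. Qed.
Lemma dvdr_mul2l a b c : a != 0 -> dvdr (a * b) (a * c) -> dvdr b c.
Proof. by move=> a0 [x]; rewrite -mulrA => /(mulfI a0) ->; exists x. Qed.
Lemma dvdr_exp2l a m n : (m <= n)%N -> dvdr (a ^+ m) (a ^+ n).
Proof. by move=> /subnKC <-; exists (a ^+ (n - m)); rewrite exprD. Qed.

Lemma prime_exp_dvd p b k g : prime_elt p -> ~ dvdr p b ->
  dvdr (p ^+ k) (g * b) -> dvdr (p ^+ k) g.
Proof.
move=> [p0 pp] pb; elim: k g => [|k IH] g; first by move=> _; exact: dvd1r.
rewrite exprS => h.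
have [[g' g'E]|//] := pp g b (dvdr_trans (dvdr_mulr _ (dvdrr p)) h).
move: h; rewrite g'E -mulrA => /(dvdr_mul2l p0)/IH h.
exact: dvdr_mul (dvdrr p) h.
Qed.

Lemma prime_prod_dvd p (I : Type) (r : seq I) (P : pred I) (F : I -> R) : prime_elt p ->
  ~ dvdr p 1 -> dvdr p (\prod_(i <- r | P i) F i) -> exists i, P i /\ dvdr p (F i).
Proof.
move=> [_ pp] p1; elim: r => [|i r IH]; first by rewrite big_nil.
rewrite big_cons; case: ifP => // Pi /pp[h|/IH //]; by exists i.
Qed.

Lemma prime_exp_ndvd p b k : prime_elt p -> ~ dvdr p 1 -> ~ dvdr p b -> ~ dvdr p (b ^+ k).
Proof.
move=> [_ pp] p1 pb; elim: k => [|k IH]; rewrite ?expr0 // exprS => /pp[].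
  exact: pb.
exact: IH.
Qed.

Lemma coprime_prod_dvd (I : eqType) (s : seq I) (F : I -> R) (k : I -> nat) g :
  uniq s -> {in s, forall i, prime_elt (F i) /\ ~ dvdr (F i) 1} ->
  {in s &, forall i j, i != j -> ~ dvdr (F i) (F j)} ->
  {in s, forall i, dvdr (F i ^+ k i) g} -> dvdr (\prod_(i <- s) F i ^+ k i) g.
Proof.
elim: s => [|i s IH] //=; first by rewrite big_nil => *; exact: dvd1r.
case/andP=> si us pF cF dF; rewrite big_cons.
have [g' g'E] : dvdr (\prod_(j <- s) F j ^+ k j) g.
  apply: IH => //.
  - by move=> j js; apply: pF; rewrite inE js orbT.
  - by move=> j j' js j's; apply: cF; rewrite inE ?js ?j's orbT.
  - by move=> j js; apply: dF; rewrite inE js orbT.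
have [Fp F1] := pF i (mem_head _ _).
rewrite g'E mulrC; apply: dvdr_mul (dvdrr _) _.
apply: (@prime_exp_dvd _ (\prod_(j <- s) F j ^+ k j)) => //; last first.
  by rewrite mulrC -g'E; apply: dF; rewrite mem_head.
rewrite big_seq => /(prime_prod_dvd Fp F1)[j [js]].
apply: prime_exp_ndvd => //; apply: cF; rewrite ?mem_head ?inE ?js ?orbT //.
by apply: contraNneq si => ->.
Qed.

End Divisibility.

Section LinearForms.
Variable K : fieldType.
Local Notation S l := {mpoly K[l]}.

Definition lform l (a : 'cV[K]_l) : S l := \sum_(i < l) a i 0 *: 'X_i.

Lemma lformD l (a b : 'cV[K]_l) : lform (a + b) = lform a + lform b.
Proof. by rewrite /lform -big_split; apply: eq_bigr => i _; rewrite mxE scalerDl. Qed.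

Lemma lformZ l c (a : 'cV[K]_l) : lform (c *: a) = c%:MP * lform a.
Proof.
by rewrite /lform mul_mpolyC scaler_sumr; apply: eq_bigr => i _; rewrite mxE scalerA.
Qed.

Lemma lform0 l : lform (0 : 'cV[K]_l) = 0.
Proof. by apply: big1 => i _; rewrite mxE scale0r. Qed.

Lemma lform_eq0 l (a : 'cV[K]_l) : lform a = 0 -> a = 0.
Proof.
move=> h; apply/colP => i; rewrite mxE.
have := congr1 (mcoeff U_(i)%MM) h; rewrite mcoeff0 /lform raddf_sum /= (bigD1 i) //=.
rewrite mcoeffZ mcoeffX eqxx mulr1 big1 ?addr0 // => j ji.
by rewrite mcoeffZ mcoeffX eq_mnm1 (negPf ji) mulr0.
Qed.

(** Composition of a polynomial function with the linear map u |-> u M on row vectors. *)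
Definition subst_mx n l (M : 'M[K]_(n, l)) : {rmorphism S l -> S n} :=
  mmap (@mpolyC n K) (fun j => lform (col j M)).

Lemma subst_mxC n l (M : 'M[K]_(n, l)) c : subst_mx M c%:MP = c%:MP.
Proof. by rewrite /subst_mx /= mmapC. Qed.

Lemma subst_mxX n l (M : 'M[K]_(n, l)) j : subst_mx M 'X_j = lform (col j M).
Proof. by rewrite /subst_mx /= mmapX mmap1U. Qed.

Lemma subst_lform n l (M : 'M[K]_(n, l)) a : subst_mx M (lform a) = lform (M *m a).
Proof.
rewrite /lform rmorph_sum /=.
transitivity (\sum_(j < l) \sum_(i < n) (M i j * a j 0) *: ('X_i : S n)).
  apply: eq_bigr => j _; rewrite -mul_mpolyC rmorphM [X in X * _]subst_mxC subst_mxX.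
  by rewrite mul_mpolyC scaler_sumr; apply: eq_bigr => i _; rewrite mxE scalerA mulrC.
by rewrite exchange_big; apply: eq_bigr => i _; rewrite mxE scaler_suml.
Qed.

Lemma subst_mx_comp k n l (N : 'M[K]_(k, n)) (M : 'M[K]_(n, l)) f :
  subst_mx N (subst_mx M f) = subst_mx (N *m M) f.
Proof.
elim/mpoly_alg_ind: f => [c|p q hp hq|p q hp hq|j].
- by rewrite !subst_mxC.
- by rewrite !rmorphD hp hq.
- by rewrite !rmorphM hp hq.
- by rewrite !subst_mxX subst_lform colE mulmxA -colE.
Qed.

Lemma subst_mx1 l f : subst_mx (1%:M : 'M[K]_l) f = f.
Proof.
elim/mpoly_alg_ind: f => [c|p q hp hq|p q hp hq|j].
- by rewrite subst_mxC.
- by rewrite rmorphD hp hq.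
- by rewrite rmorphM hp hq.
- rewrite subst_mxX /lform (bigD1 j) //= !mxE eqxx scale1r big1 ?addr0 // => i ij.
  by rewrite !mxE (negPf ij) scale0r.
Qed.

(* Setting [lform a = 0] along the direction [nu]. *)
Section Modulo.
Variables (l : nat) (a : 'cV[K]_l) (nu : 'rV[K]_l).
Hypothesis nua : nu *m a = 1%:M.

Lemma lform_mod f : dvdr (lform a) (f - subst_mx (1%:M - a *m nu) f).
Proof.
elim/mpoly_alg_ind: f => [c|p q hp hq|p q hp hq|j].
- by rewrite subst_mxC subrr; exact: dvdr0.
- by rewrite rmorphD opprD addrACA; exact: (dvdrD hp hq).
- rewrite rmorphM.
  set p' := subst_mx _ p in hp *; set q' := subst_mx _ q in hq *.
  have -> : p * q - p' * q' = p * (q - q') + (p - p') * q' by ring.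
  exact: (dvdrD (dvdr_mull _ hq) (dvdr_mulr _ hp)).
- have -> : subst_mx (1%:M - a *m nu) 'X_j = 'X_j + (- nu 0 j) %:MP * lform a.
    rewrite subst_mxX -lformZ -[in RHS](subst_mx1 'X_j) subst_mxX -lformD; congr lform.
    by apply/colP => i; rewrite !mxE big_ord1 mulNr mulrC.
  by rewrite opprD addrA subrr sub0r; apply/dvdrN/dvdr_mull/dvdrr.
Qed.

Lemma lform_dvdP f : dvdr (lform a) f <-> subst_mx (1%:M - a *m nu) f = 0.
Proof.
split=> [[g ->]|h].
  rewrite rmorphM subst_lform mulmxBl mul1mx -mulmxA nua mulmx1 subrr.
  by rewrite lform0 mul0r.
by have := lform_mod f; rewrite h subr0.
Qed.

(** By [lform_dvdP] the multiples of [lform a] are the kernel of a ring morphism into a domain. *)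
Lemma lform_prime_aux : prime_elt (lform a) /\ ~ dvdr (lform a) 1.
Proof.
split; last by move=> /lform_dvdP/eqP; rewrite rmorph1 oner_eq0.
split.
  apply/eqP => /lform_eq0 a0; have := nua; rewrite a0 mulmx0 => /matrixP/(_ 0 0)/eqP.
  by rewrite !mxE eq_sym oner_eq0.
move=> f g /lform_dvdP; rewrite rmorphM => /eqP; rewrite mulf_eq0.
by case/orP=> /eqP h; [left | right]; apply/lform_dvdP.
Qed.

Lemma lform_dvd_lform_aux b : dvdr (lform a) (lform b) -> b = (nu *m b) 0 0 *: a.
Proof.
move=> /lform_dvdP; rewrite subst_lform => /lform_eq0.
rewrite mulmxBl mul1mx => /eqP; rewrite subr_eq0 => /eqP {1}->.
by rewrite -mulmxA [nu *m b]mx11_scalar mul_mx_scalar !mxE eqxx mulr1n.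
Qed.
End Modulo.

Lemma normal_exists l (a : 'cV[K]_l) : a != 0 -> exists nu : 'rV[K]_l, nu *m a = 1%:M.
Proof.
move=> a0; have [i ai] : exists i, a i 0 != 0.
  apply/existsP; apply: contraNT a0 => /existsPn h.
  by apply/eqP/colP => i; rewrite mxE; apply/eqP; have := h i; rewrite negbK.
exists ((a i 0)^-1 *: delta_mx 0 i); rewrite -scalemxAl -rowE.
by apply/matrixP => x y; rewrite !ord1 !mxE eqxx mulVf.
Qed.

Lemma lform_prime l (a : 'cV[K]_l) : a != 0 -> prime_elt (lform a) /\ ~ dvdr (lform a) 1.
Proof. by move=> /normal_exists[nu h]; exact: lform_prime_aux h. Qed.

Lemma lform_dvd_lform l (a b : 'cV[K]_l) : a != 0 -> dvdr (lform a) (lform b) ->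
  exists c, b = c *: a.
Proof. by move=> /normal_exists[nu h] /(lform_dvd_lform_aux h) ->; eexists. Qed.

Lemma colinear_covectors l (a b : 'cV[K]_l) : a != 0 ->
  (forall v : 'rV[K]_l, v *m a = 0 -> v *m b = 0) -> exists c, b = c *: a.
Proof.
move=> /normal_exists[nu nua] h; exists ((nu *m b) 0 0).
apply/colP => i; have := h (delta_mx 0 i - a i 0 *: nu).
rewrite mulmxBl -scalemxAl nua -rowE => /(_ _)/matrixP/(_ 0 0).
rewrite mulmxBl -rowE -scalemxAl [nu *m b]mx11_scalar !mxE eqxx !mulr1n => e.
rewrite mulrC; apply/eqP; rewrite -subr_eq0; apply/eqP/e.
by apply/matrixP => x y; rewrite !ord1 !mxE eqxx mulr1 subrr.
Qed.

End LinearForms.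

(** * The variables form a regular sequence *)

Section RegularVariables.
Variables (K : fieldType) (l : nat).
Local Notation S := {mpoly K[l]}.

Lemma in_spanD (xs : seq S) (p q : S^o) : in_span xs p -> in_span xs q -> in_span xs (p + q).
Proof.
move=> [c ->] [d ->]; exists (fun i => c i + d i); rewrite -big_split.
by apply: eq_bigr => i _; rewrite scalerDr.
Qed.

Lemma in_spanM (xs : seq S) (p q : S) : @in_span S S^o xs p -> @in_span S S^o xs (q * p).
Proof.
move=> [c ->]; exists (fun i => q * c i); rewrite mulr_sumr.
by apply: eq_bigr => i _; rewrite !regular_scaleE mulrCA.
Qed.

Lemma in_span_mem (xs : seq S) (x : S) : x \in xs -> @in_span S S^o xs x.
Proof.
move=> xxs; exists (fun i => (i == index x xs)%:R).
rewrite -index_mem in xxs; rewrite (bigD1 (Ordinal xxs)) //= eqxx.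
rewrite big1 ?addr0 => [|i]; first by rewrite nth_index -?index_mem // regular_scaleE mulr1.
by rewrite -val_eqE /= => /negPf ->; rewrite regular_scaleE mulr0.
Qed.

Definition kill_vars (js : seq 'I_l) : {rmorphism S -> S} :=
  mmap (@mpolyC l K) (fun j => if j \in js then 0 else 'X_j).

Lemma in_span_varsP (js : seq 'I_l) (f : S) :
  @in_span S S^o [seq 'X_j | j <- js] f <-> kill_vars js f = 0.
Proof.
split=> [[c ->]|h].
  rewrite rmorph_sum big1 // => i _; rewrite regular_scaleE rmorphM.
  have ij : (i < size js)%N by rewrite -(size_map (fun j => 'X_j : S) js).
  have [j0 _] : exists j0, j0 \in js by exists (tnth (in_tuple js) (Ordinal ij)); rewrite mem_tnth.
  rewrite (nth_map j0) //= mmapX mmap1U mem_nth // mul0r //.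
rewrite -[f]subr0 -h; elim/mpoly_alg_ind: f {h} => [c|p q hp hq|p q hp hq|j].
- rewrite /= mmapC subrr; exists (fun _ => 0); rewrite big1 // => i _; exact: scaler0.
- by rewrite rmorphD opprD addrACA; exact: (in_spanD hp hq).
- rewrite rmorphM.
  set p' := kill_vars _ p in hp *; set q' := kill_vars _ q in hq *.
  have -> : p * q - p' * q' = p * (q - q') + q' * (p - p') by ring.
  exact: (in_spanD (in_spanM _ hq) (in_spanM _ hp)).
- rewrite /= mmapX mmap1U; case: ifP => jj.
    by rewrite subr0; apply: in_span_mem; apply: map_f.
  by rewrite subrr; exists (fun _ => 0); rewrite big1 // => i _; exact: scaler0.
Qed.

(** The ideal of the later variables is the kernel of [kill_vars], a morphism into a domain that
    does not kill the current variable. *)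
Lemma regular_vars (js : seq 'I_l) : uniq js -> @regular_seq S S^o [seq 'X_j | j <- js].
Proof.
elim: js => //= i js IH /andP[ijs /IH h]; split=> // f /in_span_varsP hf.
apply/in_span_varsP; move: hf; rewrite regular_scaleE rmorphM => /eqP.
rewrite mulf_eq0 {1}/kill_vars /= mmapX mmap1U (negPf ijs).
by rewrite -msupp_eq0 msuppX /= => /eqP.
Qed.

Definition all_vars : seq S := [seq 'X_j | j <- enum 'I_l].

Lemma size_all_vars : size all_vars = l.
Proof. by rewrite size_map size_enum_ord. Qed.

Lemma regular_all_vars : @regular_seq S S^o all_vars.
Proof. exact/regular_vars/enum_uniq. Qed.

End RegularVariables.

(** * Logarithmic forms and Saito's criterion *)

Section FormDivisibility.
Variables (R : idomainType) (l : nat).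
Local Notation E := {ffun {set 'I_l} -> R^o}.
Implicit Types (t : E) (v : 'rV[R]_l) (b : 'cV[R]_l).

Lemma pairingD v w b : pairing (v + w) b = pairing v b + pairing w b.
Proof. by rewrite /pairing mulmxDl mxE. Qed.
Lemma pairingZ c v b : pairing (c *: v) b = c * pairing v b.
Proof. by rewrite /pairing -scalemxAl mxE. Qed.
Lemma pairingB v w b : pairing (v - w) b = pairing v b - pairing w b.
Proof. by rewrite -scaleN1r pairingD pairingZ mulN1r. Qed.
Lemma pairingDr v b c : pairing v (b + c) = pairing v b + pairing v c.
Proof. by rewrite /pairing mulmxDr mxE. Qed.
Lemma pairingZr z v b : pairing v (z *: b) = z * pairing v b.
Proof. by rewrite /pairing -scalemxAr mxE. Qed.
Lemma pairing_mx n (u : 'rV[R]_n) (M : 'M[R]_(n, l)) b : pairing (u *m M) b = pairing u (M *m b).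
Proof. by rewrite /pairing mulmxA. Qed.

Lemma pairing_split (nu v : 'rV[R]_l) b : pairing nu b = 1 ->
  pairing (v - pairing v b *: nu) b = 0.
Proof. by move=> h; rewrite pairingB pairingZ h mulr1 subrr. Qed.

(** Each vector v is the sum of v - b(v) nu, annihilated by [b], and b(v) nu; every term containing
    the second part carries a factor [be]. *)
Lemma ev_dvd_annih b nu be p t : pairing nu b = 1 ->
  (forall vs, size vs = p -> (forall v, v \in vs -> pairing v b = 0) -> dvdr be (ev t vs)) ->
  forall vs, size vs = p -> (forall v, v \in vs -> dvdr be (pairing v b)) -> dvdr be (ev t vs).
Proof.
move=> nub h vs sz hv.
apply: (@ev_split R l (fun v => pairing v b = 0) (dvdr be) (dvdr be) nu p t) => //.
- exact: dvdr0.
- exact: dvdrD.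
- exact: dvdr_mull.
- by move=> z ws hz _ _; apply: dvdr_mulr.
- move=> v /hv hvb; exists (v - pairing v b *: nu), (pairing v b); split=> //.
    by rewrite subrK.
  exact: pairing_split.
Qed.

Lemma ev_dvd_all b nu be p t : pairing nu b = 1 ->
  (forall vs, size vs = p -> (forall v, v \in vs -> pairing v b = 0) -> dvdr be (ev t vs)) ->
  (forall vs, (size vs).+1 = p -> (forall v, v \in vs -> pairing v b = 0) -> dvdr be (ev t (nu :: vs))) ->
  forall vs, size vs = p -> dvdr be (ev t vs).
Proof.
move=> nub h h1 vs sz.
apply: (@ev_split R l (fun v => pairing v b = 0) (fun _ => True) (dvdr be) nu p t) => //.
- exact: dvdr0.
- exact: dvdrD.
- exact: dvdr_mull.
- by move=> z ws _ sz' hw; apply: dvdr_mull; apply: h1.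
- move=> v _; exists (v - pairing v b *: nu), (pairing v b); split=> //.
    by rewrite subrK.
  exact: pairing_split.
Qed.

Lemma form_dvdP be t : (forall J, dvdr be (t J)) -> exists g : E, t = be *: g.
Proof.
move=> h; exists [ffun J => projT1 (cid (h J))]; apply/ffunP => J; rewrite !ffunE.
exact: (projT2 (cid (h J))).
Qed.

(** On vectors annihilated by b, the form b /\ t vanishes; with nu put in front of them, its value
    is that of t on them. By [ev_dvd_all] these values decide divisibility. *)
Lemma wedge1_dvdP b nu be p t : pairing nu b = 1 -> is_pform p t ->
  (forall J, dvdr be (wedge1 b t J)) <->
  (forall vs, size vs = p -> (forall v, v \in vs -> pairing v b = 0) -> dvdr be (ev t vs)).
Proof.
move=> nub pt; split=> [h vs sz hv|h].
  have := ev_wedge1_cons t nu hv; rewrite nub mul1r => <-.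
  have [g gE] := form_dvdP h.
  by rewrite gE evZ; apply/dvdr_mulr/dvdrr.
apply: ev_coefP (dvdr0 _) (pform_wedge1 _ pt) _.
apply: (ev_dvd_all nub) => [vs _ hv|vs [sz] hv].
  by rewrite ev_wedge1_annih //; exact: dvdr0.
by rewrite ev_wedge1_cons // nub mul1r; apply: h.
Qed.

Lemma ev_dvd_coef be t vs : (forall J, dvdr be (t J)) -> dvdr be (ev t vs).
Proof.
move=> /form_dvdP[g ->]; by rewrite evZ; apply/dvdr_mulr/dvdrr.
Qed.

Lemma form_quotient be p t : be != 0 -> is_pform p t -> (forall J, dvdr be (t J)) ->
  exists2 g : E, is_pform p g & t = be *: g.
Proof.
move=> be0 pt /form_dvdP[g e]; exists g => // J Jp.
have /eqP := pt J Jp; rewrite e ffunE regular_scaleE mulf_eq0 (negPf be0) /=.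
by move/eqP.
Qed.

Lemma form_scaleI be : be != 0 -> injective (fun t : E => be *: t).
Proof.
move=> be0 t t' /ffunP h; apply/ffunP => J; have := h J; rewrite !ffunE.
exact: mulfI.
Qed.

Lemma pformZ p c t : is_pform p t -> is_pform p (c *: t).
Proof. by move=> h J Jp; rewrite ffunE h // scaler0. Qed.
Lemma pformD p t t' : is_pform p t -> is_pform p t' -> is_pform p (t + t').
Proof. by move=> h h' J Jp; rewrite ffunE h // h' // addr0. Qed.
Lemma pformB p t t' : is_pform p t -> is_pform p t' -> is_pform p (t - t').
Proof. by move=> h h' J Jp; rewrite !ffunE h // h' // subrr. Qed.

Lemma pull_scalar p c t : is_pform p t -> pull c%:M t = c ^+ p *: t.
Proof.
move=> pt; apply: (@ev_inj _ _ p); [exact: pform_pull|exact: pformZ|] => vs sz.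
rewrite ev_pull evZ -sz -ev_scale_all; congr ev; apply: eq_map => v.
by rewrite mul_mx_scalar.
Qed.

Lemma pull_comp n k (M : 'M[R]_(n, l)) (N : 'M[R]_(k, n)) p t : is_pform p t ->
  pull N (pull M t) = pull (N *m M) t.
Proof.
move=> pt; apply: (@ev_inj _ _ p); [by do 2 apply: pform_pull|exact: pform_pull|] => vs sz.
by rewrite !ev_pull -map_comp; congr ev; apply: eq_map => v /=; rewrite mulmxA.
Qed.

Lemma pull_dvd n (M : 'M[R]_(n, l)) be t : (forall J, dvdr be (t J)) -> forall J, dvdr be (pull M t J).
Proof. by move=> h J; rewrite ffunE; exact: ev_dvd_coef. Qed.

Lemma pullZ n (M : 'M[R]_(n, l)) c t : pull M (c *: t) = c *: pull M t.
Proof. by apply/ffunP => J; rewrite !ffunE evZ. Qed.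
Lemma pullB n (M : 'M[R]_(n, l)) t t' : pull M (t - t') = pull M t - pull M t'.
Proof. by apply/ffunP => J; rewrite !ffunE evB. Qed.

End FormDivisibility.

Section BaseChangeForms.
Variables (R R' : comNzRingType) (f : {rmorphism R -> R'}).

Lemma map_form_wedge1 l (b : 'cV[R]_l) t : map_form f (wedge1 b t) = wedge1 (map_mx f b) (map_form f t).
Proof.
apply/ffunP => J; rewrite !ffunE rmorph_sum; apply: eq_bigr => i _.
by rewrite !ffunE mxE !rmorphM rmorph_sign.
Qed.

Lemma map_form_pull l n (M : 'M[R]_(n, l)) t : map_form f (pull M t) = pull (map_mx f M) (map_form f t).
Proof.
apply/ffunP => J; rewrite !ffunE -ev_map; congr ev; rewrite -map_comp.
by apply: eq_map => i /=; rewrite map_row.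
Qed.

Lemma map_formZ l c (t : {ffun {set 'I_l} -> R^o}) : map_form f (c *: t) = f c *: map_form f t.
Proof. by apply/ffunP => J; rewrite !ffunE regular_scaleE rmorphM. Qed.
Lemma map_formD l (t t' : {ffun {set 'I_l} -> R^o}) : map_form f (t + t') = map_form f t + map_form f t'.
Proof. by apply/ffunP => J; rewrite !ffunE rmorphD. Qed.
Lemma map_formB l (t t' : {ffun {set 'I_l} -> R^o}) : map_form f (t - t') = map_form f t - map_form f t'.
Proof. by apply/ffunP => J; rewrite !ffunE rmorphB. Qed.

Lemma map_pairing l (v : 'rV[R]_l) b : pairing (map_mx f v) (map_mx f b) = f (pairing v b).
Proof. by rewrite /pairing -map_mxM mxE. Qed.

End BaseChangeForms.

Lemma dvdr_rmorph (R R' : idomainType) (f : {rmorphism R -> R'}) a b :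
  dvdr a b -> dvdr (f a) (f b).
Proof. by case=> c ->; exists (f c); rewrite rmorphM. Qed.

Section LogForms.
Variables (K : fieldType) (l : nat).
Local Notation S := {mpoly K[l]}.
Local Notation E := {ffun {set 'I_l} -> S^o}.
Local Notation cst := (map_mx (@mpolyC l K)).
Implicit Types (H : hyperplane K l) (A : arrangement K l).

Lemma hyperplaneP H (x : 'rV[K]_l) : (x \in val H) = (x *m defining_vector H == 0).
Proof.
have /eqP h : lker (linfun (mulmxr (defining_vector H) : 'rV_l -> 'rV_1)) == val H.
  exact: (xchooseP (defining_vector_ex H)).
by rewrite -[in LHS]h memv_ker lfunE.
Qed.

Lemma defining_vector_neq0 H : defining_vector H != 0.
Proof.
apply/eqP => h; have := valP H; rewrite /is_hyperplane.
have -> : val H = fullv.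
  by apply/vspaceP => x; rewrite memvf hyperplaneP h mulmx0 eqxx.
by rewrite dimvf /dim /= mul1n eqn_leq ltnn.
Qed.

Lemma hyperplane_sub_eq H H' : (val H <= val H')%VS -> H = H'.
Proof.
move=> h; apply/val_inj/eqP; rewrite eqEdim h /=.
by have e : (\dim (val H)).+1 = (\dim (val H')).+1 := etrans (eqP (valP H)) (esym (eqP (valP H'))); case: e => ->.
Qed.

Definition form_of H : S := lform (defining_vector H).

Lemma form_of_prime H : prime_elt (form_of H) /\ ~ dvdr (form_of H) 1.
Proof. exact/lform_prime/defining_vector_neq0. Qed.

Lemma form_of_neq0 H : form_of H != 0.
Proof. by have [[]] := form_of_prime H. Qed.

Lemma form_of_ndvd H H' : H != H' -> ~ dvdr (form_of H) (form_of H').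
Proof.
move=> HH' /(lform_dvd_lform (defining_vector_neq0 H))[c cE].
case/eqP: HH'; apply: hyperplane_sub_eq; apply/subvP => x.
by rewrite !hyperplaneP cE -scalemxAr => /eqP ->; rewrite scaler0.
Qed.

Lemma prod_forms_ndvd H (s : seq (hyperplane K l)) : H \notin s ->
  ~ dvdr (form_of H) (\prod_(L <- s) form_of L).
Proof.
have [Hp H1] := form_of_prime H.
rewrite big_seq => Hs /(prime_prod_dvd Hp H1)[L [Ls]].
by apply: form_of_ndvd; apply: contraNneq Hs => ->.
Qed.

Lemma prod_forms_dvd (s : seq (hyperplane K l)) g : uniq s ->
  {in s, forall L, dvdr (form_of L) g} -> dvdr (\prod_(L <- s) form_of L) g.
Proof.
move=> us h; have := @coprime_prod_dvd _ _ s form_of (fun _ => 1%N) g us.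
under eq_bigr do rewrite expr1; apply=> //.
- by move=> L _; exact: form_of_prime.
- by move=> L L' _ _; exact: form_of_ndvd.
Qed.

Lemma normal_of H : exists nu : 'rV[K]_l, nu *m defining_vector H = 1%:M.
Proof. exact/normal_exists/defining_vector_neq0. Qed.

Lemma pairing_cst (v : 'rV[K]_l) (a : 'cV[K]_l) :
  pairing (cst v) (cst a) = ((v *m a) 0 0)%:MP.
Proof. by rewrite map_pairing. Qed.

Definition covec H : 'cV[S]_l := cst (defining_vector H).

Lemma covec_normal H : exists nu : 'rV[S]_l, pairing nu (covec H) = 1.
Proof.
have [nu h] := normal_of H; exists (cst nu).
by rewrite pairing_cst h mxE mpolyC1.
Qed.

(* [t] stands for the logarithmic form [t / Q(A)]. *)
Definition is_log A p (t : E) : Prop :=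
  is_pform p t /\ forall H, H \in A -> forall J, dvdr (form_of H) (wedge1 (covec H) t J).

Lemma is_logP A p t : is_log A p t <-> is_pform p t /\
  forall H, H \in A -> forall vs, size vs = p ->
    (forall v, v \in vs -> pairing v (covec H) = 0) -> dvdr (form_of H) (ev t vs).
Proof.
split=> -[pt h]; split=> // H HA; have [nu nuE] := covec_normal H.
  exact/(wedge1_dvdP (form_of H) nuE pt)/h.
by apply/(wedge1_dvdP (form_of H) nuE pt) => vs; exact: h.
Qed.

Lemma is_log_tangent A p t H vs : is_log A p t -> H \in A -> size vs = p ->
  (forall v, v \in vs -> dvdr (form_of H) (pairing v (covec H))) -> dvdr (form_of H) (ev t vs).
Proof.
move=> /is_logP[_ h] HA; have [nu nuE] := covec_normal H.
by apply: (ev_dvd_annih nuE) => us; exact: h.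
Qed.

Lemma is_log_closed A p : is_log A p 0 /\
  forall a x y, is_log A p x -> is_log A p y -> is_log A p (a *: x + y).
Proof.
split.
  split=> [J _|H _ J]; first by rewrite ffunE.
  by rewrite linear0 ffunE; exact: dvdr0.
move=> a x y [px hx] [py hy]; split=> [J Jp|H HA J].
  by rewrite !ffunE px // py // scaler0 addr0.
by rewrite linearP [X in dvdr _ X]ffunE [X in dvdr _ (X + _)]ffunE; apply: dvdrD; [apply: dvdr_mull; exact: hx | exact: hy].
Qed.

Definition log_submod A p := Submodule (is_log_closed A p).
Definition logmod A p : lmodType S := submod_type (log_submod A p).

Lemma logmodP A p (t : logmod A p) : is_log A p (submod_incl t).
Proof. exact: (submod_valP t). Qed.

Lemma logmod_elt A p t : is_log A p t -> exists u : logmod A p, submod_incl u = t.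
Proof. by move=> h; exact: (@submod_eltP _ _ (log_submod A p) t h). Qed.

Lemma is_log_sub A A' p t : (forall H, H \in A' -> H \in A) -> is_log A p t -> is_log A' p t.
Proof. by move=> h [pt ht]; split=> // H /h; exact: ht. Qed.

(** The substitute for localization: [g] collects the forms of the hyperplanes along which [t] is
    not known to be logarithmic. *)
Lemma is_logZ_away A A' p t (g : S) :
  (forall H, H \in A -> H \in A' \/ dvdr (form_of H) g) ->
  is_log A' p t -> is_log A p (g *: t).
Proof.
move=> h [pt ht]; split=> [|H /h HA J]; first exact: pformZ.
rewrite linearZ /= ffunE regular_scaleE.
by case: HA => [HA'|?]; [apply/dvdr_mull/ht | apply: dvdr_mulr].
Qed.

Lemma is_log_cancel A A' p t (g : S) :
  (forall H, H \in A' -> H \in A /\ ~ dvdr (form_of H) g) ->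
  is_pform p t -> is_log A p (g *: t) -> is_log A' p t.
Proof.
move=> h pt [_ ht]; split=> // H /h[HA Hg] J.
have := ht H HA J; rewrite linearZ /= ffunE regular_scaleE.
by have [[_ pp] _] := form_of_prime H => /pp[].
Qed.

Definition QA A : S := \prod_(H <- A) form_of H.

Lemma QA_neq0 A : QA A != 0.
Proof. by rewrite /QA prodf_seq_neq0; apply/allP => H _; exact: form_of_neq0. Qed.

Lemma form_dvd_QA A H : H \in A -> dvdr (form_of H) (QA A).
Proof.
move=> HA; by rewrite /QA (big_rem H) //=; apply/dvdr_mulr/dvdrr.
Qed.

Lemma form_ndvd_QA A H : H \notin A -> ~ dvdr (form_of H) (QA A).
Proof. exact: prod_forms_ndvd. Qed.

Lemma form_ndvd_QAexp A H k : H \notin A -> ~ dvdr (form_of H) (QA A ^+ k).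
Proof. by move=> HA; have [p1 p2] := form_of_prime H; apply: prime_exp_ndvd => //; exact: form_ndvd_QA. Qed.

End LogForms.

(** * Comparison with forms over the fraction field *)

Section LogFormsLink.
Variables (K : fieldType) (l : nat).
Local Notation S := {mpoly K[l]}.
Local Notation E := {ffun {set 'I_l} -> S^o}.
Local Notation W := {ffun {set 'I_l} -> ratfun K l}.
Local Notation cst := (map_mx (@mpolyC l K)).
Implicit Types (H : hyperplane K l) (A : arrangement K l).

Lemma mderiv_lform (a : 'cV[K]_l) i : (lform a)^`M(i) = (a i 0)%:MP.
Proof.
rewrite /lform raddf_sum (bigD1 i) //= mderivZ mderivX mnm1E eqxx.
have -> : (U_(i) - U_(i) = 0)%MM by apply/mnmP => j; rewrite mnmBE subnn mnm0E.
rewrite mpolyX0 scale1r alg_mpolyC big1 ?addr0 // => j ji.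
by rewrite mderivZ mderivX mnm1E (negPf ji) scale0r scaler0.
Qed.

Lemma inversions_set1 i (M : {set 'I_l}) : i \in M -> inversions [set i] (M :\ i) = below i M.
Proof.
move=> iM; rewrite (below_setD1 i iM) ltnn add0n /inversions /below.
rewrite -(card_imset (f := fun j => (i, j)) [set j in M :\ i | (j < i)%N]); last by move=> j k [].
congr #|pred_of_set _|; apply/setP => -[k j]; rewrite !inE /=.
apply/idP/imsetP => [/andP[/andP[/eqP -> h] ji]|[j' hj [-> ->]]].
  by exists j => //; rewrite !inE h ji.
by move: hj; rewrite !inE eqxx.
Qed.

(** The differential of a linear form has constant coefficients supported on singletons, so the
    shuffle signs of [wedge] reduce to those of [wedge1]. *)
Lemma wedge_differential (a : 'cV[K]_l) (t : E) (q : ratfun K l) (M : {set 'I_l}) :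
  wedge (to_ratform (differential (lform a))) ([ffun I => (tofrac (t I) / q : ratfun K l)] : W) M
  = tofrac (wedge1 (cst a) t M) / q.
Proof.
rewrite !ffunE rmorph_sum mulr_suml.
pose G i (I : {set 'I_l}) : ratfun K l :=
  (-1) ^+ inversions I (M :\: I) * tofrac (a i 0)%:MP * (tofrac (t (M :\: I)) / q).
transitivity (\sum_(I : {set 'I_l} | I \subset M) \sum_(i < l | I == [set i]) G i I).
  apply: eq_bigr => I IM; rewrite !ffunE rmorph_sum mulr_sumr mulr_suml.
  by apply: eq_bigr => i _; rewrite /= mderiv_lform.
rewrite (exchange_big_dep xpredT) //= [RHS]big_mkcond /=.
apply: eq_bigr => i _; case: ifP => iM; last first.
  by apply: big1 => I /andP[IM /eqP Ii]; move: IM; rewrite Ii sub1set iM.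
rewrite (big_pred1 [set i]) => [|I]; last first.
  by apply/andP/eqP => [[_ /eqP]|->] //; rewrite sub1set eqxx.
rewrite /G inversions_set1 // !mxE !rmorphM rmorph_sign /= !mulrA //.
Qed.

Lemma Omega_logmod A p : exists f : {linear logmod A p -> Omega A p},
  injective f /\ forall y, exists x, f x = y.
Proof.
have Q0 : tofrac (QA A) != 0 :> {fraction S} by rewrite tofrac_eq0 QA_neq0.
pose q (t : E) : W := [ffun I => (tofrac (t I) / tofrac (QA A) : ratfun K l)].
have qlog t : is_log A p t -> q t \in logform_pred A p.
  move=> [pt ht]; apply/asboolP; split; first by exists t.
  move=> H HA; have [g pg gE] := form_quotient (form_of_neq0 H) (pform_wedge1 _ pt) (ht H HA).
  exists g => //; apply/ffunP => M; rewrite [LHS]ffunE [in LHS]wedge_differential.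
  rewrite [RHS]ffunE [in RHS]ffunE.
  rewrite -/(wedge1 _ _) -/(covec H) gE ffunE regular_scaleE.
  rewrite [LHS]/(ratfun_scale _ _) [RHS]/(ratfun_scale _ _) /ratfun_scale tofracM.
  by rewrite mulrC mulfVK.
pose f (t : logmod A p) : Omega A p := LogForm (qlog _ (logmodP t)).
have fl : linear f.
  move=> a x y; apply: val_inj; apply/ffunP => I.
  rewrite [LHS]ffunE [RHS]ffunE [X in _ = X + _]ffunE !ffunE regular_scaleE.
  by rewrite [X in _ = X + _]/(ratfun_scale _ _) /ratfun_scale tofracD tofracM mulrDl mulrA.
have [g gE] := linear_ext fl; exists g; split.
  move=> x y; rewrite !gE => /(congr1 val) /= /ffunP h; apply: submod_incl_inj.
  apply/ffunP => I; have := h I; rewrite !ffunE => /(mulIf (invr_neq0 Q0))/eqP.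
  by rewrite tofrac_eq => /eqP.
move=> y; have [[t pt tE] hy] := asboolW (valP y).
have lt : is_log A p t.
  split=> // H HA J; have [u pu /ffunP/(_ J)] := hy H HA.
  rewrite [X in X = _]ffunE tE [in X in X = _]wedge_differential -/(covec H).
  rewrite [RHS]ffunE [in RHS]ffunE [LHS]/(ratfun_scale _ _) [RHS]/(ratfun_scale _ _) /ratfun_scale.
  rewrite mulrC mulfVK // -tofracM => /eqP; rewrite tofrac_eq => /eqP ->.
  by exists (u J).
have [x xE] := logmod_elt lt; exists x; apply: val_inj; rewrite gE /= tE.
by apply/ffunP => I; rewrite !ffunE xE.
Qed.

Lemma tame_logmod A p : pd_le (Omega A p) p <-> pdim_le p (logmod A p).
Proof.
have [f [fi fs]] := Omega_logmod A p; split=> h.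
  have [g gK fK] : bijective f.
    exists (fun y => projT1 (cid (fs y))) => [x|y]; last exact: (projT2 (cid (fs y))).
    by apply: fi; exact: (projT2 (cid (fs (f x)))).
  have gl : linear g by move=> a x y; apply: fi; rewrite linearP !fK.
  have [g' g'E] := linear_ext gl.
  apply: (pdim_le_iso2 (f := g')) (pd_pdim_le h); first by move=> x y; rewrite !g'E => /(can_inj fK).
  by move=> x; exists (f x); rewrite g'E.
exact/pdim_pd_le/(pdim_le_iso2 fi fs).
Qed.

End LogFormsLink.

Section FiniteFree.
Variable R : nzRingType.

Lemma ffun_projective (I : finType) : projective_module {ffun I -> R^o}.
Proof.
move=> A B g f gs.
pose d i : {ffun I -> R^o} := [ffun j => (i == j)%:R].
pose a i := projT1 (cid (gs (f (d i)))).
have aE i : g (a i) = f (d i) := projT2 (cid (gs (f (d i)))).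
have [|h hE] := @linear_ext R {ffun I -> R^o} A (fun c => \sum_i c i *: a i).
  move=> c x y; rewrite scaler_sumr -big_split; apply: eq_bigr => i _.
  by rewrite !ffunE scalerDl scalerA.
exists h => x; rewrite hE linear_sum.
have {2}-> : x = \sum_i x i *: d i.
  apply/ffunP => j; rewrite sum_ffunE (bigD1 j) //= !ffunE eqxx big1.
    by rewrite addr0 /GRing.scale /= mulr1.
  by move=> i ij; rewrite !ffunE (negPf ij) scaler0.
by rewrite linear_sum; apply: eq_bigr => i _; rewrite !linearZ /= aE.
Qed.

Lemma regular_projective : projective_module R^o.
Proof.
move=> A B g f gs; have [a aE] := gs (f 1).
have [|h hE] := @linear_ext R R^o A (fun c : R^o => (c : R) *: a).
  by move=> c x y; rewrite scalerDl scalerA.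
exists h => x; rewrite hE linearZ /= aE -linearZ /=.
by congr (f _); rewrite /GRing.scale /= mulr1.
Qed.

End FiniteFree.

Section LogPdim.
Variables (K : fieldType) (l : nat).
Local Notation S := {mpoly K[l]}.
Local Notation E := {ffun {set 'I_l} -> S^o}.
Local Notation cst := (map_mx (@mpolyC l K)).
Implicit Types (H : hyperplane K l) (A : arrangement K l).

(** M^p(A) is the kernel of a map between finite free modules. To t one adjoins the quotients s of d
    alpha_H /\ t by alpha_H, which t determines; the equations say that t is a p-form and that d
    alpha_H /\ t = alpha_H s. *)
Lemma logmod_pdim A p : pdim_le (l - 2) (logmod A p).
Proof.
pose I := (A * {set 'I_l})%type.
pose F := pairL E {ffun I -> S^o}.
have [w wE] : exists w : hyperplane K l -> {linear E -> E}, forall H t, w H t = wedge1 (covec H) t.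
  by exists (fun H => wedge1 (covec H) : {linear _ -> _}).
have fl : linear (fun x : F => ([ffun J : {set 'I_l} => if #|J| == p then 0 else x.1 J],
    [ffun c : I => w (val c.1) x.1 c.2 - form_of (val c.1) * x.2 c]) : F).
  move=> a x y; congr pair; apply/ffunP => c; rewrite !ffunE.
    by case: ifP; rewrite ?scaler0 ?addr0 ?ffunE.
  rewrite /= linearP !ffunE !regular_scaleE.
  by rewrite /GRing.scale /=; ring.
have [f fE] := linear_ext fl.
have qex (t : logmod A p) : exists s : {ffun I -> S^o}, forall c : I,
    w (val c.1) (submod_incl t) c.2 = form_of (val c.1) * s c.
  have h (c : I) : exists s, w (val c.1) (submod_incl t) c.2 = form_of (val c.1) * s.
    by rewrite wE; have [_ h] := logmodP t; apply: h; exact: (valP c.1).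
  exists [ffun c => projT1 (cid (h c))] => c; rewrite ffunE; exact: (projT2 (cid (h c))).
pose q t := projT1 (cid (qex t)).
have qE t c : w (val c.1) (submod_incl t) c.2 = form_of (val c.1) * q t c.
  exact: (projT2 (cid (qex t))).
have il : linear (fun t : logmod A p => (submod_incl t, q t) : F).
  move=> a x y; congr pair; apply/ffunP => c; apply: (mulfI (form_of_neq0 (val c.1))).
  rewrite -qE !linearP /= !ffunE !regular_scaleE !qE.
  by rewrite /GRing.scale /=; ring.
have [i iE] := linear_ext il.
apply: (@second_syzygy_pdim _ _ _ F F i f).
- by apply: projective_pair; exact: ffun_projective.
- by apply: projective_pair; exact: ffun_projective.
- by move=> x y; rewrite !iE => -[/submod_incl_inj].
move=> x; rewrite fE; split=> [[/ffunP h1 /ffunP h2]|[t <-]]; last first.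
  rewrite iE; congr pair; apply/ffunP => c; rewrite !ffunE.
    by case: ifP => // /negbT cp; have [pt _] := logmodP t; exact: pt.
  by rewrite /= qE subrr.
have pt : is_pform p x.1 by move=> J Jp; have := h1 J; rewrite !ffunE (negPf Jp).
have wx c : w (val c.1) x.1 c.2 = form_of (val c.1) * x.2 c.
  by apply/eqP; rewrite -subr_eq0; apply/eqP; have := h2 c; rewrite !ffunE.
have lt : is_log A p x.1.
  by split=> // H HA J; rewrite -wE (wx ([` HA]%fset, J)); exists (x.2 ([` HA]%fset, J)).
have [t tE] := logmod_elt lt; exists t; rewrite iE tE [RHS]surjective_pairing; congr pair.
by apply/ffunP => c; apply: (mulfI (form_of_neq0 (val c.1))); rewrite -qE tE.
Qed.

Lemma ev_nil (t : E) : ev t [::] = t set0.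
Proof. by []. Qed.

(** A function is in M^0(A) exactly when every alpha_H divides it, so M^0(A) = Q(A) S is free of
    rank one. *)
Lemma logmod0_projective A : projective_module (logmod A 0).
Proof.
pose t0 (c : S^o) : E := [ffun J => if J == set0 then QA A * c else 0].
have lt c : is_log A 0 (t0 c).
  apply/is_logP; split=> [J|H HA [|//] _ _].
    by rewrite cards_eq0 ffunE => /negPf ->.
  rewrite ev_nil ffunE eqxx; apply: dvdr_mulr; exact: form_dvd_QA.
have [|f fE] := @linear_ext S S^o (logmod A 0) (fun c => submod_elt (lt c : log_submod A 0 (t0 c))).
  move=> a x y; apply: submod_incl_inj; apply/ffunP => J; rewrite linearP !ffunE /=.
  case: ifP => _; last by rewrite scaler0 addr0.
  by rewrite !regular_scaleE; ring.
apply: (@pdim_le_iso2 _ 0 S^o _ f) (@regular_projective S).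
  move=> x y; rewrite !fE => /(congr1 submod_incl) /= /ffunP/(_ set0).
  by rewrite !ffunE eqxx => /(mulfI (QA_neq0 A)).
move=> t; have [pt ht] := (is_logP _ _ _).1 (logmodP t).
have [c cE] : dvdr (QA A) (submod_incl t set0).
  by apply: prod_forms_dvd => [|H HA]; [exact: fset_uniq | exact: (ht H HA [::])].
exists c; apply: submod_incl_inj; rewrite fE; apply/ffunP => J; rewrite ffunE.
by case: eqP => [->|/eqP J0]; rewrite ?cE // pt // cards_eq0.
Qed.

Lemma logmod_empty_projective p : projective_module (logmod (fset0 : arrangement K l) p).
Proof.
pose t0 (t : E) : E := [ffun J : {set 'I_l} => if #|J| == p then t J else 0].
have lt t : is_log fset0 p (t0 t).
  by split=> [J Jp|H]; rewrite ?ffunE ?(negPf Jp).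
have [|r rE] := @linear_ext S E (logmod fset0 p) (fun t => submod_elt (lt t : log_submod fset0 p (t0 t))).
  move=> a x y; apply: submod_incl_inj; apply/ffunP => J; rewrite linearP !ffunE /=.
  by case: ifP => _; rewrite ?scaler0 ?addr0.
apply: (projective_retract (i := submod_incl : {linear _ -> _}) (r := r) (@ffun_projective S _)).
move=> t; apply: submod_incl_inj; rewrite rE; apply/ffunP => J; rewrite ffunE.
by case: ifP => // /negbT Jp; have [pt _] := logmodP t; rewrite pt.
Qed.

(* The rows of [Th] are a basis of the vector fields tangent to [A], the columns of
   [U] the dual basis of the logarithmic 1-forms, multiplied by [Q(A)]. *)
Definition saito A (Th U : 'M[S]_l) : Prop :=
  [/\ Th *m U = (QA A)%:M, U *m Th = (QA A)%:M,
      forall H, H \in A -> forall i, dvdr (form_of H) (pairing (row i Th) (covec H))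
    & forall H, H \in A -> forall v : 'rV[S]_l, pairing v (covec H) = 0 ->
        forall i, dvdr (form_of H) ((v *m U) 0 i)].

Definition one_form (w : 'cV[S]_l) : E := [ffun J => \sum_(i < l | J == [set i]) w i 0].

Lemma one_form_set1 w i : one_form w [set i] = w i 0.
Proof.
by rewrite ffunE (big_pred1 i) // => j; rewrite (inj_eq set1_inj) eq_sym.
Qed.

Lemma pform_one_form w : is_pform 1 (one_form w).
Proof.
move=> J J1; rewrite ffunE big1 // => i /eqP e; by rewrite e cards1 in J1.
Qed.

Lemma one_form_ex t : is_pform 1 t -> exists w, t = one_form w.
Proof.
move=> pt; exists (\col_i t [set i]); apply/ffunP => J.
have [/eqP/cards1P[i ->]|J1] := eqVneq #|J| 1%N; first by rewrite one_form_set1 mxE.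
by rewrite pt // pform_one_form.
Qed.

Lemma ev_one_form w v : ev (one_form w) [:: v] = pairing v w.
Proof.
rewrite ev_cons ev_nil ffunE /pairing mxE; apply: eq_big => [i|i _]; first by rewrite inE.
rewrite setU0 one_form_set1 (_ : below i set0 = 0%N) ?mul1r //.
by apply/eqP; rewrite cards_eq0; apply/eqP/setP => j; rewrite !inE.
Qed.

Lemma is_log_one_form A w : is_log A 1 (one_form w) <->
  forall H, H \in A -> forall v, pairing v (covec H) = 0 -> dvdr (form_of H) (pairing v w).
Proof.
rewrite is_logP; split=> [[_ h] H HA v hv|h].
  by rewrite -ev_one_form; apply: h => // u; rewrite inE => /eqP ->.
split=> [|H HA [|v [|//]] // _ hv]; first exact: pform_one_form.
by rewrite ev_one_form; apply: h => //; apply: hv; rewrite inE.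
Qed.

Lemma one_form_linear : linear one_form.
Proof.
move=> a x y; apply/ffunP => J; rewrite !ffunE scaler_sumr -big_split.
by apply: eq_bigr => i _; rewrite !mxE.
Qed.

Lemma one_form_inj : injective one_form.
Proof. by move=> x y /ffunP h; apply/colP => i; rewrite -!one_form_set1 h. Qed.

End LogPdim.

(** * From a free module of 1-forms to Saito matrices *)

Section SaitoOfFree.
Variables (K : fieldType) (l : nat).
Local Notation S := {mpoly K[l]}.
Local Notation E := {ffun {set 'I_l} -> S^o}.

Lemma free_module_iso (R : nzRingType) (M N : lmodType R) (f : {linear M -> N}) :
  injective f -> (forall y, exists x, f x = y) -> free_module N -> free_module M.
Proof.
move=> fi fs [I [b bP]].
pose b' i := projT1 (cid (fs (b i))).
have b'E i : f (b' i) = b i := projT2 (cid (fs (b i))).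
exists I, b' => m; have [c [cE cu]] := bP (f m); exists c; split.
  apply: fi; rewrite cE linear_sum; apply: eq_bigr => i _.
  by rewrite linearZ /= b'E.
move=> c' c'E; apply: cu; rewrite c'E linear_sum; apply: eq_bigr => i _.
by rewrite linearZ /= b'E.
Qed.

Lemma free_module_indep (R : nzRingType) (M : lmodType R) (I : choiceType) (b : I -> M) :
  (forall m : M, exists! c : {fsfun I -> R with 0}, m = \sum_(i <- finsupp c) c i *: b i) ->
  forall (D : {fset I}) (g g' : I -> R),
    \sum_(i <- D) g i *: b i = \sum_(i <- D) g' i *: b i -> {in D, g =1 g'}.
Proof.
move=> bP D g g' e.
have comb h : \sum_(i <- finsupp [fsfun i in D => h i | 0%R]) [fsfun i in D => h i | 0%R] i *: b i = \sum_(i <- D) h i *: b i.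
  have sD : (finsupp [fsfun i in D => h i | 0%R] `<=` D)%fset.
    by apply/fsubsetP => i; rewrite mem_finsupp fsfunE; case: ifP => //; rewrite eqxx.
  rewrite (big_fset_incl _ sD) /= => [|i iD].
    by rewrite big_seq [RHS]big_seq; apply: eq_bigr => i iD; rewrite fsfunE iD.
  by rewrite mem_finsupp negbK => /eqP ->; rewrite scale0r.
have [c [_ cu]] := bP (\sum_(i <- D) g i *: b i).
move=> i iD; have h1 := cu _ (esym (comb g)).
have h2 := cu [fsfun i in D => g' i | 0%R]; rewrite comb in h2.
have /fsfunP/(_ i) := etrans (esym h1) (h2 e).
by rewrite !fsfunE iD.
Qed.

(** The given basis has an unknown, possibly infinite index set. Its members u_i are the columns of
    [U], and expanding the forms Q dx_j in them gives [Th]. Uniqueness of expansions forces Th U = Q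
    and shows that the finitely many indices met in this way are all of them. *)
Lemma saito_of_free (A : arrangement K l) : free_arrangement A ->
  exists Th U, saito A Th U.
Proof.
have [f [fi fs]] := Omega_logmod A 1.
move=> /(free_module_iso fi fs)[I [b bP]].
have indep := free_module_indep bP.
have Q0 := QA_neq0 A; set Q := QA A in Q0 *.
have uex i : exists w, submod_incl (b i) = one_form w.
  by apply: one_form_ex; have [] := logmodP (b i).
pose u i := projT1 (cid (uex i)).
have uE i : submod_incl (b i) = one_form (u i) := projT2 (cid (uex i)).
have of_b (D : {fset I}) (g : I -> S) :
    submod_incl (\sum_(i <- D) g i *: b i) = one_form (\sum_(i <- D) g i *: u i).
  have [ol olE] := linear_ext (@one_form_linear K l).
  rewrite linear_sum -olE linear_sum; apply: eq_bigr => i _.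
  by rewrite !linearZ /= uE olE.
have span w : is_log A 1 (one_form w) -> exists c : {fsfun I -> S with 0},
    w = \sum_(i <- finsupp c) c i *: u i.
  move=> /logmod_elt[m mE]; have [c [cE _]] := bP m; exists c.
  by apply: one_form_inj; rewrite -mE -of_b -cE.
have Qlog j : is_log A 1 (one_form (Q *: delta_mx j 0)).
  apply/is_log_one_form => H HA v _; rewrite pairingZr; apply: dvdr_mulr.
  exact: form_dvd_QA.
pose c j := projT1 (cid (span _ (Qlog j))).
have cE j : Q *: delta_mx j 0 = \sum_(i <- finsupp (c j)) c j i *: u i.
  exact: (projT2 (cid (span _ (Qlog j)))).
pose D : {fset I} := (\bigcup_(j <- enum 'I_l) finsupp (c j))%fset.
have cD j : (finsupp (c j) `<=` D)%fset.
  by apply: bigfcup_sup => //; rewrite mem_enum.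
have {}cE D' j : (D `<=` D')%fset -> Q *: delta_mx j 0 = \sum_(i <- D') c j i *: u i.
  move=> DD'; rewrite cE; apply: big_fset_incl; first exact: fsubset_trans (cD j) DD'.
  by move=> i _; rewrite mem_finsupp negbK => /eqP ->; rewrite scale0r.
(* The form Q u_i is expanded twice: trivially, and through Q u_i = \sum_j u_ij Q dx_j. *)
have rel i k : \sum_j c j k * u i j 0 = Q * (i == k)%:R.
  pose D' := (i |` (k |` D))%fset.
  have DD' : (D `<=` D')%fset by apply: fsubset_trans (fsubsetUr _ _) (fsubsetUr _ _).
  have iD' : i \in D' by rewrite !inE eqxx.
  have kD' : k \in D' by rewrite !inE eqxx orbT.
  have e : Q *: u i = \sum_(k <- D') (\sum_j c j k * u i j 0) *: u k.
    transitivity (\sum_j u i j 0 *: (Q *: (delta_mx j 0 : 'cV[S]_l))).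
      apply/colP => j; rewrite mxE summxE (bigD1 j) //= !mxE !eqxx mulr1 mulrC big1 ?addr0 // => j' jj'.
      by rewrite !mxE eq_sym (negPf jj') mulr0 mulr0.
    under eq_bigr do rewrite (cE D') //.
    under eq_bigr do rewrite scaler_sumr.
    rewrite exchange_big; apply: eq_bigr => k' _; rewrite scaler_suml.
    by apply: eq_bigr => j _; rewrite scalerA mulrC.
  have /indep/(_ k kD') : \sum_(k <- D') (\sum_j c j k * u i j 0) *: b k =
      \sum_(k <- D') (Q * (i == k)%:R) *: b k.
    apply: submod_incl_inj; rewrite !of_b -e; congr one_form.
    rewrite (big_fsetD1 i) //= eqxx mulr1 big1_fset ?addr0 // => j.
    by rewrite !inE eq_sym => /andP[/negPf -> _] _; rewrite mulr0 scale0r.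
  by [].
(* An index absent from all expansions would turn [rel] into 0 = Q. *)
have allD i : i \in D.
  apply: contraT => iD; have := rel i i; rewrite eqxx mulr1 big1 => [/eqP|j _].
    by rewrite eq_sym (negPf Q0).
  have : i \notin finsupp (c j) by apply: contra iD; apply/fsubsetP.
  by rewrite mem_finsupp negbK => /eqP ->; rewrite mul0r.
pose m := #|` D|; pose e (k : 'I_m) : I := tnth (in_tuple (enum_fset D)) k.
have einj : injective e.
  by move=> x y /eqP; rewrite /e (tnth_nth (e x)) (tnth_nth (e x)) nth_uniq ?fset_uniq // => /eqP/val_inj.
pose U : 'M[S]_(l, m) := \matrix_(j, k) u (e k) j 0.
pose Th : 'M[S]_(m, l) := \matrix_(k, j) c j (e k).
have TU : Th *m U = Q%:M.
  apply/matrixP => k k'; rewrite !mxE; under eq_bigr do rewrite !mxE.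
  by rewrite rel (inj_eq einj) eq_sym mulr_natr.
have UT : U *m Th = Q%:M.
  apply/matrixP => j' j; rewrite !mxE; under eq_bigr do rewrite !mxE.
  have /colP/(_ j') := cE D j (fsubset_refl D); rewrite !mxE eqxx andbT mulr_natr => ->.
  rewrite summxE [RHS]big_tnth; apply: eq_bigr => k _; rewrite !mxE mulrC //.
(* Over the fraction field both products are invertible, so the ranks agree. *)
have lm : m = l.
  pose F := [the fieldType of {fraction S}]; pose tf := map_mx (@tofrac S).
  have Qu : (tofrac Q : F) != 0 by rewrite tofrac_eq0.
  have h n1 n2 (X : 'M[S]_(n1, n2)) (Y : 'M[S]_(n2, n1)) : X *m Y = Q%:M -> (n1 <= n2)%N.
    move=> XY; apply: (@mulmx1_min F _ _ ((tofrac Q)^-1 *: tf _ _ X) (tf _ _ Y)).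
    rewrite -scalemxAl -map_mxM XY map_scalar_mx -scalemx1 scalerA mulVf // scale1r //.
  by apply/eqP; rewrite eqn_leq (h _ _ _ _ TU) (h _ _ _ _ UT).
have Ulog H : H \in A -> forall v : 'rV[S]_l, pairing v (covec H) = 0 ->
    forall i, dvdr (form_of H) ((v *m U) 0 i).
  move=> HA v hv i; have := logmodP (b (e i)); rewrite uE => /is_log_one_form/(_ H HA v hv).
  suff -> : (v *m U) 0 i = pairing v (u (e i)) by [].
  by rewrite /pairing !mxE; apply: eq_bigr => j _; rewrite !mxE.
(* With Q = alpha_H Q', the form Q' d alpha_H is logarithmic, so it equals U d for some coordinates
   d. Multiplying by [Th] and cancelling Q' gives Th d alpha_H = alpha_H d: the rows of [Th] are
   tangent to H. *)
have Tlog H : H \in A -> forall i, dvdr (form_of H) (pairing (row i Th) (covec H)).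
  move=> HA i; have [Q' Q'E] := form_dvd_QA HA.
  have lw : is_log A 1 (one_form (Q' *: covec H)).
    apply/is_log_one_form => L LA v hv; rewrite pairingZr.
    have [HL|HL] := eqVneq H L; first by rewrite HL hv // mulr0; exact: dvdr0.
    have := form_dvd_QA LA; rewrite Q'E.
    have [[_ Lp] _] := form_of_prime L => /Lp[/form_of_ndvd|h]; first by rewrite eq_sym => /(_ HL).
    exact: dvdr_mulr.
  have [d dE] := span _ lw.
  have {}dE : Q' *: covec H = U *m \col_k d (e k).
    rewrite dE; apply/colP => j; rewrite summxE mxE.
    rewrite (big_fset_incl _ (B := D)) /=.
    + by rewrite big_tnth; apply: eq_bigr => k _; rewrite !mxE mulrC.
    + by apply/fsubsetP => k _.
    + by move=> k _; rewrite mem_finsupp negbK mxE => /eqP ->; rewrite mul0r.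
  have h : Th *m covec H = form_of H *: \col_k d (e k).
    have Q'0 : Q' != 0 by apply: contraNneq Q0 => e0; rewrite /Q Q'E e0 mulr0.
    have : Q' *: (Th *m covec H) = Q' *: (form_of H *: \col_k d (e k)).
      by rewrite scalemxAr dE mulmxA TU mul_scalar_mx scalerA [Q' * _]mulrC -Q'E.
    by move/matrixP => h; apply/matrixP => x y; have := h x y; rewrite mxE [RHS]mxE => /(mulfI Q'0).
  rewrite /pairing -row_mul h !mxE; exact/dvdr_mulr/dvdrr.
clearbody U Th; move: U Th TU UT Ulog Tlog; rewrite lm => U Th TU UT Ulog Tlog.
by exists Th, U; split.
Qed.

End SaitoOfFree.

(** * Residues and restrictions along a hyperplane *)

Lemma eq_dvdr_unit (R : idomainType) (a b c d : R) : d * c = 1 -> b = c * a -> forall g, dvdr a g <-> dvdr b g.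
Proof.
move=> dc -> g; split=> [[x ->]|[x ->]].
  by exists (d * x); rewrite mulrACA [c * d]mulrC dc mul1r.
by apply: dvdr_mulr; apply: dvdr_mull; exact: dvdrr.
Qed.

Section HyperplaneSection.
Variables (K : fieldType) (n : nat).
Local Notation S := {mpoly K[n.+1]}.
Local Notation S' := {mpoly K[n]}.
Local Notation E := {ffun {set 'I_n.+1} -> S^o}.
Local Notation E' := {ffun {set 'I_n} -> S'^o}.
Local Notation cS := (map_mx (@mpolyC n.+1 K)).
Local Notation cS' := (map_mx (@mpolyC n K)).
Local Notation dv := defining_vector.

(* [Phi] embeds K^n onto [H], [nu] is a transversal direction and [psi] the
   projection onto [H] along it; [r] sends L to L /\ H. *)
Record section_data (H : hyperplane K n.+1) (Phi : 'M[K]_(n, n.+1)) (psi : 'M[K]_(n.+1, n))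
    (nu : 'rV[K]_n.+1) (r : hyperplane K n.+1 -> hyperplane K n) : Prop := SectionData {
  sd_Phi : Phi *m dv H = 0;
  sd_nu : nu *m dv H = 1%:M;
  sd_retr : Phi *m psi = 1%:M;
  sd_dec : psi *m Phi + dv H *m nu = 1%:M;
  sd_r : forall L, L != H -> exists2 c, c != 0 & Phi *m dv L = c *: dv (r L) }.

Variables (H : hyperplane K n.+1) (Phi : 'M[K]_(n, n.+1)) (psi : 'M[K]_(n.+1, n)).
Variables (nu : 'rV[K]_n.+1) (r : hyperplane K n.+1 -> hyperplane K n).
Hypothesis sd : section_data H Phi psi nu r.

Local Notation phi := (subst_mx Phi).
Local Notation sigma := (subst_mx psi).
Local Notation pb := (map_form phi).
Local Notation covec' L := (cS' (dv L) : 'cV[S']_n.+1).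
Local Notation al := (form_of H).

Lemma phi_sigma f : phi (sigma f) = f.
Proof. by rewrite subst_mx_comp (sd_retr sd) subst_mx1. Qed.

Lemma phi_eq0 f : phi f = 0 <-> dvdr al f.
Proof.
rewrite (lform_dvdP (sd_nu sd)) -(sd_dec sd) addrK -subst_mx_comp.
by split=> [->|h]; rewrite ?rmorph0 // -[phi f]phi_sigma h rmorph0.
Qed.

Lemma phi_form L : L != H -> exists2 c, c != 0 & phi (form_of L) = c%:MP * form_of (r L).
Proof.
by move=> /(sd_r sd)[c c0 e]; exists c => //; rewrite subst_lform e lformZ.
Qed.

Lemma phi_form_dvd L g : L != H -> dvdr (phi (form_of L)) g <-> dvdr (form_of (r L)) g.
Proof.
move=> /phi_form[c c0 e]; apply: iff_sym.
apply: (@eq_dvdr_unit _ _ _ c%:MP (c^-1)%:MP) e g.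
by rewrite -mpolyCM mulVf // mpolyC1.
Qed.

Lemma phi_cS m k (M : 'M[K]_(m, k)) : map_mx phi (cS M) = cS' M.
Proof. by apply/matrixP => i j; rewrite !mxE subst_mxC. Qed.
Lemma sigma_cS m k (M : 'M[K]_(m, k)) : map_mx sigma (cS' M) = cS M.
Proof. by apply/matrixP => i j; rewrite !mxE subst_mxC. Qed.
Lemma phi_sigma_mx m k (M : 'M[S']_(m, k)) : map_mx phi (map_mx sigma M : 'M[S]_(m, k)) = M.
Proof. by apply/matrixP => i j; rewrite !mxE phi_sigma. Qed.

Lemma ev_pb t vs : ev (pb t) vs = phi (ev t [seq (map_mx sigma v : 'rV[S]_n.+1) | v <- vs]).
Proof.
rewrite -ev_map -map_comp; congr ev; rewrite -[LHS]map_id.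
by apply: eq_map => v /=; rewrite phi_sigma_mx.
Qed.

Lemma pairing_sigma (v : 'rV[S']_n.+1) L :
  pairing (map_mx sigma v : 'rV[S]_n.+1) (covec L) = sigma (pairing v (covec' L)).
Proof. by rewrite -map_pairing sigma_cS. Qed.

Lemma pb_dvd A p t L ws : is_log A p t -> L \in A -> size ws = p ->
  (forall w, w \in ws -> pairing w (covec' L) = 0) -> dvdr (phi (form_of L)) (ev (pb t) ws).
Proof.
move=> /is_logP[_ h] LA sz hw; rewrite ev_pb; apply: dvdr_rmorph; apply: h => //.
  by rewrite size_map.
by move=> v /mapP[w /hw e ->]; rewrite pairing_sigma e rmorph0.
Qed.

Lemma pb_H A p t ws : is_log A p t -> H \in A -> size ws = p ->
  (forall w, w \in ws -> pairing w (covec' H) = 0) -> ev (pb t) ws = 0.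
Proof.
move=> lt HA sz hw; have [c ->] := pb_dvd lt HA sz hw.
by rewrite (phi_eq0 al).2 ?mul0r //; exact: dvdrr.
Qed.

Lemma pairing_Phi (u : 'rV[S']_n) : pairing (u *m cS' Phi) (covec' H) = 0.
Proof. by rewrite pairing_mx -map_mxM (sd_Phi sd) map_mx0 /pairing mulmx0 mxE. Qed.

Lemma pairing_Phi_r L : L != H -> exists2 c, c != 0 & forall u : 'rV[S']_n,
  pairing (u *m cS' Phi) (covec' L) = c%:MP * pairing u (covec (r L)).
Proof.
move=> /(sd_r sd)[c c0 e]; exists c => // u.
by rewrite pairing_mx -map_mxM e -pairingZr map_mxZ.
Qed.

Lemma pairing_nu : pairing (cS' nu) (covec' H) = 1.
Proof. by rewrite map_pairing /pairing (sd_nu sd) mxE eqxx rmorph1. Qed.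

Lemma split_H (w : 'rV[S']_n.+1) : pairing w (covec' H) = 0 -> w = (w *m cS' psi) *m cS' Phi.
Proof.
move=> hw; have := congr1 (fun M => w *m cS' M) (sd_dec sd).
rewrite map_mxD map_mx1 mulmx1 mulmxDr !map_mxM !mulmxA => {1}<-.
have -> : w *m covec' H = 0 by rewrite [LHS]mx11_scalar -[X in X%:M]/(pairing w _) hw raddf0.
by rewrite mul0mx addr0.
Qed.

Definition restr (t : E) : E' := pull (cS' Phi) (pb t).
Definition extend (s : E') : E := pull (cS psi) (map_form sigma s).
(** Contraction with [nu] extracts the part along d alpha_H, which is then restricted to H: the
    Poincare residue with denominators cleared. *)
Definition residue (t : E) : E' := pull (cS' Phi) (interior (cS' nu) (pb t)).

Lemma ev_restr t us : ev (restr t) us = ev (pb t) [seq u *m cS' Phi | u <- us].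
Proof. exact: ev_pull. Qed.

Lemma ev_residue t us : ev (residue t) us = ev (pb t) (cS' nu :: [seq u *m cS' Phi | u <- us]).
Proof. exact: ev_pull. Qed.

Lemma pb_extend p s : is_pform p s -> pb (extend s) = pull (cS' psi) s.
Proof.
move=> ps; rewrite map_form_pull phi_cS; congr pull.
by apply/ffunP => J; rewrite !ffunE phi_sigma.
Qed.

Lemma restr_extend p s : is_pform p s -> restr (extend s) = s.
Proof.
move=> ps; rewrite /restr (pb_extend ps) (pull_comp _ _ ps) -map_mxM (sd_retr sd) map_mx1.
by rewrite (pull_scalar _ ps) expr1n scale1r.
Qed.

Lemma pform_restr p t : is_pform p t -> is_pform p (restr t).
Proof. by move=> pt; apply/pform_pull/pform_map. Qed.
Lemma pform_extend p s : is_pform p s -> is_pform p (extend s).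
Proof. by move=> pt; apply/pform_pull/pform_map. Qed.
Lemma pform_residue p t : is_pform p.+1 t -> is_pform p (residue t).
Proof. by move=> pt; apply/pform_pull/pform_interior/pform_map. Qed.

Definition restriction_arr (A : arrangement K n.+1) : arrangement K n := [fset r L | L in A]%fset.

Section WithArrangement.
Variable A : arrangement K n.+1.
Hypothesis HA : H \notin A.
Local Notation B := (restriction_arr A).

Let neqH L : L \in A -> L != H.
Proof. by move=> LA; apply: contraNneq HA => <-. Qed.

(* Any L in A contains a vector [nu + u] transversal to [H], [u] in [H]; moving
   [nu] inside [H] does not change the residue. *)
Lemma transversal_vector L : L \in A -> exists u : 'rV[K]_n, (nu + u *m Phi) *m dv L = 0.
Proof.
move=> /neqH/(sd_r sd)[c c0 e]; have [w wE] := normal_of (r L).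
set x := (nu *m dv L) 0 0; have xE : nu *m dv L = x%:M by exact: mx11_scalar.
exists ((- c^-1 * x) *: w).
rewrite mulmxDl -mulmxA e -scalemxAl -scalemxAr wE scalerA xE.
have -> : - c^-1 * x * c = - x by rewrite mulrAC mulNr mulVf // mulN1r.
by rewrite scalemx1 -raddfD subrr raddf0.
Qed.

Lemma residue_log p t : is_log (H |` A)%fset p.+1 t -> is_log B p (residue t).
Proof.
move=> lt; have [pt _] := lt; apply/is_logP; split; first exact: pform_residue.
move=> X /imfsetP[L /= LA ->] us sz hus.
have LH := neqH LA; have [u uE] := transversal_vector LA.
have [c c0 cE] := pairing_Phi_r LH.
rewrite -(phi_form_dvd _ LH) ev_residue.
set ws := [seq _ | _ <- _].
have sws : (size ws).+1 = p.+1 by rewrite size_map sz.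
have -> : ev (pb t) (cS' nu :: ws) = ev (pb t) (cS' (nu + u *m Phi) :: ws).
  have h0 : ev (pb t) (cS' (u *m Phi) :: ws) = 0.
    apply: (pb_H lt) => //; first by rewrite !inE eqxx.
    move=> w; rewrite inE => /orP[/eqP ->|/mapP[v _ ->]]; last exact: pairing_Phi.
    by rewrite map_mxM pairing_Phi.
  by rewrite addrC map_mxD -[X in X + _]scale1r ev_consP h0 mulr0 add0r.
apply: (pb_dvd lt) => //; first by rewrite !inE LA orbT.
move=> w; rewrite inE => /orP[/eqP ->|/mapP[v vus ->]].
  by rewrite map_pairing /pairing uE mxE raddf0.
by rewrite cE hus // mulr0.
Qed.

(** Restricted to points of H, t vanishes on tangent vectors because it is logarithmic along H, and
    on tuples containing [nu] because the residue vanishes; hence alpha_H divides t. *)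
Lemma residue_eq0 p t : is_log (H |` A)%fset p.+1 t -> residue t = 0 <->
  exists2 t', is_log A p.+1 t' & t = al *: t'.
Proof.
move=> lt; have [pt _] := lt; split=> [rt0|[t' [pt' _] ->]]; last first.
  apply: (@ev_inj _ _ p); [apply: pform_residue; exact: pformZ|by move=> J _; rewrite ffunE|].
  move=> us _; rewrite ev_residue ev0 map_formZ evZ (phi_eq0 al).2 ?mul0r //; exact: dvdrr.
have pbt0 : pb t = 0.
  apply: (@ev_inj _ _ p.+1); [exact: pform_map|by move=> J _; rewrite ffunE|].
  move=> vs sz; rewrite ev0.
  apply: (@ev_split S' _ (fun w => pairing w (covec' H) = 0) (fun _ => True) (fun x => x = 0) (cS' nu) p.+1) => //.
  - by move=> x y -> ->; rewrite addr0.
  - by move=> x y ->; rewrite mulr0.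
  - by move=> ws sz' hw; apply: (pb_H lt) => //; rewrite !inE eqxx.
  - move=> z ws _ sz' hw.
    have -> : ws = [seq u *m cS' Phi | u <- [seq w *m cS' psi | w <- ws]].
      rewrite -map_comp -[LHS]map_id; apply/eq_in_map => w /hw; exact: split_H.
    by rewrite -ev_residue rt0 ev0 mulr0.
  - move=> v _; exists (v - pairing v (covec' H) *: cS' nu), (pairing v (covec' H)).
    by split=> //; [rewrite subrK | apply: pairing_split; exact: pairing_nu].
have [J|t' pt' tE] := form_quotient (form_of_neq0 H) pt _.
  by apply/phi_eq0; have /ffunP/(_ J) := pbt0; rewrite !ffunE.
exists t' => //; apply: (is_log_cancel (A := (H |` A)%fset) (g := al)) => //; last by rewrite -tE.
move=> L LA; rewrite !inE LA orbT; split=> //; apply: form_of_ndvd; exact: neqH.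
Qed.

Definition mult (X : hyperplane K n) : nat := count (fun L => r L == X) A.
(** Up to a unit, the quotient of Q(A) restricted to H by Q(A^H); see [phi_QA]. *)
Definition Bpoly : S' := \prod_(X <- B) form_of X ^+ (mult X).-1.

Lemma BpolyE : Bpoly = \prod_(X <- B) form_of X ^+ (mult X).-1.
Proof. by []. Qed.

Lemma mult_gt0 X : X \in B -> (0 < mult X)%N.
Proof.
by move=> /imfsetP[L /= LA ->]; rewrite /mult -has_count; apply/hasP; exists L.
Qed.

(** Each alpha_L restricts to a nonzero constant times the form of its trace. Grouping the members
    by trace collects the powers, and the constants make up c. *)
Lemma phi_QA : exists c d : S', c * d = 1 /\ phi (QA A) = c * (Bpoly * QA B).
Proof.
have -> : Bpoly * QA B = \prod_(X <- B) form_of X ^+ mult X.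
  rewrite /Bpoly /QA -big_split /= big_seq [RHS]big_seq; apply: eq_bigr => X /mult_gt0 XB.
  by rewrite -exprSr prednK.
have -> : \prod_(X <- B) form_of X ^+ mult X = \prod_(L <- A) form_of (r L).
  transitivity (\prod_(X <- B) \prod_(L <- A | r L == X) form_of X).
    by apply: eq_bigr => X _; rewrite big_const_seq /mult iter_mulr mulr1.
  rewrite (exchange_big_dep xpredT) //= big_seq [RHS]big_seq; apply: eq_bigr => L LA.
  have rB : r L \in B by apply/imfsetP; exists L.
  rewrite (big_rem _ rB) /= eqxx big_seq_cond big1 ?mulr1 // => X /andP[].
  by rewrite mem_rem_uniq ?fset_uniq // inE => /andP[/negPf h _]; rewrite eq_sym h.
have main (s : seq (hyperplane K n.+1)) : {subset s <= A} -> exists c d : S', c * d = 1 /\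
    phi (\prod_(L <- s) form_of L) = c * \prod_(L <- s) form_of (r L).
  elim: s => [|L s IH] hs.
    by exists 1, 1; rewrite !big_nil rmorph1 !mulr1.
  have [|c [d [cd e]]] := IH; first by move=> x xs; apply: hs; rewrite inE xs orbT.
  have [c' c'0 e'] := phi_form (neqH (hs L (mem_head _ _))).
  exists (c'%:MP * c), ((c'^-1)%:MP * d); split.
    by rewrite mulrACA cd mulr1 -mpolyCM mulfV // mpolyC1.
  by rewrite !big_cons rmorphM [X in X * _]e' [X in _ * X]e mulrACA.
exact: main.
Qed.

Lemma Bpoly_neq0 : Bpoly != 0.
Proof. by rewrite /Bpoly prodf_seq_neq0; apply/allP => X _; rewrite expf_neq0 // form_of_neq0. Qed.

Lemma phi_QA_dvd g : (forall X, X \in B -> dvdr (form_of X ^+ mult X) g) -> dvdr (phi (QA A)) g.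
Proof.
move=> h; have [c [d [cd e]]] := phi_QA.
rewrite mulrC in cd; apply/(eq_dvdr_unit cd e).
have -> : Bpoly * QA B = \prod_(X <- B) form_of X ^+ mult X.
  rewrite /Bpoly /QA -big_split /= big_seq [RHS]big_seq; apply: eq_bigr => X /mult_gt0 XB.
  by rewrite -exprSr prednK.
apply: coprime_prod_dvd => //.
- by move=> X _; exact: form_of_prime.
- by move=> X Y _ _; exact: form_of_ndvd.
Qed.

(** The [mult X] members of A with trace X are pairwise coprime before restriction, so their product
    divides g; on H each of them becomes a constant times alpha_X. *)
Lemma mult_dvd X g : (forall L, L \in A -> r L = X -> dvdr (form_of L) g) ->
  dvdr (form_of X ^+ mult X) (phi g).
Proof.
move=> h; pose s := [seq L <- A | r L == X].
have sA L : L \in s -> L \in A by rewrite mem_filter => /andP[].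
have : dvdr (\prod_(L <- s) form_of L) g.
  apply: prod_forms_dvd; first by rewrite filter_uniq // fset_uniq.
  by move=> L; rewrite mem_filter => /andP[/eqP rL LA]; apply: h.
move/(dvdr_rmorph phi); apply: dvdr_trans.
have : forall L, L \in s -> L \in A /\ r L = X.
  by move=> L; rewrite mem_filter => /andP[/eqP -> ->].
rewrite /mult -size_filter -/s; elim: (s) => [|L s' IH] hs /=; first exact: dvd1r.
rewrite big_cons exprS rmorphM; apply: dvdr_mul; last first.
  by apply: IH => M Ms; apply: hs; rewrite inE Ms orbT.
have [LA <-] := hs L (mem_head _ _).
by have [c _ ->] := phi_form (neqH LA); apply/dvdr_mull/dvdrr.
Qed.

End WithArrangement.
End HyperplaneSection.

(** * Logarithmic forms expanded in a Saito basis *)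

Section SaitoForms.
Variables (K : fieldType) (l : nat).
Local Notation S := {mpoly K[l]}.
Local Notation E := {ffun {set 'I_l} -> S^o}.
Variables (A : arrangement K l) (Th U : 'M[S]_l).
Hypothesis sA : saito A Th U.

Lemma saito_annih H hs : H \in A -> (forall v, v \in hs -> pairing v (covec H) = 0) ->
  exists cs : seq 'rV[S]_l, [seq v *m U | v <- hs] = [seq form_of H *: c | c <- cs].
Proof.
move=> HA; have [_ _ _ hU] := sA; elim: hs => [|v hs IH] hv; first by exists [::].
have [|cs csE] := IH; first by move=> u uhs; apply: hv; rewrite inE uhs orbT.
have d i := hU H HA v (hv v (mem_head _ _)) i.
exists ((\row_i projT1 (cid (d i))) :: cs); rewrite /= csE; congr (_ :: _).
by apply/rowP => i; rewrite [RHS]mxE [X in _ * X]mxE; exact: (projT2 (cid (d i))).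
Qed.

(** The columns of [U] are Q times logarithmic 1-forms, so a combination of (p+1)-fold products is
    Q^(p+1) times a logarithmic form, that is Q^p t. For the divisibility, each argument annihilated
    by d alpha_H contributes a factor alpha_H through [U]; p + 1 such arguments give the tangency of
    t, and with one transversal argument p factors are left. *)
Lemma saito_log p f : is_pform p.+1 f ->
  exists2 t, is_log A p.+1 t & pull U f = QA A ^+ p *: t.
Proof.
move=> pf; set g := pull U f.
have gH H hs : H \in A -> (forall v, v \in hs -> pairing v (covec H) = 0) ->
    dvdr (form_of H ^+ size hs) (ev g hs).
  move=> HA hv; have [cs csE] := saito_annih HA hv.
  rewrite ev_pull csE ev_scale_all -(size_map (fun c => form_of H *: c) cs) -csE size_map.
  exact/dvdr_mulr/dvdrr.
have gH1 H w hs : H \in A -> (forall v, v \in hs -> pairing v (covec H) = 0) ->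
    dvdr (form_of H ^+ size hs) (ev g (w :: hs)).
  move=> HA hv; have [cs csE] := saito_annih HA hv.
  rewrite ev_pull /= csE ev_cons ev_scale_all -(size_map (fun c => form_of H *: c) cs) -csE size_map.
  exact/dvdr_mulr/dvdrr.
have gall H vs : H \in A -> size vs = p.+1 -> dvdr (form_of H ^+ p) (ev g vs).
  move=> HA; have [nu nuE] := covec_normal H.
  apply: (ev_dvd_all nuE) => [hs sz hv|hs [sz] hv].
    by apply: dvdr_trans (gH H hs HA hv); rewrite sz; apply: dvdr_exp2l.
  by rewrite -sz; apply: gH1.
have Qn0 : QA A ^+ p != 0 by rewrite expf_neq0 // QA_neq0.
have [|t pt tE] := form_quotient Qn0 (pform_pull U pf).
  apply: (@ev_coefP _ _ p.+1 g) => [||vs sz]; [exact: dvdr0|exact: pform_pull|].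
  rewrite /QA -prodrXl; apply: coprime_prod_dvd; first exact: fset_uniq.
  - by move=> H _; exact: form_of_prime.
  - by move=> H H' _ _; exact: form_of_ndvd.
  - by move=> H HA; exact: gall.
exists t => //; apply/is_logP; split=> // H HA hs sz hv.
have := gH H hs HA hv; rewrite /g tE evZ sz => h.
have [Hp H1] := form_of_prime H.
pose Q' := \prod_(L <- rem H A) form_of L.
have QE : QA A = form_of H * Q' by rewrite /QA (big_rem H).
have ndvd : ~ dvdr (form_of H) (Q' ^+ p).
  apply: prime_exp_ndvd => //; apply: prod_forms_ndvd.
  by rewrite mem_rem_uniq ?fset_uniq // inE eqxx.
move: h; rewrite QE exprMn -mulrA exprSr => /(dvdr_mul2l (expf_neq0 _ (form_of_neq0 H))).
by have [_ pp] := Hp => /pp[].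
Qed.

(** The values of t on the basis fields recover the coefficients f, since pulling back along Th U =
    Q multiplies a (p+1)-form by Q^(p+1). *)
Lemma saito_log_values p f t : is_pform p.+1 f -> is_pform p.+1 t -> pull U f = QA A ^+ p *: t ->
  pull Th t = QA A *: f.
Proof.
move=> pf pt e; have [TU _ _ _] := sA.
apply: (form_scaleI (expf_neq0 p (QA_neq0 A))) => /=.
by rewrite -pullZ -e (pull_comp _ _ pf) TU (pull_scalar _ pf) scalerA -exprSr.
Qed.

End SaitoForms.

(** * Restriction of logarithmic forms and surjectivity in the free case *)

Section HyperplaneSection.
Variables (K : fieldType) (n : nat).
Local Notation S := {mpoly K[n.+1]}.
Local Notation S' := {mpoly K[n]}.
Local Notation E := {ffun {set 'I_n.+1} -> S^o}.
Local Notation E' := {ffun {set 'I_n} -> S'^o}.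
Local Notation cS := (map_mx (@mpolyC n.+1 K)).
Local Notation cS' := (map_mx (@mpolyC n K)).
Local Notation dv := defining_vector.
Variables (H : hyperplane K n.+1) (Phi : 'M[K]_(n, n.+1)) (psi : 'M[K]_(n.+1, n)).
Variables (nu : 'rV[K]_n.+1) (r : hyperplane K n.+1 -> hyperplane K n).
Hypothesis sd : section_data H Phi psi nu r.
Local Notation phi := (subst_mx Phi).
Local Notation sigma := (subst_mx psi).
Local Notation pb := (map_form phi).
Local Notation covec' L := (cS' (dv L) : 'cV[S']_n.+1).
Local Notation al := (form_of H).
Local Notation restr := (restr Phi).
Local Notation extend := (extend psi).
Local Notation residue := (residue Phi nu).

Variable A : arrangement K n.+1.
Hypothesis HA : H \notin A.
Local Notation B := (restriction_arr r A).
Local Notation mult := (mult r A).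
Local Notation Bpoly := (Bpoly r A).

Let neqH L : L \in A -> L != H.
Proof. by move=> LA; apply: contraNneq HA => <-. Qed.

Let sig (u : 'rV[S']_n) : 'rV[S]_n.+1 := map_mx sigma (u *m cS' Phi).

Let ev_restr_sig t us : ev (restr t) us = phi (ev t [seq sig u | u <- us]).
Proof. by rewrite ev_restr (ev_pb sd) -map_comp. Qed.

Let sig_annih L u : L \in A -> pairing u (covec (r L)) = 0 -> pairing (sig u) (covec L) = 0.
Proof.
move=> LA hu; rewrite pairing_sigma; have [c c0 ->] := pairing_Phi_r sd (neqH LA).
by rewrite hu mulr0 rmorph0.
Qed.

Let phi_al : phi al = 0.
Proof. by apply/(phi_eq0 sd); exact: dvdrr. Qed.

Lemma restr_dvd_annih p t X us : is_log A p t -> size us = p ->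
  (forall u, u \in us -> pairing u (covec X) = 0) -> dvdr (form_of X ^+ mult X) (ev (restr t) us).
Proof.
move=> lt sz hu; rewrite ev_restr_sig; apply: (mult_dvd sd HA) => L LA rL.
have [_ h] := (is_logP _ _ _).1 lt; apply: h; rewrite ?size_map //.
by move=> v /mapP[u uus ->]; apply: sig_annih => //; rewrite rL; exact: hu.
Qed.

(* The vector field [Y u1 + al nu] is tangent to all members of [A] through [X]. *)
Lemma restr_dvd p t X us : is_log A p t -> X \in B -> size us = p ->
  dvdr (form_of X ^+ (mult X).-1) (ev (restr t) us).
Proof.
move=> lt XB; have [u1 u1E] := normal_of X.
have u1p : pairing (cS' u1) (covec X) = 1 by rewrite map_pairing /pairing u1E mxE eqxx rmorph1.
have [k kE] : exists k, mult X = k.+1 by exists (mult X).-1; rewrite prednK //; exact: mult_gt0.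
apply: (ev_dvd_all u1p) => [ws sz hw|ws sz hw].
  by apply: dvdr_trans (restr_dvd_annih lt sz hw); rewrite kE; apply: dvdr_exp2l.
pose Y := lform (psi *m dv X); pose eul := Y *: cS (u1 *m Phi) + al *: cS nu.
have phiY : phi Y = form_of X by rewrite subst_lform mulmxA (sd_retr sd) mul1mx.
have eulL L : L \in A -> r L = X -> pairing eul (covec L) = form_of L.
  move=> LA rL; have [c c0 cE] := sd_r sd (neqH LA).
  rewrite pairingD !pairingZ !pairing_cst.
  have -> : form_of L = lform (c *: (psi *m dv X) + (nu *m dv L) 0 0 *: dv H).
    congr lform; rewrite -[LHS]mul1mx -(sd_dec sd) mulmxDl -!mulmxA cE rL -scalemxAr.
    by congr (_ + _); rewrite -mul_mx_scalar -mx11_scalar.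
  rewrite lformD !lformZ -/Y mulrC -/al [al * _]mulrC; congr (_ %:MP * _ + _).
  by rewrite -mulmxA cE rL -scalemxAr u1E !mxE eqxx mulr1.
have sig_u1 : sig (cS' u1) = cS (u1 *m Phi) by rewrite /sig -map_mxM sigma_cS.
have := @mult_dvd _ _ _ _ _ _ _ sd A HA X (ev t (eul :: [seq sig u | u <- ws])) _.
(* On H the field [eul] becomes alpha_X u1, which costs one power of alpha_X and explains the
   exponent [(mult X).-1]. *)
have -> : phi (ev t (eul :: [seq sig u | u <- ws])) = form_of X * ev (restr t) (cS' u1 :: ws).
  rewrite /eul ev_consP ev_consZ.
  have -> (x y : S) : phi (Y * x + al * y) = form_of X * phi x.
    by rewrite rmorphD rmorphM phiY rmorphM phi_al mul0r addr0.
  by rewrite ev_restr_sig map_cons -sig_u1.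
rewrite kE exprS /= => h; apply: (dvdr_mul2l (form_of_neq0 X)); apply: h => L LA rL.
apply: (is_log_tangent lt LA); first by rewrite /= size_map.
move=> v; rewrite inE => /orP[/eqP ->|/mapP[u uws ->]]; first by rewrite eulL //; exact: dvdrr.
by rewrite sig_annih ?rL //; [exact: dvdr0 | exact: hw].
Qed.

Lemma restr_log p t : is_log A p t -> exists2 s, is_log B p s & restr t = Bpoly *: s.
Proof.
move=> lt; have [pt _] := lt.
have [|s ps sE] := form_quotient (Bpoly_neq0 r A) (pform_restr Phi pt).
  apply: (@ev_coefP _ _ p (restr t)) => [||us sz]; [exact: dvdr0|exact: pform_restr|].
  apply: coprime_prod_dvd; first exact: fset_uniq.
  - by move=> X _; exact: form_of_prime.
  - by move=> X X' _ _; exact: form_of_ndvd.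
  - by move=> X XB; apply: restr_dvd lt XB sz.
exists s => //; apply/is_logP; split=> // X XB us sz hu.
have := restr_dvd_annih lt sz hu; rewrite sE evZ.
have [k kE] : exists k, mult X = k.+1 by exists (mult X).-1; rewrite prednK //; exact: mult_gt0.
rewrite BpolyE (big_rem X) //= kE exprSr /= -mulrA.
move=> /(dvdr_mul2l (expf_neq0 _ (form_of_neq0 X))).
have [Xp X1] := form_of_prime X; have [_ pp] := Xp => /pp[|//].
rewrite big_seq => /(prime_prod_dvd Xp X1)[Y []].
rewrite mem_rem_uniq ?fset_uniq // inE => /andP[YX _] h; exfalso; move: h.
by apply: prime_exp_ndvd => //; apply: form_of_ndvd; rewrite eq_sym.
Qed.

Lemma restr_eq0 p t : is_log A p t -> restr t = 0 <-> is_log (H |` A)%fset p t.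
Proof.
move=> lt; have [pt ht] := lt; split=> [h|lt'].
  apply/is_logP; split; first exact: pt.
  move=> L; rewrite !inE => /orP[/eqP ->|LA] vs sz hv; last first.
    by have [_ {}ht] := (is_logP _ _ _).1 lt; apply: ht.
  apply/(phi_eq0 sd); rewrite -ev_map.
  have -> : [seq map_mx phi v | v <- vs] = [seq u *m cS' Phi | u <- [seq map_mx phi v *m cS' psi | v <- vs]].
    rewrite -map_comp; apply/eq_in_map => v /hv hv0; apply: (split_H sd).
    by rewrite -(phi_cS Phi) map_pairing hv0 rmorph0.
  by rewrite -ev_restr h ev0.
apply: (@ev_inj _ _ p); [exact: pform_restr|by move=> J _; rewrite ffunE|].
move=> us sz; rewrite ev0 ev_restr; apply: (pb_H sd lt'); rewrite ?inE ?eqxx ?size_map //.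
by move=> w /mapP[u _ ->]; exact: (pairing_Phi sd).
Qed.

(* [Y theta(al) - al theta(Y)] is divisible by every member of [A] through [X]. *)
Lemma tangent_dvd (th : 'rV[S]_n.+1) X :
  (forall L, L \in A -> dvdr (form_of L) (pairing th (covec L))) -> X \in B ->
  dvdr (form_of X ^+ (mult X).-1) (phi (pairing th (covec H))).
Proof.
move=> hth XB.
have [k kE] : exists k, mult X = k.+1 by exists (mult X).-1; rewrite prednK //; exact: mult_gt0.
pose y := psi *m dv X; pose Y := lform y.
pose D := Y * pairing th (covec H) - al * pairing th (cS y).
have phiD : phi D = form_of X * phi (pairing th (covec H)).
  have phiY : phi Y = form_of X by rewrite subst_lform mulmxA (sd_retr sd) mul1mx.
  have e (x z : S) : phi (Y * x - al * z) = form_of X * phi x.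
    by rewrite rmorphB rmorphM phiY rmorphM phi_al mul0r subr0.
  exact: e.
have := @mult_dvd _ _ _ _ _ _ _ sd A HA X D; rewrite phiD kE exprS /=.
move=> h; apply: (dvdr_mul2l (form_of_neq0 X)); apply: h => L LA rL.
have [c c0 cE] := sd_r sd (neqH LA); set b := (nu *m dv L) 0 0.
have dvE : dv L = c *: y + b *: dv H.
  rewrite -[LHS]mul1mx -(sd_dec sd) mulmxDl -!mulmxA cE rL -scalemxAr.
  by congr (_ + _); rewrite -mul_mx_scalar -mx11_scalar.
have fE : form_of L = c%:MP * Y + b%:MP * al by rewrite /form_of dvE lformD !lformZ.
have pE : pairing th (covec L) = c%:MP * pairing th (cS y) + b%:MP * pairing th (covec H).
  by rewrite /covec dvE map_mxD !map_mxZ pairingDr !pairingZr.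
have cc : c^-1%:MP * c%:MP = 1 :> S by rewrite -mpolyCM mulVf // mpolyC1.
have -> : D = c^-1%:MP * (form_of L * pairing th (covec H) - al * pairing th (covec L)).
  have e (c' d b' a' x z w : S) : c' * d = 1 -> x * z - a' * w = c' * ((d * x + b' * a') * z - a' * (d * w + b' * z)).
    by move=> h; rewrite -[LHS]mul1r -h; ring.
  by rewrite fE pE; exact: e cc.
apply/dvdr_mull/dvdrB; first exact/dvdr_mulr/dvdrr.
by apply/dvdr_mull/hth.
Qed.

(** The quotient by q exists only after restriction to H; [sigma] lifts it to a form on the whole
    space. *)
Lemma pform_pull_choice p (M : 'M[S]_n.+1) (w : E) q :
  q != 0 -> is_pform p w -> (forall J, dvdr q (phi (pull M w J))) ->
  exists2 f : E, is_pform p f & forall J, phi (pull M w J) = q * phi (f J).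
Proof.
move=> q0 pw h; have [||g pg gE] := @form_quotient _ _ q p (pb (pull M w)) q0.
- exact/pform_map/pform_pull.
- by move=> J; rewrite ffunE.
exists (map_form sigma g); first exact: pform_map.
move=> J; have /ffunP/(_ J) := gE; rewrite [LHS]ffunE => ->.
by rewrite !ffunE (phi_sigma sd).
Qed.

(** The form xi = d alpha_H /\ extend s has the right residue but need not be logarithmic along A.
    Its coordinates [pull Th xi] become divisible by Q(A) after restriction to H. Taking a lift f of
    the quotient as coordinates gives a form t logarithmic along A and congruent to xi modulo
    alpha_H, which settles both the condition along H and the residue. *)
Lemma residue_surj_saito p s Th U : saito A Th U -> is_log B p s ->
  exists2 t, is_log (H |` A)%fset p.+1 t & residue t = s.
Proof.
move=> sA ls; have [ps hs] := (is_logP _ _ _).1 ls.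
have [TU UT tTh hU] := sA.
pose w := extend s; pose xi : E := wedge1 (covec H) w.
have pw : is_pform p w by apply: pform_extend.
have pxi : is_pform p.+1 xi by apply: pform_wedge1.
have Q0 : phi (QA A) != 0.
  by apply/eqP => /(phi_eq0 sd); exact: form_ndvd_QA.
have ev_xi us : (forall u, u \in us -> pairing u (covec' H) = 0) -> forall v, ev (pb xi) (v :: us) =
    pairing v (covec' H) * ev s [seq u *m cS' psi | u <- us].
  move=> hu v; rewrite map_form_wedge1 phi_cS ev_wedge1_cons //; congr (_ * _).
  by rewrite (pb_extend sd ps) ev_pull.
have xiQ J : dvdr (phi (QA A)) (phi (pull Th xi J)).
  have [Jp|Jp] := eqVneq #|J| p.+1; last first.
    by rewrite (pform_pull Th pxi) // rmorph0; exact: dvdr0.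
  apply: (phi_QA_dvd sd HA) => X XB; rewrite ffunE -ev_map -map_comp.
  have [L LA XL] : exists2 L, L \in A & X = r L by case/imfsetP: XB => L /= LA ->; exists L.
  have [u uE] := transversal_vector sd HA LA.
  have nu1H : pairing (cS' (nu + u *m Phi)) (covec' H) = 1.
    by rewrite map_mxD pairingD map_mxM (pairing_Phi sd) (pairing_nu sd) addr0.
  have nu1L : pairing (cS' (nu + u *m Phi)) (covec' L) = 0.
    by rewrite map_pairing /pairing uE mxE raddf0.
  have [k kE] : exists k, mult X = k.+1 by exists (mult X).-1; rewrite prednK //; exact: mult_gt0.
  (* On vectors of H alone xi vanishes, so one slot carries nu + u, transversal to H and contained
     in L. Its coefficient theta(alpha_H) is divisible by alpha_X^(m-1) by [tangent_dvd]; the other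
     vectors are tangent to X modulo alpha_X, so s supplies the last factor. *)
  apply: (@ev_split S' _ (fun v => pairing v (covec' H) = 0 /\ dvdr (form_of X) (pairing v (covec' L)))
    (dvdr (form_of X ^+ k)) (dvdr (form_of X ^+ mult X)) (cS' (nu + u *m Phi)) p.+1).
  - exact: dvdr0.
  - exact: dvdrD.
  - exact: dvdr_mull.
  - case=> [//|v vs] _ hv; rewrite ev_xi.
      by have [e _] := hv v (mem_head _ _); rewrite e mul0r; exact: dvdr0.
    by move=> v' v'vs; have [|//] := hv v'; rewrite inE v'vs orbT.
  - move=> z ws hz [sz] hw; rewrite ev_xi; last by move=> v /hw[].
    rewrite nu1H mul1r kE exprSr; apply: dvdr_mul => //.
    have [nu' nu'E] := covec_normal X.
    apply: (ev_dvd_annih nu'E) => [us|| v /mapP[v' v'ws ->]]; [exact: hs | by rewrite size_map|].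
    have [h1 h2] := hw _ v'ws.
    have [c c0 cE] := pairing_Phi_r sd (neqH LA).
    have cc : (c^-1)%:MP * c%:MP = 1 :> S' by rewrite -mpolyCM mulVf // mpolyC1.
    rewrite XL; have -> : pairing (v' *m cS' psi) (covec (r L)) = (c^-1)%:MP * pairing v' (covec' L).
      by rewrite [in RHS](split_H sd h1) cE mulrA cc mul1r.
    by apply: dvdr_mull; rewrite -XL.
  - by rewrite size_map -cardE.
  - move=> v /mapP[i _ ->] /=.
    set v0 := map_mx phi _; exists (v0 - pairing v0 (covec' H) *: cS' (nu + u *m Phi)), (pairing v0 (covec' H)).
    have v0E L' : pairing v0 (covec' L') = phi (pairing (row i Th) (covec L')).
      by rewrite /v0 -(phi_cS Phi) map_pairing.
    split; first by rewrite subrK.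
      split; first exact: pairing_split.
      rewrite pairingB pairingZ nu1L mulr0 subr0 v0E XL -(phi_form_dvd sd _ (neqH LA)).
      by apply: dvdr_rmorph; apply: tTh.
    have -> : k = (mult X).-1 by rewrite kE.
    by rewrite v0E; apply: tangent_dvd => // L' L'A; apply: tTh.
have [f pf fE] := pform_pull_choice Q0 pxi xiQ.
have [t lt tE] := saito_log sA pf; have [pt _] := lt.
have tTh' := saito_log_values sA pf pt tE.
have pd : is_pform p.+1 (t - xi) by apply: pformB.
have dTh J : dvdr al (pull Th (t - xi) J).
  apply/(phi_eq0 sd); rewrite pullB tTh' !ffunE regular_scaleE rmorphB rmorphM.
  by have := fE J; rewrite [pull Th xi J]ffunE => ->; rewrite subrr.
(* Pulling back along [U] turns [Th] into multiplication by Q(A)^(p+1), which is prime to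
   alpha_H. *)
have dal J : dvdr al ((t - xi) J).
  have := pull_dvd U dTh J; rewrite (pull_comp _ _ pd) UT (pull_scalar _ pd) ffunE regular_scaleE.
  have [[_ pp] _] := form_of_prime H => /pp[|//].
  by move/(form_ndvd_QAexp HA).
have pbE : pb t = pb xi.
  apply/eqP; rewrite -subr_eq0 -map_formB; apply/eqP/ffunP => J.
  by rewrite [LHS]ffunE [RHS]ffunE; apply/(phi_eq0 sd).
exists t.
  apply/is_logP; split; first exact: pt.
  move=> L; rewrite !inE => /orP[/eqP ->|LA] vs sz hv; last first.
    by have [_ {}ht] := (is_logP _ _ _).1 lt; apply: ht.
  have -> : ev t vs = ev (t - xi) vs by rewrite evB ev_wedge1_annih ?subr0.
  exact: ev_dvd_coef.
apply: (@ev_inj _ _ p) => [||us sz]; [exact: pform_residue|exact: ps|].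
rewrite ev_residue pbE ev_xi => [|u /mapP[v _ ->]]; last exact: (pairing_Phi sd).
rewrite (pairing_nu sd) mul1r -map_comp -[in RHS](map_id us); congr ev; apply: eq_map => u /=.
by rewrite -mulmxA -map_mxM (sd_retr sd) map_mx1 mulmx1.
Qed.

(** Let w extend Bpoly s. The rows of [Th] are tangent to H, and on H tangent to all X, so their
    values on w are there divisible by Bpoly Q(A^H), that is by Q(A). The quotient, lifted to f,
    defines a form t logarithmic along H and A. It is congruent to alpha_H w to second order along H
    on vectors tangent to H, hence t / alpha_H is the form sought. *)
Lemma restr_surj_saito p s Th U : saito (H |` A)%fset Th U -> is_log B p.+1 s ->
  exists2 t, is_log A p.+1 t & restr t = Bpoly *: s.
Proof.
move=> sA ls; have [ps hs] := (is_logP _ _ _).1 ls.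
have [TU UT tTh hU] := sA.
have HHA : H \in (H |` A)%fset by rewrite !inE eqxx.
have QE : QA (H |` A)%fset = al * QA A.
  by rewrite /QA (big_fsetD1 H) //=; congr (_ * _); rewrite fsetU1K.
pose w := extend (Bpoly *: s).
have pBs : is_pform p.+1 (Bpoly *: s) by apply: pformZ.
have pw : is_pform p.+1 w by apply: pform_extend.
have Q0 : phi (QA A) != 0.
  by apply/eqP => /(phi_eq0 sd); exact: form_ndvd_QA.
have wQ J : dvdr (phi (QA A)) (phi (pull Th w J)).
  have [Jp|Jp] := eqVneq #|J| p.+1; last first.
    by rewrite (pform_pull Th pw) // rmorph0; exact: dvdr0.
  rewrite ffunE -ev_map -map_comp (pb_extend sd pBs) ev_pull evZ.
  have [c [d [cd ce]]] := phi_QA sd HA.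
  have dc : d * c = 1 by rewrite mulrC.
  apply/(eq_dvdr_unit dc ce); apply: dvdr_mul; first exact: dvdrr.
  apply: prod_forms_dvd; first exact: fset_uniq.
  move=> X /imfsetP[L /= LA ->]; have [nu' nu'E] := covec_normal (r L).
  apply: (ev_dvd_annih nu'E) => [us||v /mapP[_ /mapP[i _ ->] ->]].
  - by apply: hs; apply/imfsetP; exists L.
  - by rewrite !size_map -cardE.
  - rewrite /=; set v0 := map_mx phi _.
    have v0E L' : pairing v0 (covec' L') = phi (pairing (row i Th) (covec L')).
      by rewrite /v0 -(phi_cS Phi) map_pairing.
    have h0 : pairing v0 (covec' H) = 0 by rewrite v0E; apply/(phi_eq0 sd)/tTh.
    have [c' c'0 c'E] := pairing_Phi_r sd (neqH LA).
    have cc : (c'^-1)%:MP * c'%:MP = 1 :> S' by rewrite -mpolyCM mulVf // mpolyC1.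
    have -> : pairing (v0 *m cS' psi) (covec (r L)) = (c'^-1)%:MP * pairing v0 (covec' L).
      by rewrite [in RHS](split_H sd h0) c'E mulrA cc mul1r.
    apply: dvdr_mull; rewrite v0E -(phi_form_dvd sd _ (neqH LA)).
    by apply: dvdr_rmorph; apply: tTh; rewrite !inE LA orbT.
have [f pf fE] := pform_pull_choice Q0 pw wQ.
have [t lt tE] := saito_log sA pf; have [pt _] := lt.
have tTh' := saito_log_values sA pf pt tE.
pose d := t - al *: w.
have pd : is_pform p.+1 d by apply: pformB => //; apply: pformZ.
have [e eE] : exists e : E, pull Th d = al ^+ 2 *: e.
  apply: form_dvdP => J; rewrite pullB pullZ tTh' QE.
  have -> : (((al * QA A) *: f - al *: pull Th w) J : S) = al * (QA A * f J - pull Th w J).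
    by rewrite !ffunE !regular_scaleE mulrBr mulrA.
  rewrite expr2; apply: dvdr_mul; first exact: dvdrr.
  by apply/(phi_eq0 sd); rewrite rmorphB rmorphM fE subrr.
have evd vs : size vs = p.+1 -> (al * QA A) ^+ p.+1 * ev d vs = al ^+ 2 * ev e [seq v *m U | v <- vs].
  by move=> sz; rewrite -evZ -QE -(pull_scalar _ pd) -UT -(pull_comp _ _ pd) ev_pull eE evZ.
(* The vectors v U supply alpha_H^(p+k); together with alpha_H^2 and after cancelling alpha_H^(p+1),
   the power k + 1 remains. It is used with k = 1 for tangent vectors and k = 0 when one vector is
   transversal. *)
have cancel k vs : size vs = p.+1 -> dvdr (al ^+ (p + k)) (ev e [seq v *m U | v <- vs]) ->
    dvdr (al ^+ k.+1) (ev d vs).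
  move=> sz [g gE]; have := evd _ sz; rewrite gE exprMn -mulrA.
  have e2 : (2 + (p + k) = p.+1 + k.+1)%N by rewrite [RHS]addSn addnS.
  have -> : al ^+ 2 * (al ^+ (p + k) * g) = al ^+ p.+1 * (al ^+ k.+1 * g).
    by rewrite [LHS]mulrA [RHS]mulrA -!exprD e2.
  move=> /(mulfI (expf_neq0 _ (form_of_neq0 H))) h.
  have : dvdr (al ^+ k.+1) (ev d vs * QA A ^+ p.+1) by rewrite mulrC h; exists g.
  have [Hp _] := form_of_prime H; apply: prime_exp_dvd => //; exact: form_ndvd_QAexp.
have dH hs' : size hs' = p.+1 -> (forall v, v \in hs' -> pairing v (covec H) = 0) ->
    dvdr (al ^+ 2) (ev d hs').
  move=> sz hv; apply: cancel => //; have [cs csE] := saito_annih sA HHA hv.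
  rewrite csE ev_scale_all -(size_map (fun c => al *: c) cs) -csE size_map sz addn1.
  exact/dvdr_mulr/dvdrr.
have dall vs : size vs = p.+1 -> dvdr al (ev d vs).
  have [nu' nu'E] := covec_normal H.
  apply: (ev_dvd_all nu'E) => [hs' sz hv|hs' [sz] hv].
    by apply: dvdr_trans (dH _ sz hv); rewrite expr2; apply/dvdr_mulr/dvdrr.
  rewrite -[X in dvdr X _]expr1; apply: cancel; first by rewrite /= sz.
  have [cs csE] := saito_annih sA HHA hv.
  rewrite /= csE ev_cons ev_scale_all -(size_map (fun c => al *: c) cs) -csE size_map sz addn0.
  exact/dvdr_mulr/dvdrr.
have [|d' pd' d'E] := form_quotient (form_of_neq0 H) pd.
  by apply: (@ev_coefP _ _ p.+1 d) => //; exact: dvdr0.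
have tE' : t = al *: (w + d').
  by rewrite scalerDr -d'E /d addrC subrK.
exists (w + d').
  apply: (is_log_cancel (A := (H |` A)%fset) (g := al)); rewrite -?tE' //; last exact: pformD.
  move=> L LA; rewrite !inE LA orbT; split=> //; apply: form_of_ndvd; exact: neqH.
rewrite -[RHS](restr_extend sd pBs); apply: (@ev_inj _ _ p.+1); [exact/pform_restr/pformD|exact: pform_restr|].
move=> us sz; rewrite !ev_restr_sig evD rmorphD [X in _ + X](_ : _ = 0) ?addr0 //.
apply/(phi_eq0 sd); have := dH [seq sig u | u <- us]; rewrite size_map sz => /(_ erefl) h.
apply: (dvdr_mul2l (form_of_neq0 H)); rewrite -expr2 -evZ -d'E; apply: h => v /mapP[u _ ->].
by rewrite pairing_sigma (pairing_Phi sd) rmorph0.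
Qed.

End HyperplaneSection.

(** * Coordinates on a hyperplane *)

Section SectionData.
Variable K : fieldType.

Lemma hyperplane_of_covector n (a : 'cV[K]_n) : a != 0 ->
  exists (X : hyperplane K n) (c : K), c != 0 /\ a = c *: defining_vector X.
Proof.
move=> a0; pose f : 'Hom('rV[K]_n, 'rV[K]_1) := linfun (mulmxr a).
have kerP v : (v \in lker f) = (v *m a == 0) by rewrite memv_ker lfunE.
have [nu nuE] := normal_exists a0.
have limf : limg f = fullv.
  apply/vspaceP => y; rewrite memvf; apply/memv_imgP; exists (y 0 0 *: nu); first exact: memvf.
  by rewrite lfunE /= -scalemxAl nuE scalemx1 -mx11_scalar.
have hX : is_hyperplane (lker f).
  rewrite /is_hyperplane; have := limg_ker_dim f fullv.
  by rewrite capfv limf !dimvf /dim /= !mul1n addn1 => ->.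
pose X : hyperplane K n := exist (fun H => is_hyperplane H) (lker f) hX.
exists X; have [|c cE] := @colinear_covectors _ _ (defining_vector X) a (defining_vector_neq0 X).
  by move=> v /eqP; rewrite -hyperplaneP => h; apply/eqP; rewrite -kerP.
exists c; split=> //; by apply: contra_neq a0 => c0; rewrite cE c0 scale0r.
Qed.

Lemma section_data_of_basis n (H : hyperplane K n.+1) (Phi : 'M[K]_(n, n.+1)) :
  (0 < n)%N -> row_free Phi -> Phi *m defining_vector H = 0 ->
  exists psi nu r, section_data H Phi psi nu r.
Proof.
move=> n0 fPhi Pa; have [nu nua] := normal_of H; set a := defining_vector H in Pa nua *.
have kerE (v : 'rV[K]_n.+1) : v *m a = 0 -> (v <= Phi)%MS.
  move=> va; have PK : (Phi <= kermx a)%MS by apply/sub_kermxP.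
  have a0 : a != 0 by exact: defining_vector_neq0.
  have rk : \rank (kermx a) = n.
    have : (0 < \rank a)%N by rewrite lt0n mxrank_eq0.
    have : (\rank a <= 1)%N by rewrite rank_leq_col.
    by rewrite mxrank_ker; case: (\rank a) => [|[|]] //; rewrite subn1.
  have [_ /esym e] := mxrank_leqif_sup PK.
  have KP : (kermx a <= Phi)%MS by rewrite e rk; apply/eqP/(eqP fPhi).
  by apply: submx_trans KP; apply/sub_kermxP.
(* Project to H along [nu], then take coordinates in the basis given by the rows of [Phi]. *)
pose psi := (1%:M - a *m nu) *m pinvmx Phi.
have retr : Phi *m psi = 1%:M.
  by rewrite mulmxA mulmxBr mulmx1 [Phi *m (a *m nu)]mulmxA Pa mul0mx subr0 mulmxVp.
have dec : psi *m Phi + a *m nu = 1%:M.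
  rewrite /psi mulmxKpV ?subrK //; apply/row_subP => i; apply: kerE.
  by rewrite -row_mul mulmxBl mul1mx -mulmxA nua mulmx1 subrr row0.
have rex L : exists X, L != H -> exists2 c, c != 0 & Phi *m defining_vector L = c *: defining_vector X.
  (* The total function [r] also takes a value at H; as n > 0, the all-ones covector provides some
     hyperplane of K^n. *)
  have [->|LH] := eqVneq L H.
    have [|X _] := @hyperplane_of_covector n (const_mx 1); last by exists X.
    apply/eqP => /colP/(_ (Ordinal n0))/eqP; by rewrite !mxE oner_eq0.
  have PL : Phi *m defining_vector L != 0.
    apply: contraNneq LH => PL; apply/eqP/esym/hyperplane_sub_eq/subvP => v.
    rewrite !hyperplaneP => /eqP/kerE/submxP[u ->].
    by rewrite -mulmxA PL mulmx0.
  by have [X [c [c0 cE]]] := hyperplane_of_covector PL; exists X => _; exists c.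
exists psi, nu, (fun L => projT1 (cid (rex L))); split=> // L LH.
exact: (projT2 (cid (rex L))).
Qed.

Lemma section_data_exists n (H : hyperplane K n.+1) : (0 < n)%N ->
  exists Phi psi nu r, section_data H Phi psi nu r.
Proof.
move=> n0; have dimH : \dim (val H) = n by have /eqP[] := valP H.
pose Phi : 'M[K]_(n, n.+1) := \matrix_(i < n) (vbasis (val H))`_i.
exists Phi; apply: section_data_of_basis => //.
  rewrite -kermx_eq0; apply/rowV0P => u /sub_kermxP uP.
  have /freeP fH := basis_free (vbasisP (val H)).
  apply/rowP => i; rewrite mxE.
  have := fH (fun j : 'I_(\dim (val H)) => u 0 (cast_ord dimH j)) _ (cast_ord (esym dimH) i).
  rewrite cast_ordKV; apply; rewrite -[RHS]uP.
  rewrite (reindex (cast_ord (esym dimH))) /=; last first.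
    by exists (cast_ord dimH) => j _; rewrite ?cast_ordK ?cast_ordKV.
  apply/rowP => k; rewrite summxE mxE; apply: eq_bigr => j _.
  by rewrite !mxE cast_ordKV.
apply/row_matrixP => i; rewrite row_mul rowK row0; apply/eqP; rewrite -hyperplaneP.
have i' : (i < size (vbasis (val H)))%N by rewrite size_tuple dimH.
exact: (vbasis_mem (mem_nth 0 i')).
Qed.

Lemma hyperplane_of_section n (H : hyperplane K n.+1) Phi psi nu r : section_data H Phi psi nu r ->
  forall L, L != H -> forall u : 'rV[K]_n, (u \in val (r L)) = (u *m Phi \in val L).
Proof.
move=> sd L LH u; have [c c0 cE] := sd_r sd LH.
by rewrite !hyperplaneP -mulmxA cE -scalemxAr scaler_eq0 (negPf c0).
Qed.

Lemma restriction_section n (A : arrangement K n.+1) (H : hyperplane K n.+1)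
    (phi : 'Hom('rV[K]_n, 'rV[K]_n.+1)) (B : arrangement K n) : (0 < n)%N ->
  is_restriction A H phi B ->
  exists Phi psi nu r, section_data H Phi psi nu r /\ B = restriction_arr r (A `\ H)%fset.
Proof.
move=> n0 [ker0 im rest]; pose Phi := lin1_mx phi.
have PhiE u : u *m Phi = phi u by rewrite mul_rV_lin1.
have phi_inj : injective phi by apply/lker0P; rewrite ker0.
have [||psi [nu [r sd]]] := @section_data_of_basis n H Phi n0.
- rewrite -kermx_eq0; apply/rowV0P => u /sub_kermxP; rewrite PhiE -(linear0 phi).
  exact: phi_inj.
- apply/row_matrixP => i; rewrite row_mul row0; apply/eqP; rewrite -hyperplaneP.
  by rewrite rowE PhiE -im memv_img ?memvf.
exists Phi, psi, nu, r; split=> //.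
have key X L : L != H -> (phi @: val X)%VS = (val H :&: val L)%VS -> X = r L.
  move=> LH e; apply/val_inj/vspaceP => u; rewrite (hyperplane_of_section sd LH) PhiE.
  have -> : (u \in val X) = (phi u \in (phi @: val X)%VS).
    apply/idP/idP => [h|/memv_imgP[v vX /phi_inj ->] //]; exact: memv_img.
  by rewrite e memv_cap -im memv_img ?memvf.
apply/fsetP => X; apply/idP/imfsetP => [XB|[L /= LA ->]].
  have : (phi @: val X)%VS \in [fset (phi @: val L)%VS | L in B]%fset by apply/imfsetP; exists X.
  rewrite rest => /imfsetP[L /= LA e]; exists L => //; apply: key => //.
  by move: LA; rewrite !inE => /andP[].
have LH : L != H by move: LA; rewrite !inE => /andP[].
have : (val H :&: val L)%VS \in [fset (val H :&: val L)%VS | L in (A `\ H)%fset]%fset.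
  by apply/imfsetP; exists L.
by rewrite -rest => /imfsetP[X' /= X'B /esym/(key _ _ LH) <-].
Qed.

End SectionData.

(** * From local to global surjectivity *)

Lemma count_ltn (T : eqType) (a b : pred T) (s : seq T) (x : T) :
  subpred a b -> x \in s -> ~~ a x -> b x -> (count a s < count b s)%N.
Proof.
move=> ab; elim: s => [//|y s IH]; rewrite inE /= => /orP[/eqP<- na bx|xs na bx].
  by rewrite (negPf na) bx add0n add1n ltnS sub_count.
have := IH xs na bx; have := ab y; case: (a y) => /= [->//|_] lt.
by rewrite add0n (leq_trans lt) ?leq_addl.
Qed.

Section GlobalSurjectivity.
Variables (K : fieldType) (n : nat).
Local Notation S := {mpoly K[n.+1]}.
Local Notation S' := {mpoly K[n]}.
Variables (phi : {rmorphism S -> S'}) (A : arrangement K n.+1) (H : hyperplane K n.+1).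
Hypothesis HA : H \in A.
Hypothesis phiH : phi (form_of H) = 0.
Variables (F G : lmodType S) (N : lmodType S').
Variables (f : {linear F -> G}) (g : {linear G -> resmod phi N}).
Hypothesis finj : injective f.
Hypothesis exact_g : forall x, g x = 0 <-> exists y, f y = x.
Variable k : nat.
Hypothesis kn : (k + 3 <= n.+1)%N.
Hypothesis pdF : pdim_le k F.
Hypothesis pdG : pdim_le (n.+1 - 2) G.
Hypothesis torsion_free : forall (a : S') (y : N), a != 0 -> a *: y = 0 -> y = 0.
Hypothesis phiX : exists i, phi 'X_i != 0.
(** Surjectivity at x without localizing: the forms of the hyperplanes missing x are units at x, and
    their product carries every s into the image. *)
Hypothesis local_surj : forall x, x \in val H -> x != 0 -> forall s : N,
  exists t, g t = phi (\prod_(L <- A | x \notin val L) form_of L) *: s.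

Let im (c : resmod phi N) : Prop := exists t, g t = c.

Let imD c d : im c -> im d -> im (c + d).
Proof. by move=> [x <-] [y <-]; exists (x + y); rewrite linearD. Qed.
Let imZ a c : im c -> im (a *: c).
Proof. by move=> [x <-]; exists (a *: x); rewrite linearZ. Qed.

Let T (c : resmod phi N) : seq (hyperplane K n.+1) := [seq L <- A | `[< im (form_of L *: c) >]].

Let socle_lift c : (forall i, im ('X_i *: c)) -> im c.
Proof.
move=> h; have reg := regular_all_vars K n.+1; have sz := size_all_vars K n.+1.
apply: (koszul_lift (xs := all_vars K n.+1) finj exact_g).
(* The two degree counts are 2 + k < n + 1 for F and 1 + (n + 1 - 2) < n + 1 for G. *)
- by apply: regular_pdim_kvanish reg pdF _; rewrite sz; lia.
- by apply: regular_pdim_kvanish reg pdG _; rewrite sz; lia.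
- move=> y hy; have [i i0] := phiX; apply: (torsion_free i0).
  by apply: (hy 'X_i); apply: map_f; rewrite mem_enum.
- by move=> x /mapP[i _ ->]; exact: h.
Qed.

(** If the members of [T c] meet only in 0, their forms span all linear forms, so every variable
    carries c into the image and [socle_lift] applies. *)
Let span_lift c : (forall x : 'rV[K]_n.+1, (forall L, L \in T c -> x \in val L) -> x = 0) -> im c.
Proof.
move=> h; apply: socle_lift => i.
pose M := \matrix_(i < n.+1, j < size (T c)) defining_vector (tnth (in_tuple (T c)) j) i 0.
have /row_freeP[N' MN] : row_free M.
  rewrite -kermx_eq0; apply/rowV0P => u /sub_kermxP/rowP uM; apply: h => L LT.
  rewrite hyperplaneP; apply/eqP/rowP => j; rewrite ord1 [RHS]mxE.
  have iL : (index L (T c) < size (T c))%N by rewrite index_mem.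
  have := uM (Ordinal iL); rewrite [RHS]mxE => <-; rewrite !mxE; apply: eq_bigr => k' _.
  by rewrite !mxE (tnth_nth L) /= nth_index.
have -> : 'X_i = \sum_(j < size (T c)) (N' j i)%:MP * form_of (tnth (in_tuple (T c)) j) :> S.
  have -> : 'X_i = lform (M *m col i N') :> S.
    by rewrite -[LHS]subst_mx1 subst_mxX -MN [col i (M *m N')]colE colE mulmxA.
  under eq_bigr do rewrite -lformZ.
  have -> : M *m col i N' = \sum_(j < size (T c)) N' j i *: defining_vector (tnth (in_tuple (T c)) j).
    apply/colP => i'; rewrite summxE mxE; apply: eq_bigr => j _.
    by rewrite !mxE mulrC.
  by elim/big_rec2: _ => [|j x y _ <-]; rewrite ?lform0 // lformD.
rewrite scaler_suml; apply: (big_ind im) => [|x y|j _].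
- by exists 0; rewrite linear0.
- exact: imD.
- rewrite -scalerA; apply: imZ.
  by have := mem_tnth j (in_tuple (T c)); rewrite mem_filter => /andP[/asboolP].
Qed.

(* Choose [c] outside the image with as many [form_of L *: c] as possible in it. *)
Lemma global_surj : forall c, exists t, g t = c.
Proof.
have main m : forall c, (size A - size (T c) < m)%N -> im c.
  elim: m => [//|m IH] c cm.
  have [h|/existsNP[x /not_implyP[hx x0]]] := pselect (forall x : 'rV[K]_n.+1,
      (forall L, L \in T c -> x \in val L) -> x = 0); first exact: span_lift.
  (* The form of H acts as zero on N, so H always belongs to [T c]. *)
  have xH : x \in val H.
    apply: hx; rewrite mem_filter HA andbT; apply/asboolP.
    by exists 0; rewrite linear0 resmodZ phiH scale0r.
  have [t tE] := local_surj xH (introN eqP x0) c.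
  have hc : im (\prod_(L <- A | x \notin val L) form_of L *: c) by exists t.
  apply: contrapT => nc.
  (* Multiply c by the forms missing x one at a time; d is the last product outside the image and L
     the factor that brings it in. As L misses x, it belongs to [T d] but not to [T c]. *)
  have [d [L [LA xL nd dL dT]]] : exists d L, [/\ L \in A, x \notin val L, ~ im d,
      im (form_of L *: d) & forall M, im (form_of M *: c) -> im (form_of M *: d)].
    have : forall L, L \in enum_fset A -> L \in A by [].
    elim: (enum_fset A) hc => [|L s IHs] /=.
      by rewrite big_nil scale1r.
    rewrite big_cons; case: ifP => xL hc hs; last first.
      by apply: IHs => // M Ms; apply: hs; rewrite inE Ms orbT.
    set d := \prod_(M <- s | x \notin val M) form_of M *: c in IHs *.
    have [dim|nd] := pselect (im d).
      by apply: IHs => // M Ms; apply: hs; rewrite inE Ms orbT.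
    exists d, L; split=> //; first by apply: hs; rewrite mem_head.
      by rewrite /d scalerA.
    by move=> M hM; rewrite /d scalerA mulrC -scalerA; apply: imZ.
  apply: nd; apply: IH.
  have TT : (size (T c) < size (T d))%N.
    rewrite !size_filter; have : L \in enum_fset A by exact: LA.
    have imp M : `[< im (form_of M *: c) >] -> `[< im (form_of M *: d) >].
      by move=> /asboolP h; apply/asboolP/dT.
    have nL : ~~ `[< im (form_of L *: c) >].
      by apply: contra xL => h; apply: hx; rewrite mem_filter h.
    move=> LA'; apply: (count_ltn imp LA' nL); exact/asboolP.
  have : (size (T d) <= size A)%N by rewrite size_filter count_size.
  by lia.
move=> c; exact: (main (size A - size (T c)).+1).
Qed.

End GlobalSurjectivity.

(** * The residue and restriction sequences *)

Lemma semilinear_lift (R R' : comNzRingType) (phi : {rmorphism R -> R'}) (M : lmodType R)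
    (N N' : lmodType R') (i : {linear N -> N'}) (h : M -> N') :
  injective i -> (forall a x y, h (a *: x + y) = phi a *: h x + h y) ->
  (forall x, exists u, i u = h x) ->
  exists g : {linear M -> resmod phi N}, forall x, i (g x) = h x.
Proof.
move=> ii hl hx; pose g x := projT1 (cid (hx x)).
have gE x : i (g x) = h x by exact: (projT2 (cid (hx x))).
have [|g' g'E] := @linear_ext _ M (resmod phi N) g; last by exists g' => x; rewrite g'E.
by move=> a x y; apply: ii; rewrite gE hl resmodZ linearP !gE.
Qed.

Lemma submod_torsion_free (R : nzRingType) (M : lmodType R) (U : submodule M) a :
  (forall x : M, a *: x = 0 -> x = 0) -> forall y : submod_type U, a *: y = 0 -> y = 0.
Proof.
move=> h y e; apply: submod_incl_inj; rewrite linear0; apply: h.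
by rewrite -linearZ e linear0.
Qed.

Lemma in_localization (K : fieldType) l (A : arrangement K l) x L :
  (L \in localization A x) = (L \in A) && (x \in val L).
Proof. by rewrite !inE. Qed.

Section ResidueSequences.
Variables (K : fieldType) (n : nat).
Local Notation S := {mpoly K[n.+1]}.
Local Notation S' := {mpoly K[n]}.
Local Notation E := {ffun {set 'I_n.+1} -> S^o}.
Local Notation E' := {ffun {set 'I_n} -> S'^o}.
Variables (H : hyperplane K n.+1) (Phi : 'M[K]_(n, n.+1)) (psi : 'M[K]_(n.+1, n)).
Variables (nu : 'rV[K]_n.+1) (r : hyperplane K n.+1 -> hyperplane K n).
Hypothesis sd : section_data H Phi psi nu r.
Hypothesis n0 : (0 < n)%N.
Local Notation phi := (subst_mx Phi).
Local Notation sigma := (subst_mx psi).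
Local Notation al := (form_of H).
Variable A : arrangement K n.+1.
Hypothesis HA : H \notin A.
Local Notation B := (restriction_arr r A).

Lemma pullP m k (M : 'M[S']_(m, k)) a (x y : {ffun {set 'I_k} -> S'^o}) :
  pull M (a *: x + y) = a *: pull M x + pull M y.
Proof.
have pE t J : pull M t J = ev t [seq row i M | i <- enum J] by rewrite ffunE.
by apply/ffunP => J; rewrite pE [RHS]ffunE [X in _ = X + _]ffunE !pE evD evZ.
Qed.

Lemma restrP a (x y : E) : restr Phi (a *: x + y) = phi a *: restr Phi x + restr Phi y.
Proof. by rewrite /restr map_formD map_formZ pullP. Qed.

Lemma residueP a (x y : E) :
  residue Phi nu (a *: x + y) = phi a *: residue Phi nu x + residue Phi nu y.
Proof. by rewrite /residue map_formD map_formZ linearP pullP. Qed.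

Lemma restrZ a (x : E) : restr Phi (a *: x) = phi a *: restr Phi x.
Proof. by rewrite /restr map_formZ pullZ. Qed.

Lemma residueZ a (x : E) : residue Phi nu (a *: x) = phi a *: residue Phi nu x.
Proof. by rewrite /residue map_formZ linearZ pullZ. Qed.

Lemma subst_section_al : phi al = 0.
Proof. by apply/(phi_eq0 sd); exact: dvdrr. Qed.

Lemma subst_section_surj y : exists x, phi x = y.
Proof. by exists (sigma y); rewrite (phi_sigma sd). Qed.

Lemma subst_section_ker x : phi x = 0 <-> exists y, x = al * y.
Proof. exact: (phi_eq0 sd). Qed.

Lemma subst_section_var : exists i, phi 'X_i != 0.
Proof.
apply: contrapT => h.
have P0 : Phi = 0.
  apply/matrixP => i j; rewrite [RHS]mxE; apply: contrapT => /eqP ij.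
  apply: h; exists j; rewrite subst_mxX.
  have [|[p0 _] _] := @lform_prime K n (col j Phi); last exact: p0.
  by apply: contra_neq ij => /colP/(_ i); rewrite !mxE.
have := sd_retr sd; rewrite P0 mul0mx => /matrixP/(_ (Ordinal n0) (Ordinal n0))/eqP.
by rewrite !mxE eqxx eq_sym oner_eq0.
Qed.

Lemma logmod_torsion_free m (C : arrangement K m) p a (y : logmod C p) :
  a != 0 -> a *: y = 0 -> y = 0.
Proof.
move=> a0; apply: (@submod_torsion_free _ _ (log_submod C p)) => x ax.
by apply: (form_scaleI a0); rewrite /= ax scaler0.
Qed.

Lemma restriction_arr_loc x X : X \in restriction_arr r (localization A x) -> X \in B.
Proof.
move=> /imfsetP[L /=]; rewrite in_localization => /andP[LA _] ->.
by apply/imfsetP; exists L.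
Qed.

Lemma away_loc x L (C : arrangement K n.+1) : L \in A -> (forall M, M \in A -> M \in C) ->
  L \in localization A x \/ dvdr (form_of L) (\prod_(M <- C | x \notin val M) form_of M).
Proof.
move=> LA /(_ L LA) LC; have [xL|xL] := boolP (x \in val L); first by left; rewrite in_localization LA.
right; rewrite -big_filter (big_rem L) /=; first exact/dvdr_mulr/dvdrr.
by rewrite mem_filter xL.
Qed.

(** Exactness on the left and in the middle is [residue_eq0]. For surjectivity, the form given at x
    by Saito's criterion is logarithmic only along the localization; multiplied by the forms missing
    x it becomes logarithmic along everything, as [global_surj] demands. *)
Lemma residue_ses p k : (k + 3 <= n.+1)%N -> pdim_le k (logmod A p.+1) ->
  (forall x, x \in val H -> x != 0 -> free_arrangement (localization A x)) ->
  exists (f : {linear logmod A p.+1 -> logmod (H |` A)%fset p.+1})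
    (g : {linear logmod (H |` A)%fset p.+1 -> resmod phi (logmod B p)}), ses f g.
Proof.
move=> kn pdA freeA.
have [f fE] : exists f : {linear logmod A p.+1 -> logmod (H |` A)%fset p.+1},
    forall x, submod_incl (f x) = al *: submod_incl x.
  have [|h hE] := @linear_ext _ (logmod A p.+1) E (fun x => al *: submod_incl x).
    by move=> a x y; rewrite /= [submod_incl _]linearP scalerDr !scalerA mulrC.
  have [|f fE] := @submod_corestrict _ _ (log_submod (H |` A)%fset p.+1) _ h.
    move=> x; rewrite hE; apply: is_logZ_away (logmodP x) => L.
    by rewrite !inE => /orP[/eqP ->|]; [right; exact: dvdrr|left].
  by exists f => x; rewrite fE hE.
have [||x|g gE] := @semilinear_lift _ _ phi (logmod (H |` A)%fset p.+1) (logmod B p) E'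
    (submod_incl (U := log_submod B p)) (fun x => residue Phi nu (submod_incl x)).
- exact: submod_incl_inj.
- by move=> a x y; rewrite linearP residueP.
- exact: logmod_elt (residue_log sd HA (logmodP x)).
exists f, g.
have fi : injective f.
  move=> x y e; apply: submod_incl_inj; apply: (form_scaleI (form_of_neq0 H)).
  by rewrite -!fE e.
have ex x : g x = 0 <-> exists y, f y = x.
  have -> : g x = 0 <-> residue Phi nu (submod_incl x) = 0.
    rewrite -gE; split=> [->|e]; first by rewrite linear0.
    by apply: submod_incl_inj; rewrite e linear0.
  rewrite (residue_eq0 sd HA (logmodP x)); split=> [[t' /logmod_elt[y <-] e]|[y <-]].
    by exists y; apply: submod_incl_inj; rewrite fE.
  by exists (submod_incl y); [exact: logmodP|exact: fE].
split=> //; apply: (@global_surj _ _ phi (H |` A)%fset H _ _ _ _ _ f g fi ex k kn pdA).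
- by rewrite in_fset1U eqxx.
- exact: subst_section_al.
- exact: logmod_pdim.
- by move=> a y; exact: logmod_torsion_free.
- exact: subst_section_var.
move=> x xH x0 s; have [Th [U sA]] := saito_of_free (freeA x xH x0).
have HAx : H \notin localization A x by apply: contra HA; rewrite in_localization => /andP[].
have sx := is_log_sub (@restriction_arr_loc x) (logmodP s).
have [t lt tE] := residue_surj_saito sd HAx sA sx.
set gx := \prod_(L <- _ | _) _.
have [|u uE] := @logmod_elt _ _ (H |` A)%fset p.+1 (gx *: t).
  apply: is_logZ_away lt => L LA.
  have [->|LH] := eqVneq L H; first by left; rewrite in_fset1U eqxx.
  have LA' : L \in A by move: LA; rewrite in_fset1U (negPf LH).
  have [M MA|h|h] := @away_loc x L (H |` A)%fset LA'; first by rewrite in_fset1U MA orbT.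
    by left; rewrite in_fset1U h orbT.
  by right.
exists u; apply: submod_incl_inj; rewrite gE uE residueZ tE.
by symmetry; exact: linearZ.
Qed.

Lemma Bpoly_loc x : exists k, Bpoly r A = Bpoly r (localization A x) * k.
Proof.
apply: coprime_prod_dvd; first exact: fset_uniq.
- by move=> X _; exact: form_of_prime.
- by move=> X X' _ _; exact: form_of_ndvd.
move=> X Xx; rewrite [Bpoly r A](big_rem X) /=; last exact: (restriction_arr_loc Xx).
apply/dvdr_mulr/dvdr_exp2l; rewrite -!subn1 leq_sub2r // /mult.
rewrite -[leqLHS]size_filter -[leqRHS]size_filter; apply: uniq_leq_size.
  by rewrite filter_uniq ?fset_uniq.
move=> L; rewrite !mem_filter => /andP[->] LAx.
have : L \in localization A x by [].
by rewrite in_localization => /andP[].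
Qed.

Lemma restr_ses p k : (k + 3 <= n.+1)%N -> pdim_le k (logmod (H |` A)%fset p.+1) ->
  (forall x, x \in val H -> x != 0 -> free_arrangement (localization (H |` A)%fset x)) ->
  exists (f : {linear logmod (H |` A)%fset p.+1 -> logmod A p.+1})
    (g : {linear logmod A p.+1 -> resmod phi (logmod B p.+1)}), ses f g.
Proof.
move=> kn pdA freeA.
have [f fE] : exists f : {linear logmod (H |` A)%fset p.+1 -> logmod A p.+1},
    forall x, submod_incl (f x) = submod_incl x.
  apply: (@submod_corestrict _ _ (log_submod A p.+1) (logmod (H |` A)%fset p.+1)).
  by move=> x; apply: is_log_sub (logmodP x) => L; rewrite in_fset1U => ->; rewrite orbT.
have [i iE] : exists i : {linear logmod B p.+1 -> E'},
    forall x, i x = Bpoly r A *: submod_incl x.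
  apply: (@linear_ext _ (logmod B p.+1) E' (fun x => Bpoly r A *: submod_incl x)).
  by move=> a x y; rewrite /= [submod_incl _]linearP scalerDr !scalerA mulrC.
have ii : injective i.
  move=> x y; rewrite !iE => /(form_scaleI (Bpoly_neq0 r A)); exact: submod_incl_inj.
have [||g gE] := @semilinear_lift _ _ phi (logmod A p.+1) (logmod B p.+1) E'
    i (fun x => restr Phi (submod_incl x)) ii.
- by move=> a x y; rewrite linearP restrP.
- move=> x; have [s ls e] := restr_log sd HA (logmodP x).
  by have [u uE] := logmod_elt ls; exists u; rewrite iE uE.
exists f, g.
have fi : injective f by move=> x y e; apply: submod_incl_inj; rewrite -!fE e.
have ex x : g x = 0 <-> exists y, f y = x.
  have -> : g x = 0 <-> restr Phi (submod_incl x) = 0.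
    by rewrite -gE; split=> [->|e]; [rewrite linear0|apply: ii; rewrite e linear0].
  rewrite (restr_eq0 sd (logmodP x)); split=> [/logmod_elt[y e]|[y <-]].
    by exists y; apply: submod_incl_inj; rewrite fE.
  by rewrite fE; exact: logmodP.
split=> //; apply: (@global_surj _ _ phi (H |` A)%fset H _ _ _ _ _ f g fi ex k kn pdA).
- by rewrite in_fset1U eqxx.
- exact: subst_section_al.
- exact: logmod_pdim.
- by move=> a y; exact: logmod_torsion_free.
- exact: subst_section_var.
move=> x xH x0 s.
have HAx : H \notin localization A x by apply: contra HA; rewrite in_localization => /andP[].
have loc : localization (H |` A)%fset x = (H |` localization A x)%fset.
  apply/fsetP => L; rewrite in_localization !in_fset1U in_localization.
  by have [->|] := eqVneq L H.
have := freeA x xH x0; rewrite loc => /saito_of_free[Th [U sA]].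
have sx := is_log_sub (@restriction_arr_loc x) (logmodP s).
have [t lt tE] := restr_surj_saito sd HAx sA sx.
(* At x the restriction is divided by the [Bpoly] of the localization, globally by that of A. The
   quotient k', lifted through [sigma], makes up the difference. *)
have [k' k'E] := Bpoly_loc x.
set gx := \prod_(L <- _ | _) _.
have [|u uE] := @logmod_elt _ _ A p.+1 ((gx * sigma k') *: t).
  apply: is_logZ_away lt => L LA.
  have [M MA|h|h] := @away_loc x L (H |` A)%fset LA; first by rewrite in_fset1U MA orbT.
    by left.
  by right; exact: dvdr_mulr.
exists u; apply: ii; rewrite gE uE restrZ tE rmorphM (phi_sigma sd) -mulrC.
transitivity (phi gx *: i s); last by symmetry; exact: linearZ.
by rewrite iE !scalerA k'E; congr (_ *: _); ring.
Qed.

End ResidueSequences.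

(** * Tameness by induction on the defining rules *)

Section TameInductively.
Variable K : fieldType.
Variable SF : forall l, arrangement K l -> Prop.
Hypothesis SF_free : forall l (A : arrangement K l), SF A -> free_arrangement A.

Lemma localization_locally_free l (A : arrangement K l) X :
  stairly_locally_free SF A X -> forall x, x \in X -> x != 0 -> free_arrangement (localization A x).
Proof. by move=> h x xX x0; apply/SF_free/h. Qed.

Lemma tame_deletion n (A : arrangement K n.+1) (H : hyperplane K n.+1) :
  (3 <= n)%N -> H \notin A ->
  (forall x, x \in val H -> x != 0 -> free_arrangement (localization (H |` A)%fset x)) ->
  (forall x, x \in val H -> x != 0 -> free_arrangement (localization A x)) ->
  (forall p, pdim_le p (logmod A p)) -> forall p, (p + 3 <= n.+1)%N ->
  pdim_le p (logmod (H |` A)%fset p).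
Proof.
move=> n3 HA freeH freeA pdA; have n0 : (0 < n)%N by exact: leq_trans n3.
have [Phi [psi [nu [r sd]]]] := section_data_exists H n0.
pose B := restriction_arr r A.
(* The bound for the forms of A^H is carried along because the deletion rule gives no hypothesis on
   A^H. The residue sequence uses it in degree p to bound degree p + 1 of the enlarged arrangement,
   and the restriction sequence then restores it in degree p + 1. *)
suff main p : (p + 3 <= n.+1)%N -> pdim_le p (logmod (H |` A)%fset p) /\
    pdim_le p.+1 (resmod (subst_mx Phi) (logmod B p)).
  by move=> p /main[].
elim: p => [_|p IH pn].
  split; first exact: logmod0_projective.
  apply: (pdim_resmod (al := form_of H)); last exact: logmod0_projective.
  - by move=> x /eqP; rewrite mulf_eq0 (negPf (form_of_neq0 H)) => /eqP.
  - exact: subst_section_surj sd.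
  - exact: subst_section_ker sd.
have [|_ pdB] := IH; first by lia.
have [f [g s]] := residue_ses sd n0 HA pn (pdA p.+1) freeA.
have pdHA := pdim_le_ext s (pdA p.+1) pdB.
have [f' [g' s']] := restr_ses sd n0 HA pn pdHA freeH.
split=> //; exact: pdim_le_coker s' pdHA (pdim_leS (pdA p.+1)).
Qed.

(** Tameness of A^H bounds M^p(A^H) by p over its own ring, hence by p + 1 over S, which is what the
    residue sequence requires in degree p + 1. *)
Lemma tame_restriction n (A : arrangement K n.+1) (H : hyperplane K n.+1)
    Phi psi nu r (sd : section_data H Phi psi nu r) :
  (3 <= n)%N -> H \notin A ->
  (forall x, x \in val H -> x != 0 -> free_arrangement (localization A x)) ->
  (forall p, pdim_le p (logmod A p)) -> (forall p, pdim_le p (logmod (restriction_arr r A) p)) ->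
  forall p, (p + 3 <= n.+1)%N -> pdim_le p (logmod (H |` A)%fset p).
Proof.
move=> n3 HA freeA pdA pdB [_|p pn]; first exact: logmod0_projective.
have n0 : (0 < n)%N by exact: leq_trans n3.
have [f [g s]] := residue_ses sd n0 HA pn (pdA p.+1) freeA.
apply: (pdim_le_ext s (pdA p.+1)).
apply: (pdim_resmod (al := form_of H)) (pdB p).
- by move=> x /eqP; rewrite mulf_eq0 (negPf (form_of_neq0 H)) => /eqP.
- exact: subst_section_surj sd.
- exact: subst_section_ker sd.
Qed.

Lemma logmod_pdim_high l (A : arrangement K l) p : (l <= p + 2)%N -> pdim_le p (logmod A p).
Proof. by move=> lp; apply: pdim_le_leq (logmod_pdim A p); lia. Qed.

Lemma inductively_tame_pdim l (A : arrangement K l) :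
  inductively_tame SF A -> forall p, pdim_le p (logmod A p).
Proof.
elim=> {l A} [l A l3 [|p]|l p|l A H l4 HA lf lf' _ IH p|l A H phi B l4 HA lf' _ IH rest _ IHB p].
(* For l <= 3 only p = 0 falls outside the range l <= p + 2 of [logmod_pdim_high]. *)
- exact: logmod0_projective.
- by apply: logmod_pdim_high; lia.
- by apply: (@pdim_le_leq _ 0) => //; exact: logmod_empty_projective.
- have [/logmod_pdim_high|lp] := leqP l (p + 2); first exact.
  case: l => [//|n] in A H l4 HA lf lf' IH lp *.
  have nH : H \notin (A `\ H)%fset by rewrite fsetD11.
  rewrite -(fsetD1K HA); apply: tame_deletion IH _ _ => //; last by lia.
  + by rewrite (fsetD1K HA); exact: localization_locally_free.
  + exact: localization_locally_free.
- have [/logmod_pdim_high|lp] := leqP l.+1 (p + 2); first exact.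
  have nH : H \notin (A `\ H)%fset by rewrite fsetD11.
  have [|Phi [psi [nu [r [sd BE]]]]] := restriction_section _ rest; first by lia.
  rewrite -(fsetD1K HA); apply: (tame_restriction sd) IH _ _ _ => //; last by lia.
  + exact: localization_locally_free.
  + by rewrite -BE.
Qed.

Lemma inductively_tame_tame l (A : arrangement K l) : inductively_tame SF A -> tame A.
Proof. by move=> /inductively_tame_pdim h p _; apply/tame_logmod. Qed.

End TameInductively.

(** * Isomorphisms of intersection lattices *)

Section Flats.
Variables (K : fieldType) (l : nat).
Implicit Types (A B : arrangement K l) (H L : hyperplane K l) (s t : seq (hyperplane K l)).

Definition cap s : {vspace 'rV[K]_l} := (\bigcap_(H <- s) val H)%VS.

Lemma cap_cons H s : cap (H :: s) = (val H :&: cap s)%VS.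
Proof. by rewrite /cap big_cons. Qed.

Lemma mem_cap s x : (x \in cap s) = all (fun H => x \in val H) s.
Proof.
elim: s => [|H s IH]; first by rewrite /cap big_nil memvf.
by rewrite cap_cons memv_cap IH.
Qed.

Lemma sub_cap X s : (X <= cap s)%VS = all (fun H => X <= val H)%VS s.
Proof.
elim: s => [|H s IH]; first by rewrite /cap big_nil subvf.
by rewrite cap_cons subv_cap IH.
Qed.

Lemma cap_eq_mem s t : s =i t -> cap s = cap t.
Proof. by move=> st; apply/vspaceP => x; rewrite !mem_cap; exact: eq_all_r. Qed.

Lemma cap_sub_dim s H : (cap s <= val H)%VS = (\dim (cap (H :: s)) == \dim (cap s)).
Proof.
rewrite cap_cons (dimv_leqif_eq (capvSr _ _)).
by apply/idP/eqP => [/capv_idPr //|<-]; exact: capvSl.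
Qed.

Lemma dim_hyperplane H : (\dim (val H)).+1 = l.
Proof. exact/eqP/(valP H). Qed.

Lemma dim_cap_cons s H : (\dim (cap s) <= (\dim (cap (H :: s))).+1)%N.
Proof.
have := dimv_add_leqif (val H) (cap s); have := dimv_sum_cap (val H) (cap s).
rewrite -cap_cons => e _; have h := dim_hyperplane H.
have : (\dim (val H + cap s) <= l)%N.
  by rewrite (leq_trans (dimvS (subvf _))) // dimvf /dim /= mul1n.
by move: e; lia.
Qed.

Lemma flatP A X :
  reflect (exists2 s, {subset s <= A} & X = cap s) (X \in intersection_lattice A).
Proof.
apply: (iffP (imfsetP _ _ _ _)) => [[s /=]|[s sA ->]].
  by rewrite fpowersetE => /fsubsetP sA ->; exists s.
exists [fset H in s]%fset => /=.
  by rewrite fpowersetE; apply/fsubsetP => H; rewrite !inE; exact: sA.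
by apply: cap_eq_mem => H; rewrite !inE.
Qed.

Definition above A (X : {vspace 'rV[K]_l}) := [seq L <- A | (X <= val L)%VS].

Lemma above_sub A X : {subset above A X <= A}.
Proof. by move=> L; rewrite mem_filter => /andP[]. Qed.

Lemma cap_above A X : X \in intersection_lattice A -> cap (above A X) = X.
Proof.
move=> /flatP[s sA ->]; apply: subv_anti; apply/andP; split.
  rewrite sub_cap; apply/allP => L Ls; have : L \in above A (cap s).
    by rewrite mem_filter sA // andbT; have := subvv (cap s); rewrite sub_cap => /allP->.
  by move=> h; have := subvv (cap (above A (cap s))); rewrite sub_cap => /allP->.
by rewrite sub_cap; apply/allP => L; rewrite mem_filter => /andP[].
Qed.

End Flats.

Section MatroidIso.
Variables (K : fieldType) (l : nat).
Implicit Types (A B : arrangement K l) (H L : hyperplane K l) (s t : seq (hyperplane K l)).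
Implicit Types (f g : hyperplane K l -> hyperplane K l).

(** Equality of rank functions, tested on lists of members. The maps f and g are total and are
    mutually inverse between A and B only. *)
Definition matroid_iso f g A B : Prop :=
  [/\ forall H, H \in A -> f H \in B /\ g (f H) = H,
      forall H, H \in B -> g H \in A /\ f (g H) = H
    & forall s, {subset s <= A} -> \dim (cap (map f s)) = \dim (cap s)].

Lemma matroid_iso_map f g A B s : matroid_iso f g A B -> {subset s <= A} ->
  {subset map f s <= B} /\ map g (map f s) = s.
Proof.
move=> [fA _ _] sA; split=> [H /mapP[L /sA/fA[fL _] ->] //|].
by rewrite -map_comp -[RHS]map_id; apply/eq_in_map => L /sA/fA[].
Qed.

Lemma matroid_iso_sym f g A B : matroid_iso f g A B -> matroid_iso g f B A.
Proof.
move=> [fA gB dA]; split=> // s sB.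
have gs : {subset map g s <= A} by move=> H /mapP[L /sB/gB[gL _] ->].
rewrite -(dA _ gs) -map_comp; congr (\dim (cap _)); rewrite -[RHS]map_id.
by apply/esym/eq_in_map => L /sB/gB[].
Qed.

Lemma matroid_iso_cap f g A B s H : matroid_iso f g A B -> {subset s <= A} -> H \in A ->
  (cap (map f s) <= val (f H))%VS = (cap s <= val H)%VS.
Proof.
move=> [_ _ dA] sA HA; rewrite !cap_sub_dim -map_cons !dA // => L.
by rewrite inE => /orP[/eqP ->|/sA].
Qed.

Lemma matroid_iso_sub f g A B A' B' : matroid_iso f g A B ->
  {subset A' <= A} -> {subset B' <= B} -> (forall H, H \in A -> (f H \in B') = (H \in A')) ->
  matroid_iso f g A' B'.
Proof.
move=> [fA gB dA] sA sB fAB; split=> [H HA|H HB|s sA'].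
- by rewrite fAB; [split=> //; have [] := fA H (sA _ HA)|exact: sA].
- have [gA e] := gB H (sB _ HB); split=> //; by rewrite -(fAB _ gA) e.
- by apply: dA => L /sA'; exact: sA.
Qed.

(** A flat is the intersection of the members above it, and whether a flat lies in a member is a
    matter of dimensions. So X goes to the intersection of the images of the members above X. *)
Lemma matroid_iso_lattice f g A B : matroid_iso f g A B -> lattice_iso A B.
Proof.
move=> m; have [fA gB _] := m.
have flat_cap f' g' A' B' (m' : matroid_iso f' g' A' B') X :
    cap (map f' (above A' X)) \in intersection_lattice B'.
  have [h _] := matroid_iso_map m' (@above_sub _ _ A' X).
  by apply/flatP; exists (map f' (above A' X)).
have le f' g' A' B' (m' : matroid_iso f' g' A' B') X Y : X \in intersection_lattice A' ->
    Y \in intersection_lattice A' ->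
    (cap (map f' (above A' X)) <= cap (map f' (above A' Y)))%VS = (X <= Y)%VS.
  move=> hX hY; rewrite sub_cap -[in RHS](cap_above hX) -[in RHS](cap_above hY) sub_cap.
  rewrite all_map; apply: eq_in_all => L /above_sub LA /=.
  by apply: (matroid_iso_cap m') => //; exact: above_sub.
have inv f' g' A' B' (m' : matroid_iso f' g' A' B') X : X \in intersection_lattice A' ->
    cap (map g' (above B' (cap (map f' (above A' X))))) = X.
  move=> hX; have [fA' gB' _] := m'; rewrite -[RHS](cap_above hX); apply: cap_eq_mem => L.
  have key M : M \in A' -> (f' M \in above B' (cap (map f' (above A' X)))) = (M \in above A' X).
    move=> MA; rewrite !mem_filter MA (fA' M MA).1 !andbT (matroid_iso_cap m') //; last exact: above_sub.
    by rewrite cap_above.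
  apply/mapP/idP => [[M hM ->]|LX].
    by have [gA e] := gB' M (above_sub hM); rewrite -(key _ gA) e.
  have LA := above_sub LX; exists (f' L); first by rewrite key.
  by rewrite (fA' L LA).2.
have m' := matroid_iso_sym m.
exists (fun X => [` flat_cap _ _ _ _ m (val X)]%fset); split.
  exists (fun Y => [` flat_cap _ _ _ _ m' (val Y)]%fset) => X; apply: val_inj => /=.
    by apply: (inv _ _ _ _ m); exact: valP.
  by apply: (inv _ _ _ _ m'); exact: valP.
by move=> X Y; rewrite /flat_le /=; apply: (le _ _ _ _ m); exact: valP.
Qed.

Lemma lattice_iso_flats A B : lattice_iso A B ->
  exists F G : {vspace 'rV[K]_l} -> {vspace 'rV[K]_l},
  [/\ forall X, X \in intersection_lattice A -> F X \in intersection_lattice B /\ G (F X) = X,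
      forall Y, Y \in intersection_lattice B -> G Y \in intersection_lattice A /\ F (G Y) = Y,
      forall X Y, X \in intersection_lattice A -> Y \in intersection_lattice A ->
        (F X <= F Y)%VS = (X <= Y)%VS
    & forall X Y, X \in intersection_lattice B -> Y \in intersection_lattice B ->
        (G X <= G Y)%VS = (X <= Y)%VS].
Proof.
move=> [f [[g fK gK] le]].
pose F X := oapp (fun Z => val (f Z)) X (insub X).
pose G X := oapp (fun Z => val (g Z)) X (insub X).
have FE X (h : X \in intersection_lattice A) : F X = val (f [` h]%fset) by rewrite /F insubT.
have GE X (h : X \in intersection_lattice B) : G X = val (g [` h]%fset) by rewrite /G insubT.
exists F, G; split=> [X h|Y h|X Y hX hY|X Y hX hY].
- rewrite FE; split; first exact: valP.
  rewrite (GE _ (valP _)) (_ : [` _]%fset = f [` h]%fset) ?fK //; exact: val_inj.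
- rewrite GE; split; first exact: valP.
  rewrite (FE _ (valP _)) (_ : [` _]%fset = g [` h]%fset) ?gK //; exact: val_inj.
- by rewrite !FE; have := le [` hY]%fset [` hX]%fset.
- by rewrite !GE; have := le (g [` hY]%fset) (g [` hX]%fset); rewrite !gK => e; exact: (esym e).
Qed.

(** Intersecting with one more hyperplane lowers dim X by at most 1, while dim (F X) drops by at
    least 1 whenever X shrinks. *)
Lemma dim_flat_le A B (F : {vspace 'rV[K]_l} -> {vspace 'rV[K]_l}) :
  (forall X, X \in intersection_lattice A -> F X \in intersection_lattice B) ->
  (forall X Y, X \in intersection_lattice A -> Y \in intersection_lattice A ->
        (F X <= F Y)%VS = (X <= Y)%VS) ->
  forall X, X \in intersection_lattice A -> (\dim (F X) <= \dim X)%N.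
Proof.
move=> FA le X /flatP[s + ->]; elim: s => [_|H s IH sA].
  by rewrite {2}/cap big_nil; apply/dimvS/subvf.
have sA' : {subset s <= A} by move=> L Ls; apply: sA; rewrite inE Ls orbT.
have hs : cap s \in intersection_lattice A by apply/flatP; exists s.
have hHs : cap (H :: s) \in intersection_lattice A by apply/flatP; exists (H :: s).
have sub : (cap (H :: s) <= cap s)%VS by rewrite cap_cons capvSr.
have [e|ne] := eqVneq (cap (H :: s)) (cap s); first by rewrite e; exact: IH.
have lt : (\dim (F (cap (H :: s))) < \dim (F (cap s)))%N.
  rewrite (ltn_leqif (dimv_leqif_sup _)) ?le //.
  by apply: contra ne => h; rewrite eqEsubv sub.
by rewrite -ltnS (leq_trans lt) // (leq_trans (IH sA')) // dim_cap_cons.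
Qed.

(** Applying [dim_flat_le] in both directions shows that dimensions are preserved. The members are
    the flats of dimension l - 1, and an order isomorphism carries intersections of members to
    intersections of their images. *)
Lemma lattice_iso_matroid A B : lattice_iso A B -> exists f g, matroid_iso f g A B.
Proof.
move=> /lattice_iso_flats[F [G [FA GB leF leG]]].
have dimF X : X \in intersection_lattice A -> \dim (F X) = \dim X.
  move=> hX; apply/eqP; rewrite eqn_leq.
  rewrite (@dim_flat_le A B F) //=; last by move=> Y /FA[].
  have [hF e] := FA X hX; rewrite -[leqLHS]/(\dim X) -{1}e.
  by apply: (@dim_flat_le B A G) => // Y /GB[].
have dimG X : X \in intersection_lattice B -> \dim (G X) = \dim X.
  by move=> /GB[h e]; rewrite -(dimF _ h) e.
have flat1 (C : arrangement K l) H : H \in C -> val H \in intersection_lattice C.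
  move=> HC; apply/flatP; exists [:: H]; first by move=> L; rewrite inE => /eqP ->.
  by rewrite /cap big_seq1.
have hyp (C : arrangement K l) X : X \in intersection_lattice C -> (\dim X).+1 = l -> exists2 H, H \in C & X = val H.
  move=> /flatP[[|H s] sC ->] dX.
    by move: dX; rewrite /cap big_nil dimvf /dim /= mul1n => dX; exfalso; lia.
  exists H; first by apply: sC; rewrite mem_head.
  apply/eqP; rewrite eqEdim {1}cap_cons capvSl /=.
  by rewrite -ltnS dX dim_hyperplane.
have fex H : exists H', H \in A -> H' \in B /\ val H' = F (val H).
  have [HA|HA] := boolP (H \in A); last by exists H.
  have h := flat1 A H HA; have [|H' H'B e] := @hyp B (F (val H)) (FA _ h).1.
    by rewrite dimF // dim_hyperplane.
  by exists H'.
have gex H : exists H', H \in B -> H' \in A /\ val H' = G (val H).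
  have [HB|HB] := boolP (H \in B); last by exists H.
  have h := flat1 B H HB; have [|H' H'B e] := @hyp A (G (val H)) (GB _ h).1.
    by rewrite dimG // dim_hyperplane.
  by exists H'.
pose f H := projT1 (cid (fex H)); pose g H := projT1 (cid (gex H)).
have fP H : H \in A -> f H \in B /\ val (f H) = F (val H) by exact: (projT2 (cid (fex H))).
have gP H : H \in B -> g H \in A /\ val (g H) = G (val H) by exact: (projT2 (cid (gex H))).
exists f, g; split=> [H HA|H HB|s sA].
- have [fB e] := fP H HA; split=> //; apply: val_inj; rewrite (gP _ fB).2 e.
  by have [] := FA _ (flat1 A H HA).
- have [gA e] := gP H HB; split=> //; apply: val_inj; rewrite (fP _ gA).2 e.
  by have [] := GB _ (flat1 B H HB).
have hs : cap s \in intersection_lattice A by apply/flatP; exists s.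
rewrite -(dimF _ hs); congr (\dim _); apply: subv_anti; apply/andP; split; last first.
  rewrite sub_cap all_map; apply/allP => L Ls /=; rewrite (fP _ (sA _ Ls)).2 leF ?flat1 ?sA //.
  by have := subvv (cap s); rewrite sub_cap => /allP->.
have fs : {subset map f s <= B} by move=> H /mapP[L /sA/fP[h _] ->].
have hfs : cap (map f s) \in intersection_lattice B by apply/flatP; exists (map f s).
have [hG <-] := GB _ hfs; rewrite leF // sub_cap; apply/allP => L Ls.
have [_ <-] := FA _ (flat1 A L (sA _ Ls)); rewrite -(fP _ (sA _ Ls)).2 leG ?flat1 ?(fP _ (sA _ Ls)).1 //.
have := subvv (cap (map f s)); rewrite sub_cap => /allP->//; exact: map_f.
Qed.

End MatroidIso.

Lemma count_split (T : Type) (a p : pred T) (s : seq T) :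
  (count (fun x => a x && ~~ p x) s + count (fun x => a x && p x) s = count a s)%N.
Proof. by elim: s => //= x s <-; case: (a x); case: (p x) => /=; lia. Qed.

(** * Points lying on prescribed members and on no others *)

Section GenericPoints.
Variables (K : fieldType) (l : nat).
Implicit Types (A B : arrangement K l) (H L : hyperplane K l) (s t : seq (hyperplane K l)).
Implicit Types (X Y : {vspace 'rV[K]_l}) (E : seq 'rV[K]_l).

Lemma enum_vectors (cs : seq K) : (forall c, c \in cs) ->
  exists2 E : seq 'rV[K]_l, uniq E & forall x, x \in E.
Proof.
move=> csP; pose F := {ffun 'I_l -> seq_sub cs}.
exists (undup [seq \row_i val (h i) | h : F]); first exact: undup_uniq.
move=> x; rewrite mem_undup; apply/mapP.
exists [ffun i => SeqSub (csP (x 0 i))]; first by rewrite mem_enum.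
by apply/rowP => i; rewrite !mxE ffunE.
Qed.

Lemma count_vspace_le E X Y : uniq E -> (forall x, x \in E) -> \dim X = \dim Y ->
  (count (fun x => (x != 0%R) && (x \in X)) E <= count (fun x => (x != 0%R) && (x \in Y)) E)%N.
Proof.
move=> uE allE e.
pose h x := \sum_(i < \dim Y) coord (vbasis X) (cast_ord (esym e) i) x *: (vbasis Y)`_i.
have hB x y : h x - h y = h (x - y).
  by rewrite /h -sumrB; apply: eq_bigr => i _; rewrite linearB scalerBl.
have h0 x : x \in X -> h x = 0 -> x = 0.
  move=> xX hx; have /freeP fY := basis_free (vbasisP Y).
  rewrite (coord_vbasis xX) big1 // => i _.
  by have := fY _ hx (cast_ord e i); rewrite cast_ordK => ->; rewrite scale0r.
have hY x : h x \in Y.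
  apply: memv_suml => i _; apply/memvZ/vbasis_mem/mem_nth; by rewrite size_tuple.
rewrite -2!size_filter -(size_map h); apply: uniq_leq_size.
  rewrite map_inj_in_uniq ?filter_uniq // => x y.
  rewrite !mem_filter => /andP[/andP[_ xX] _] /andP[/andP[_ yX] _] xy.
  by apply/eqP; rewrite -subr_eq0; apply/eqP/h0; [exact: rpredB|rewrite -hB xy subrr].
move=> _ /mapP[x + ->]; rewrite !mem_filter => /andP[/andP[x0 xX] _].
by rewrite hY allE !andbT; apply: contra_neq x0; exact: h0.
Qed.

Definition generic_count E s t :=
  count (fun x => [&& x != 0, x \in cap s & all (fun L => x \notin val L) t]) E.

Lemma generic_countS E s L t :
  (generic_count E s (L :: t) + generic_count E (L :: s) t = generic_count E s t)%N.
Proof.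
rewrite /generic_count -[RHS](count_split _ (fun x => x \in val L)).
congr (_ + _)%N; apply: eq_count => x /=; rewrite ?cap_cons ?memv_cap.
  by case: (x != 0); case: (x \in cap s); case: (x \in val L); case: (all _ _).
by case: (x != 0); case: (x \in cap s); case: (x \in val L); case: (all _ _).
Qed.

Lemma generic_count_iso f g A B E s t : uniq E -> (forall x, x \in E) ->
  matroid_iso f g A B -> {subset s <= A} -> {subset t <= A} ->
  generic_count E s t = generic_count E (map f s) (map f t).
Proof.
move=> uE allE [_ _ dA]; elim: t s => [|L t IH] s sA tA.
  rewrite /generic_count /=; under eq_count do rewrite andbT.
  under [RHS]eq_count do rewrite andbT.
  by apply/eqP; rewrite eqn_leq !count_vspace_le ?dA.
have LA : L \in A by apply: tA; rewrite mem_head.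
have tA' : {subset t <= A} by move=> M Mt; apply: tA; rewrite inE Mt orbT.
have sA' : {subset L :: s <= A} by move=> M; rewrite inE => /orP[/eqP ->|/sA].
have := generic_countS E s L t; have := generic_countS E (map f s) (f L) (map f t).
rewrite (IH s) // (IH (L :: s)) //= => <-; exact: addIn.
Qed.

(** If the point x found so far lies on L, move it to x + c z with z in X outside L. This leaves L
    for c nonzero, and each other member excludes at most one value of c. *)
Lemma avoid_hyperplanes X t : (forall cs : seq K, exists c, c \notin cs) ->
  (forall L, L \in t -> ~~ (X <= val L)%VS) ->
  exists2 x, x \in X & forall L, L \in t -> x \notin val L.
Proof.
move=> infK; elim: t => [|L t IH] tX; first by exists 0; [exact: mem0v|].
have [M Mt|x xX xt] := IH; first by apply: tX; rewrite inE Mt orbT.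
have [z zX zL] : exists2 z, z \in X & z \notin val L.
  by apply/subvPn/tX/mem_head.
have [xL|xL] := boolP (x \in val L); last first.
  by exists x => // M; rewrite inE => /orP[/eqP ->|/xt].
pose v M := (x *m defining_vector M) 0 0; pose w M := (z *m defining_vector M) 0 0.
have [c] := infK (0 :: [seq - v M / w M | M <- t]); rewrite inE negb_or => /andP[c0 ct].
exists (x + c *: z); first by rewrite rpredD ?rpredZ.
move=> M; rewrite inE => /orP[/eqP ->|Mt].
  by rewrite rpredDl // rpredZeq (negPf c0).
have := xt M Mt; apply: contra; rewrite !hyperplaneP => /eqP e.
have {}e : v M + c * w M = 0.
  transitivity (((x + c *: z) *m defining_vector M) 0 0); last by rewrite e mxE.
  by rewrite mulmxDl -scalemxAl [RHS]mxE [X in _ = _ + X]mxE.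
have [w0|w0] := eqVneq (w M) 0.
  apply/eqP/rowP => i; rewrite ord1 [RHS]mxE.
  by move: e; rewrite w0 mulr0 addr0.
case/negP: ct; apply/mapP; exists M => //.
by move/eqP: e; rewrite addrC addr_eq0 => /eqP <-; rewrite mulfK.
Qed.

(* Over a finite field avoiding the other hyperplanes is not automatic; there the
   generic points are counted by deletion-restriction, and their number depends
   only on the dimensions of the flats. *)
Lemma generic_point f g A B s t y : matroid_iso f g A B ->
  {subset s <= A} -> {subset t <= A} -> y != 0 -> y \in cap (map f s) ->
  (forall L, L \in t -> y \notin val (f L)) ->
  exists x, [/\ x != 0, x \in cap s & forall L, L \in t -> x \notin val L].
Proof.
move=> m sA tA y0 ys yt.
have [[cs csP]|infK] := pselect (exists cs : seq K, forall c, c \in cs).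
  have [E uE allE] := enum_vectors csP.
  have : (0 < generic_count E (map f s) (map f t))%N.
    rewrite -has_count; apply/hasP; exists y => //=; rewrite y0 ys all_map /=.
    by apply/allP => L /yt.
  rewrite -(generic_count_iso uE allE m sA tA) -has_count => /hasP[x _ /and3P[x0 xs /allP xt]].
  by exists x.
have {}infK (cs : seq K) : exists c, c \notin cs.
  apply: contrapT => h; apply: infK; exists cs => c; apply: contrapT => /negP hc.
  by apply: h; exists c.
have [L Lt|x xs xt] := @avoid_hyperplanes (cap s) t infK.
  rewrite -(matroid_iso_cap m sA (tA _ Lt)); apply: contra (yt _ Lt) => /subvP; exact.
(* The point obtained can be 0 only when [t] is empty. Then any nonzero vector of [cap s] will do,
   and there is one because this space has the dimension of its image flat, which contains y. *)
have [x0|x0] := eqVneq x 0; last by exists x.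
have t0 : t = [::].
  case: t xt {tA yt} => [//|L t xt].
  by have := xt L (mem_head _ _); rewrite x0 mem0v.
have X0 : cap s != 0%VS.
  have [_ _ dA] := m; rewrite -dimv_eq0 -(dA _ sA) dimv_eq0.
  by apply: contraNneq y0 => e; move: ys; rewrite e memv0.
exists (vpick (cap s)); rewrite vpick0 X0 memv_pick t0; split=> // L.
Qed.

End GenericPoints.

(** * Dimensions of intersections in a restriction *)

Section SectionLattice.
Variables (K : fieldType) (n : nat) (H : hyperplane K n.+1) (Phi : 'M[K]_(n, n.+1)).
Variables (psi : 'M[K]_(n.+1, n)) (nu : 'rV[K]_n.+1) (r : hyperplane K n.+1 -> hyperplane K n).
Hypothesis sd : section_data H Phi psi nu r.
Implicit Type s : seq (hyperplane K n.+1).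

Definition section_map : 'Hom('rV[K]_n, 'rV[K]_n.+1) := linfun (mulmxr Phi).

Lemma section_mapE u : section_map u = u *m Phi.
Proof. by rewrite lfunE. Qed.

Lemma lker_section_map : lker section_map = 0%VS.
Proof.
apply/eqP/lker0P => u v; rewrite !section_mapE => /(congr1 (mulmxr psi)) /=.
by rewrite -!mulmxA (sd_retr sd) !mulmx1.
Qed.

Lemma section_map_cap s : (forall L, L \in s -> L != H) ->
  (section_map @: cap (map r s))%VS = cap (H :: s).
Proof.
move=> sH; have key u : (u \in cap (map r s)) = (u *m Phi \in cap s).
  rewrite !mem_cap all_map; apply: eq_in_all => L /sH LH /=.
  exact: (hyperplane_of_section sd LH).
apply/vspaceP => v; rewrite cap_cons memv_cap; apply/memv_imgP/andP => [[u uX ->]|[vH vs]].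
  rewrite section_mapE -key uX; split=> //.
  by rewrite hyperplaneP -mulmxA (sd_Phi sd) mulmx0.
have e : v *m psi *m Phi = v.
  have := congr1 (fun M => v *m M) (sd_dec sd); rewrite mulmxDr mulmx1 !mulmxA.
  by move: vH; rewrite hyperplaneP => /eqP ->; rewrite mul0mx addr0.
by exists (v *m psi); rewrite ?section_mapE ?key e.
Qed.

Lemma dim_cap_section s : (forall L, L \in s -> L != H) ->
  \dim (cap (map r s)) = \dim (cap (H :: s)).
Proof.
move=> /section_map_cap <-; rewrite limg_dim_eq //.
by rewrite lker_section_map capv0.
Qed.

Lemma section_is_restriction (A : arrangement K n.+1) :
  is_restriction A H section_map (restriction_arr r (A `\ H)%fset).
Proof.
have img1 L : L != H -> (section_map @: val (r L))%VS = (val H :&: val L)%VS.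
  move=> LH; have := @section_map_cap [:: L]; rewrite /= [cap (H :: _)]cap_cons /cap !big_seq1; apply.
  by move=> M; rewrite inE => /eqP ->.
split; first exact: lker_section_map.
  by have := @section_map_cap [::]; rewrite /= cap_cons /cap !big_nil capvf; apply.
apply/fsetP => X; apply/imfsetP/imfsetP => [[Y /=]|[L /= LA ->]].
  move=> /imfsetP[L /= LA ->] ->; exists L => //; apply: img1.
  by move: LA; rewrite in_fsetD1 => /andP[].
exists (r L); first by apply/imfsetP; exists L.
by rewrite img1 //; move: LA; rewrite in_fsetD1 => /andP[].
Qed.

(** Writes equality of traces on H in terms of dimensions, so that a [matroid_iso] transports it. *)
Lemma section_eq L M : L != H -> M != H ->
  (r L == r M) = (\dim (cap [:: H; M; L]) == \dim (cap [:: H; L])).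
Proof.
move=> LH MH; have h s : {subset s <= [:: M; L]} -> forall L', L' \in s -> L' != H.
  by move=> sub L' /sub; rewrite !inE => /orP[] /eqP ->.
rewrite -(@dim_cap_section [:: M; L]); last exact: h.
rewrite -(@dim_cap_section [:: L]); last by apply: h => L'; rewrite !inE => ->; rewrite orbT.
rewrite /= -cap_sub_dim /cap big_seq1.
by apply/eqP/idP => [->|/hyperplane_sub_eq]; first exact: subvv.
Qed.

End SectionLattice.

Section RestrictionIso.
Variables (K : fieldType) (n : nat) (H H' : hyperplane K n.+1).
Variables (Phi Phi' : 'M[K]_(n, n.+1)) (psi psi' : 'M[K]_(n.+1, n)) (nu nu' : 'rV[K]_n.+1).
Variables (r r' : hyperplane K n.+1 -> hyperplane K n).
Hypothesis sd : section_data H Phi psi nu r.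
Hypothesis sd' : section_data H' Phi' psi' nu' r'.

(** Choose for every trace X a member e X inducing it. By [section_eq] the trace of f (e X) does not
    depend on this choice, and dimensions in the restriction are those of intersections with H. *)
Lemma restriction_matroid_iso f g A A' : matroid_iso f g A A' -> H \in A -> f H = H' ->
  exists f1 g1, matroid_iso f1 g1 (restriction_arr r (A `\ H)%fset) (restriction_arr r' (A' `\ H')%fset).
Proof.
move=> [fA gA' dA] HA fH; have [H'A' gH'] := fA H HA; rewrite fH in H'A' gH'.
have fD L : L \in (A `\ H)%fset -> f L \in (A' `\ H')%fset.
  rewrite !in_fsetD1 => /andP[LH LA]; rewrite (fA L LA).1 andbT.
  by apply: contra_neq LH => /(congr1 g); rewrite (fA L LA).2 gH'.
have gD L : L \in (A' `\ H')%fset -> g L \in (A `\ H)%fset.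
  rewrite !in_fsetD1 => /andP[LH LA]; rewrite (gA' L LA).1 andbT.
  by apply: contra_neq LH => /(congr1 f); rewrite (gA' L LA).2 fH.
have inA C (G L : hyperplane K n.+1) : L \in (C `\ G)%fset -> L \in C /\ L != G.
  by rewrite in_fsetD1 => /andP[].
have req L M : L \in (A `\ H)%fset -> M \in (A `\ H)%fset -> (r L == r M) = (r' (f L) == r' (f M)).
  move=> hL hM; have [LA LH] := inA _ _ _ hL; have [MA MH] := inA _ _ _ hM.
  have [fLA fLH] := inA _ _ _ (fD _ hL); have [fMA fMH] := inA _ _ _ (fD _ hM).
  rewrite (section_eq sd) // (section_eq sd') //.
  by rewrite -(dA [:: H; M; L]) -1?(dA [:: H; L]) /= ?fH // => G; rewrite !inE;
     do ?case/orP; move=> /eqP ->.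
have sec C (rr : hyperplane K n.+1 -> hyperplane K n) : exists e, forall X, X \in restriction_arr rr C ->
    e X \in C /\ rr (e X) = X.
  have ex X : exists L, X \in restriction_arr rr C -> L \in C /\ rr L = X.
    have [/imfsetP[L /= LC ->]|nX] := boolP (X \in restriction_arr rr C); first by exists L.
    by exists H.
  by exists (fun X => projT1 (cid (ex X))) => X; exact: (projT2 (cid (ex X))).
have [e eP] := sec (A `\ H)%fset r; have [e' e'P] := sec (A' `\ H')%fset r'.
have mem C (rr : hyperplane K n.+1 -> hyperplane K n) L : L \in C -> rr L \in restriction_arr rr C.
  by move=> LC; apply/imfsetP; exists L.
exists (fun X => r' (f (e X))), (fun X => r (g (e' X))); split=> [X XB|X XB|s sB].
- have [eA re] := eP X XB; have feD := fD _ eA; have fB := mem _ r' _ feD; split=> //.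
  have [e'A re'] := e'P _ fB; rewrite -[RHS]re; apply/eqP.
  rewrite req ?gD // (gA' _ (inA _ _ _ e'A).1).2 re'; exact: eqxx.
- have [eA re] := e'P X XB; have feD := gD _ eA; have fB := mem _ r _ feD; split=> //.
  have [e'A re'] := eP _ fB; rewrite -[RHS]re.
  by have := req _ _ e'A feD; rewrite re' eqxx (gA' _ (inA _ _ _ eA).1).2 => /esym/eqP.
have eD : {subset map e s <= (A `\ H)%fset}.
  by move=> L /mapP[X /sB/eP[h _] ->].
have se : s = map r (map e s).
  by rewrite -map_comp -[LHS]map_id; apply/eq_in_map => X /sB/eP[_ h] /=; rewrite h.
rewrite [in RHS]se (dim_cap_section sd); last by move=> L /eD/inA[].
rewrite (map_comp (r' \o f) e) (map_comp r' f) (dim_cap_section sd'); last first.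
  by move=> _ /mapP[L /eD/fD/inA[_ h] ->].
rewrite -fH -map_cons dA // => L; rewrite inE => /orP[/eqP ->//|/eD/inA[]//].
Qed.

End RestrictionIso.

(** * Transport of inductive tameness along an isomorphism *)

Section TameCombinatorial.
Variable K : fieldType.
Variable SF : forall l, arrangement K l -> Prop.
Hypothesis SF_lattice : forall l (A B : arrangement K l), lattice_iso A B -> SF A -> SF B.

(** Local freeness speaks of points, which an isomorphism of lattices does not carry over. So for y
    a nonzero x must be found on exactly those members whose images contain y, by
    [generic_point]. *)
Lemma localization_matroid_iso l f g (A B : arrangement K l) H y : matroid_iso f g A B ->
  H \in A -> y \in val (f H) -> y != 0 ->
  exists x, [/\ x \in val H, x != 0 & forall L, L \in A -> (y \in val (f L)) = (x \in val L)].
Proof.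
move=> m HA yH y0.
pose s := [seq L <- A | y \in val (f L)]; pose t := [seq L <- A | y \notin val (f L)].
have [||||x [x0 xs xt]] := @generic_point _ _ f g A B s t y m _ _ y0.
- by move=> L; rewrite mem_filter => /andP[].
- by move=> L; rewrite mem_filter => /andP[].
- rewrite mem_cap all_map; apply/allP => L; rewrite mem_filter => /andP[] //.
- by move=> L; rewrite mem_filter => /andP[].
have key L : L \in A -> (y \in val (f L)) = (x \in val L).
  move=> LA; apply/idP/idP => [yL|].
    by move: xs; rewrite mem_cap => /allP; apply; rewrite mem_filter yL.
  by apply: contraTT => yL; apply: xt; rewrite mem_filter yL.
by exists x; rewrite -key.
Qed.

Lemma stairly_locally_free_iso l f g (A B A' B' : arrangement K l) H : matroid_iso f g A B ->
  H \in A -> {subset A' <= A} -> {subset B' <= B} ->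
  (forall L, L \in A -> (f L \in B') = (L \in A')) ->
  stairly_locally_free SF A' (val H) -> stairly_locally_free SF B' (val (f H)).
Proof.
move=> m HA sA sB fAB lf y yH y0.
have [x [xH x0 key]] := localization_matroid_iso m HA yH y0.
apply: SF_lattice (lf x xH x0); apply: matroid_iso_lattice (f) (g) _ _ _.
apply: (matroid_iso_sub m) => [L|L|L LA]; rewrite ?in_fset /= ?inE.
- by case/andP => /sA.
- by case/andP => /sB.
- by rewrite fAB // key.
Qed.

Lemma inductively_tame_iso l (A : arrangement K l) : inductively_tame SF A ->
  forall f g B, matroid_iso f g A B -> inductively_tame SF B.
Proof.
have del m f g (C D : arrangement K m) H : matroid_iso f g C D -> H \in C ->
    forall L, L \in C -> (f L \in (D `\ f H)%fset) = (L \in (C `\ H)%fset).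
  move=> [fC _ _] HC L LC; rewrite !in_fsetD1 (fC L LC).1 LC !andbT.
  apply/idP/idP; apply: contra => /eqP e; first by rewrite e.
  by apply/eqP; rewrite -(fC L LC).2 e (fC H HC).2.
have delS m (C : arrangement K m) H : {subset (C `\ H)%fset <= C}.
  by move=> L; rewrite in_fsetD1 => /andP[].
elim=> {l A} [l A l3|l|l A H l4 HA lf lf' _ IH|l A H phi A1 l4 HA lf' _ IH rest _ IH1] f g B iso.
- exact: IT_small.
- suff -> : B = fset0 by exact: IT_empty.
  apply/fsetP => H; rewrite in_fset0; apply/negP => HB.
  by have [_ gB _] := iso; have [] := gB H HB; rewrite in_fset0.
- have fHB : f H \in B by have [fA _ _] := iso; have [] := fA H HA.
  apply: (IT_deletion l4 fHB).
  + apply: (stairly_locally_free_iso iso HA) lf => // L LA.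
    by have [fA _ _] := iso; rewrite (fA L LA).1 LA.
  + exact: (stairly_locally_free_iso iso HA (delS _ _ _) (delS _ _ _) (del _ _ _ _ _ _ iso HA)) lf'.
  + apply: IH (f) (g) _ _; exact: matroid_iso_sub iso (delS _ _ _) (delS _ _ _) (del _ _ _ _ _ _ iso HA).
have fHB : f H \in B by have [fA _ _] := iso; have [] := fA H HA.
have l0 : (0 < l)%N by lia.
have [Phi [psi [nu [r [sd A1E]]]]] := restriction_section l0 rest.
(* The restriction rule accepts any identification of f H with K^l, so any coordinates on f H may be
   taken, unrelated to [phi]. *)
have [Phi' [psi' [nu' [r' sd']]]] := section_data_exists (f H) l0.
have [f1 [g1 m1]] := restriction_matroid_iso sd sd' iso HA erefl.
apply: (IT_restriction l4 fHB _ _ (section_is_restriction sd' B)).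
- exact: (stairly_locally_free_iso iso HA (delS _ _ _) (delS _ _ _) (del _ _ _ _ _ _ iso HA)) lf'.
- apply: IH (f) (g) _ _; exact: matroid_iso_sub iso (delS _ _ _) (delS _ _ _) (del _ _ _ _ _ _ iso HA).
- by apply: IH1 (f1) (g1) _ _; rewrite A1E.
Qed.

End TameCombinatorial.

Theorem theorem5p3 (K : fieldType)
  (stair_free : forall l : nat, arrangement K l -> Prop)
  (stair_free_is_free : forall (l : nat) (A : arrangement K l),
     stair_free l A -> free_arrangement A)
  (stair_free_combinatorial : forall (l : nat) (A B : arrangement K l),
     lattice_iso A B -> stair_free l A -> stair_free l B)
  (l : nat) (A : arrangement K l) :
  inductively_tame stair_free A ->
  tame A /\ (forall B : arrangement K l, lattice_iso A B -> tame B).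
Proof.
move=> ITA; split=> [|B /lattice_iso_matroid[f [g iso]]].
  exact: inductively_tame_tame ITA.
apply: inductively_tame_tame (stair_free_is_free) _ _ _.
exact: (inductively_tame_iso stair_free_combinatorial ITA iso).
Qed.
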